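(* Let $n\in\mathbb{N}$, $n>1$, and let $\mathbb{H}^n$ be equipped with the Korányi distance $d_{\mathbb{H}^n}$. Then: (1) for every $1\le p<4$ there is a $1$-regular curve $\Gamma$ in $(\mathbb{H}^n,d_{\mathbb{H}^n})$ with $\Gamma\notin\mathrm{GLem}(\beta_{\infty,\mathcal{V}^1(\mathbb{H}^n)},p)$; (2) for every $p>2$ there is a $1$-regular set $E\subset\mathbb{H}^n$ with $E\in\mathrm{GLem}(\beta_{\infty,\mathcal{V}^1(\mathbb{H}^n)},p)$ that is not contained in a $1$-regular curve.
   Context: Heisenberg group: $\mathbb{H}^n=(\mathbb{R}^{2n}\times\mathbb{R},\cdot)$ with $(x,t)\cdot(x',t')=(x+x',t+t'+\omega(x,x'))$, $\omega(x,x')=\frac12\sum_{i=1}^n(x_ix'_{n+i}-x_{n+i}x'_i)$. Korányi metric: $d_{\mathbb{H}^n}(p,p')=\|p^{-1}\cdot p'\|$, $\|(x,t)\|=(|x|^4+16t^2)^{1/4}$. Horizontal lines: $\mathcal{V}^1(\mathbb{H}^n)=\{p\cdot(V\times\{0\}):p\in\mathbb{H}^n,\ V\subset\mathbb{R}^{2n}\text{ a one-dimensional linear subspace}\}$. A $1$-regular curve is a curve (continuous image of an interval) that is a $1$-regular set. Regular sets: a closed set $E$ with $\mathrm{diam}(E)>0$ is in $\mathrm{Reg}_1(C)$, $C\ge1$, if $C^{-1}r\le\mathcal{H}^1(B_r(x)\cap E)\le Cr$ for all $x\in E$, $r\in(0,2\,\mathrm{diam}(E))$ ($B_r(x)$ open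 ball, $\mathcal{H}^1$ Hausdorff measure, $\mathrm{diam}(E)=+\infty$ if $E$ unbounded); $1$-regular means in $\mathrm{Reg}_1(C)$ for some $C$. Put $\mu=\mathcal{H}^1|_E$. Dyadic systems: if $E$ is bounded let $\mathbb{J}=\{j\in\mathbb{Z}:j\ge j_*\}$ where $2^{-j_*}\le\mathrm{diam}(E)<2^{-j_*+1}$; otherwise $\mathbb{J}=\mathbb{Z}$. It is known that there is $c_0=c_0(C)\in(0,1)$ such that every $E\in\mathrm{Reg}_1(C)$ admits a system of dyadic cubes $\Delta=\bigcup_{j\in\mathbb{J}}\Delta_j$, where each $\Delta_j$ is a family of pairwise disjoint Borel subsets of $E$ (cubes) such that: (1) $E=\bigcup_{Q\in\Delta_j}Q$ for each $j$; (2) if $i\le j$, $Q\in\Delta_i$, $Q'\in\Delta_j$, then $Q'\subset Q$ or $Q\cap Q'=\emptyset$; (3) for $Q'\in\Delta_j$ and $i<j$, $i\in\mathbb{J}$, there is a unique $Q\in\Delta_i$ with $Q'\subset Q$; (4) $\mathrm{diam}(Q)\le c_0^{-1}2^{-j}$ for $Q\in\Delta_j$; (5) for each $Q\in\Delta_j$ there is $x_Q\in E$ with $B_{c_02^{-j}}(x_Q)\cap E\subset Q$. Put $\Delta_{Q_0}=\{Q\in\Delta:Q\subset Q_0\}$ and, for $K>1$, $KQ=\{x\in E:\mathrm{dist}(x,Q)\le(K-1)\mathrm{diam}(Q)\}$. Geometric lemma: let $\mathcal{D}_1(E)$ be the family of bounded Borel subsets of $E$ of positive $\mathcal{H}^1$-measure.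 For $h:\mathcal{D}_1(E)\to[0,1]$ and $p\in(0,\infty)$, $E\in\mathrm{GLem}(h,p)$ means that there is a constant $M$ such that for every dyadic system $\Delta$ on $E$ and every $Q_0\in\Delta$, $\sum_{Q\in\Delta_{Q_0}}h(2Q)^p\mu(Q)\le M\mu(Q_0)$. Coefficients: $\beta_{\infty,\mathcal{V}^1(\mathbb{H}^n)}(S)=\inf_{\ell\in\mathcal{V}^1(\mathbb{H}^n)}\sup_{y\in S}\frac{d_{\mathbb{H}^n}(y,\ell)}{\mathrm{diam}(S)}$ for $0<\mathrm{diam}(S)<\infty$. *)

(* Defs.v *)
From HB Require Import structures.
From mathcomp Require Import all_boot all_order all_algebra.
From mathcomp Require Import ring lra.
From mathcomp Require Import all_classical all_reals all_analysis.

Set Implicit Arguments.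
Unset Strict Implicit.
Unset Printing Implicit Defensive.

Import Order.TTheory GRing.Theory Num.Theory.
Import numFieldNormedType.Exports.

Local Open Scope classical_set_scope.
Local Open Scope ring_scope.


Section metric_space.
Context {R : realType} {T : metricType R}.
Implicit Types (E S Q A : set T) (C c K p : R).

(* The point 0 makes [diam set0 = 0], instead of [-oo]. *)
Definition diam A : \bar R :=
  ereal_sup (0%E |` [set (mdist z.1 z.2)%:E | z in A `*` A]).

Definition hausdorff1_pre (delta : R) A : \bar R :=
  ereal_inf [set (\sum_(0 <= i <oo) diam (U i))%E | U in
    [set U : (set T)^nat | A `<=` \bigcup_i U i /\
                           forall i, (diam (U i) <= delta%:E)%E]].

(* Normalised so that [hausdorff1] is Lebesgue measure on the line. *)
Definition hausdorff1 A : \bar R :=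
  ereal_sup [set hausdorff1_pre delta A | delta in [set delta | 0 < delta]].

Definition Reg1 C E : Prop :=
  [/\ 1 <= C, closed E, (0 < diam E)%E &
   forall x r, E x -> 0 < r -> (r%:E < 2%:E * diam E)%E ->
     ((C^-1 * r)%:E <= hausdorff1 (ball x r `&` E) <= (C * r)%:E)%E].

Definition regular1 E : Prop := exists C, Reg1 C E.

Definition curve E : Prop :=
  exists (I : interval R) (f : R -> T),
    {within [set` I], continuous f} /\ E = f @` [set` I].

Definition regular1_curve E : Prop := curve E /\ regular1 E.

Definition dyadic_index E : set int :=
  [set j | diam E = +oo%E \/
    exists2 j0 : int,
      (((2 : R) ^ (- j0))%:E <= diam E < ((2 : R) ^ (- j0 + 1))%:E)%E & j0 <= j].

Definition borel A : Prop := <<s @open T >> A.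

(* Only the generations [D j] with [j] in [dyadic_index E] are relevant. *)
Record dyadic_system c E (D : int -> set (set T)) : Prop := {
  dyadic_borel : forall j Q, dyadic_index E j -> D j Q -> borel Q /\ Q `<=` E ;
  dyadic_disjoint : forall j, dyadic_index E j -> trivIset (D j) id ;
  dyadic_cover : forall j, dyadic_index E j -> E = \bigcup_(Q in D j) Q ;
  dyadic_nested : forall i j Q Q', dyadic_index E i -> dyadic_index E j ->
    i <= j -> D i Q -> D j Q' -> Q' `<=` Q \/ Q `&` Q' = set0 ;
  dyadic_parent : forall i j Q', dyadic_index E i -> dyadic_index E j ->
    i < j -> D j Q' -> exists! Q, D i Q /\ Q' `<=` Q ;
  dyadic_diam : forall j Q, dyadic_index E j -> D j Q ->
    (diam Q <= (c^-1 * 2 ^ (- j))%:E)%E ;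
  dyadic_ball : forall j Q, dyadic_index E j -> D j Q ->
    exists2 x, E x & ball x (c * 2 ^ (- j)) `&` E `<=` Q
}.

Definition cubes E (D : int -> set (set T)) : set (set T) :=
  \bigcup_(j in dyadic_index E) D j.

Definition dilate K E Q : set T :=
  [set x | E x /\ (edist_inf Q x <= (K - 1)%:E * diam Q)%E].

(* Geometric lemma with respect to the dyadic systems of constant [c]. Cubes
   are subsets of [E], so [hausdorff1] agrees on them with its restriction
   to [E]. *)
Definition GLem c (h : set T -> \bar R) p E : Prop :=
  exists M : R, forall D, dyadic_system c E D -> forall Q0, cubes E D Q0 ->
    (\esum_(Q in [set Q | cubes E D Q /\ Q `<=` Q0])
       (h (dilate 2 E Q) `^ p * hausdorff1 Q) <= M%:E * hausdorff1 Q0)%E.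

(* Meaningful for [0 < diam S < +oo]. *)
Definition beta_infty (L : set (set T)) S : \bar R :=
  ereal_inf [set ereal_sup [set (edist_inf l y * (fine (diam S))^-1%:E)%E | y in S]
            | l in L].

End metric_space.

(* [c0] is a choice of the constant [c0 C] in (0, 1) for which all sets of
   [Reg1 C] have dyadic systems. *)
Definition dyadic_constant {R : realType} (T : metricType R) (c0 : R -> R) :=
  forall C : R, 1 <= C -> 0 < c0 C < 1 /\
    forall E : set T, Reg1 C E -> exists D, dyadic_system (c0 C) E D.


Section euclidean.
Context {R : realType} {n : nat}.
Implicit Types x y : 'rV[R]_(n + n).

Definition enorm x : R := Num.sqrt (\sum_i x 0 i ^+ 2).

(* The two halves of the coordinates are indexed by [lshift] and [rshift]. *)
Definition omega x y : R :=
  2^-1 * \sum_(i < n) (x 0 (lshift n i) * y 0 (rshift n i)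
                       - x 0 (rshift n i) * y 0 (lshift n i)).

Lemma omegaDl x x' y : omega (x + x') y = omega x y + omega x' y.
Proof.
rewrite /omega -mulrDr -big_split/=; congr (_ * _).
by apply: eq_bigr => i _; rewrite !mxE; ring.
Qed.

Lemma omegaDr x y y' : omega x (y + y') = omega x y + omega x y'.
Proof.
rewrite /omega -mulrDr -big_split/=; congr (_ * _).
by apply: eq_bigr => i _; rewrite !mxE; ring.
Qed.

Lemma omegaNl x y : omega (- x) y = - omega x y.
Proof.
rewrite /omega -mulrN -sumrN; congr (_ * _).
by apply: eq_bigr => i _; rewrite !mxE; ring.
Qed.

Lemma omegaC x y : omega x y = - omega y x.
Proof.
rewrite /omega -mulrN -sumrN; congr (_ * _).
by apply: eq_bigr => i _; ring.
Qed.

Lemma omegaxx x : omega x x = 0.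
Proof. by have := omegaC x x; lra. Qed.

Lemma omega0l y : omega 0 y = 0.
Proof. by rewrite /omega big1 ?mulr0// => i _; rewrite !mxE; ring. Qed.

Lemma omega0r x : omega x 0 = 0.
Proof. by rewrite omegaC omega0l oppr0. Qed.

End euclidean.

Record heisenberg (R : realType) (n : nat) :=
  Heis { horiz : 'rV[R]_(n + n) ; vert : R }.

Section heisenberg_choice.
Context (R : realType) (n : nat).

Let to_pair (p : heisenberg R n) := (horiz p, vert p).
Let of_pair (z : 'rV[R]_(n + n) * R) := Heis z.1 z.2.

Let to_pairK : cancel to_pair of_pair. Proof. by case. Qed.

HB.instance Definition _ := Choice.copy (heisenberg R n) (can_type to_pairK).

End heisenberg_choice.

Section heisenberg_group.
Context {R : realType} {n : nat}.
Implicit Types p q r : heisenberg R n.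

Definition heis_one : heisenberg R n := Heis 0 0.

Definition heis_mul p q : heisenberg R n :=
  Heis (horiz p + horiz q) (vert p + vert q + omega (horiz p) (horiz q)).

Definition heis_inv p : heisenberg R n := Heis (- horiz p) (- vert p).

Lemma heis_mulA : associative heis_mul.
Proof.
move=> p q r; rewrite /heis_mul/= addrA omegaDl omegaDr; congr Heis; ring.
Qed.

Lemma heis_mul1 : left_id heis_one heis_mul.
Proof. by case=> x t; rewrite /heis_mul/= omega0l !add0r addr0. Qed.

Lemma heis_mulr1 : right_id heis_one heis_mul.
Proof. by case=> x t; rewrite /heis_mul/= omega0r !addr0. Qed.

Lemma heis_mulV : left_inverse heis_one heis_inv heis_mul.
Proof. by case=> x t; rewrite /heis_mul/= omegaNl omegaxx oppr0 !addNr addr0. Qed.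

Lemma heis_mulrV : right_inverse heis_one heis_inv heis_mul.
Proof.
by case=> x t; rewrite /heis_mul/= omegaC omegaNl omegaxx !oppr0 !addrN addr0.
Qed.

HB.instance Definition _ := isGroup.Build (heisenberg R n)
  heis_mulA heis_mul1 heis_mulr1 heis_mulV heis_mulrV.

End heisenberg_group.

Section koranyi.
Context {R : realType} {n : nat}.
Implicit Types p q r : heisenberg R n.

Definition koranyi p : R := (enorm (horiz p) ^+ 4 + 16 * vert p ^+ 2) `^ 4^-1.

Let sq (x : 'rV[R]_(n + n)) : R :=
  \sum_(i < n) (x 0 (lshift n i) ^+ 2 + x 0 (rshift n i) ^+ 2).

Let dot (x y : 'rV[R]_(n + n)) : R :=
  \sum_(i < n) (x 0 (lshift n i) * y 0 (lshift n i)
                + x 0 (rshift n i) * y 0 (rshift n i)).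

Let sq_ge0 x : 0 <= sq x.
Proof. by apply: sumr_ge0 => i _; rewrite addr_ge0 ?sqr_ge0. Qed.

Let enorm2 x : enorm x ^+ 2 = sq x.
Proof.
rewrite sqr_sqrtr; last by apply: sumr_ge0 => i _; rewrite sqr_ge0.
by rewrite big_split_ord/= /sq big_split.
Qed.

Let enorm4 x : enorm x ^+ 4 = sq x ^+ 2.
Proof. by rewrite -enorm2 -exprM. Qed.

Let sq_eq0 x : sq x = 0 -> x = 0.
Proof.
rewrite -enorm2 => /eqP; rewrite sqrf_eq0 => /eqP e0.
have s0 : 0 <= \sum_i x 0 i ^+ 2 by apply: sumr_ge0 => i _; rewrite sqr_ge0.
have /eqP : \sum_i x 0 i ^+ 2 = 0 by rewrite -(sqr_sqrtr s0) -/(enorm x) e0 expr0n.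
rewrite psumr_eq0 => [/allP xi|i _]; last exact: sqr_ge0.
apply/rowP => i; rewrite mxE; apply/eqP; rewrite -sqrf_eq0.
by apply: xi; rewrite mem_index_enum.
Qed.

Let sqN x : sq (- x) = sq x.
Proof. by apply: eq_bigr => i _; rewrite !mxE !sqrrN. Qed.

Let sqD x y : sq (x + y) = sq x + sq y + 2 * dot x y.
Proof.
rewrite /sq /dot mulr_sumr -!big_split/=; apply: eq_bigr => i _.
by rewrite !mxE; ring.
Qed.

Let hermitian_cauchy_schwarz x y :
  dot x y ^+ 2 + 4 * omega x y ^+ 2 <= sq x * sq y.
Proof.
have [y0|y0] := eqVneq (sq y) 0.
  rewrite (sq_eq0 y0) omega0r [dot _ _]big1 => [|i _]; last by rewrite !mxE; ring.
  by rewrite [X in _ <= _ * X]big1 => [|i _]; rewrite ?mxE; [lra|ring].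
have B0 : 0 < sq y by rewrite lt_def y0 sq_ge0.
set B := sq y in B0 *; set s := dot x y; set w := omega x y.
have w2 : 2 * w = \sum_(i < n) (x 0 (lshift n i) * y 0 (rshift n i)
                       - x 0 (rshift n i) * y 0 (lshift n i)).
  by rewrite /w /omega mulrA divff ?mul1r.
suff : 0 <= B * (sq x * B - (s ^+ 2 + 4 * w ^+ 2)) by rewrite pmulr_rge0// subr_ge0.
have -> : B * (sq x * B - (s ^+ 2 + 4 * w ^+ 2)) =
    B ^+ 2 * sq x + (s ^+ 2 + 4 * w ^+ 2) * sq y - 2 * B * s * dot x y
    - 4 * B * w * (2 * w) by rewrite -/B -/s; ring.
rewrite w2; move: B s w {w2 B0 y0} => B s w; rewrite /sq /dot.
rewrite !mulr_sumr -!sumrN -!big_split/=; apply: sumr_ge0 => i _.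
set a := x 0 (lshift _ _); set b := x 0 (rshift _ _).
set a' := y 0 (lshift _ _); set b' := y 0 (rshift _ _).
apply: (le_trans (addr_ge0 (sqr_ge0 (B * a - s * a' - 2 * w * b'))
                           (sqr_ge0 (B * b - s * b' + 2 * w * a')))).
by rewrite le_eqVlt; apply/orP; left; apply/eqP; ring.
Qed.

Let minkowski2 (a b c d u v : R) : 0 <= u -> 0 <= v ->
  a ^+ 2 + b ^+ 2 <= u ^+ 2 -> c ^+ 2 + d ^+ 2 <= v ^+ 2 ->
  (a + c) ^+ 2 + (b + d) ^+ 2 <= (u + v) ^+ 2.
Proof.
move=> u0 v0 abu cdv.
suff : a * c + b * d <= u * v by nra.
apply: le_trans (ler_norm _) _.
rewrite -(@ler_pXn2r _ 2)// ?nnegrE ?mulr_ge0// -normrX ger0_norm ?sqr_ge0//.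
rewrite exprMn; apply: le_trans (ler_pM _ _ abu cdv); rewrite ?addr_ge0 ?sqr_ge0//.
have := sqr_ge0 (a * d - b * c); nra.
Qed.

Let koranyi_ge0 p : 0 <= koranyi p. Proof. exact: powR_ge0. Qed.

Let koranyi4 p : koranyi p ^+ 4 = sq (horiz p) ^+ 2 + (4 * vert p) ^+ 2.
Proof.
have h0 : 0 <= sq (horiz p) ^+ 2 + 16 * vert p ^+ 2.
  by rewrite addr_ge0 ?sqr_ge0// mulr_ge0 ?sqr_ge0.
rewrite /koranyi enorm4 -powR_mulrn ?powR_ge0// -powRrM mulVf// powRr1//; ring.
Qed.

Let koranyi_mul p q : koranyi (p * q)%g <= koranyi p + koranyi q.
Proof.
rewrite -(@ler_pXn2r _ 4)// ?nnegrE ?addr_ge0// koranyi4/=.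
have := koranyi4 p; have := koranyi4 q; have := koranyi_ge0 p.
have := koranyi_ge0 q; move: (koranyi p) (koranyi q) => P Q.
case: p q => x t [y t'] /= Q0 P0 hQ hP.
have cs := hermitian_cauchy_schwarz x y.
have hx : sq x <= P ^+ 2.
  rewrite -(@ler_pXn2r _ 2)// ?nnegrE ?sqr_ge0// -exprM hP.
  by rewrite lerDl sqr_ge0.
have hy : sq y <= Q ^+ 2.
  rewrite -(@ler_pXn2r _ 2)// ?nnegrE ?sqr_ge0// -exprM hQ.
  by rewrite lerDl sqr_ge0.
have hxy : sq x * sq y <= P ^+ 2 * Q ^+ 2 by rewrite ler_pM.
have h1 := @minkowski2 (sq x) (4 * t) (sq y) (4 * t') (P ^+ 2) (Q ^+ 2)
  (sqr_ge0 _) (sqr_ge0 _).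
rewrite -!exprM hP hQ !lexx in h1; have {}h1 := h1 isT isT.
have PQ0 : 0 <= 2 * (P * Q) by rewrite !mulr_ge0.
have := @minkowski2 _ _ (2 * dot x y) (4 * omega x y) _ (2 * (P * Q))
  (addr_ge0 (sqr_ge0 P) (sqr_ge0 Q)) PQ0 h1.
rewrite (_ : (P + Q) ^+ 4 = (P ^+ 2 + Q ^+ 2 + 2 * (P * Q)) ^+ 2); last by ring.
rewrite sqD !mulrDr; apply; nra.
Qed.

Let koranyiV p : koranyi (p^-1)%g = koranyi p.
Proof. by rewrite /koranyi/= sqrrN !enorm4 sqN. Qed.

Definition koranyi_dist p q : R := koranyi (p^-1 * q)%g.

Lemma koranyi_distxx p : koranyi_dist p p = 0.
Proof.
have : koranyi (1%g : heisenberg R n) ^+ 4 == 0.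
  rewrite koranyi4/= [sq _]big1 => [|i _]; last by rewrite !mxE; ring.
  by apply/eqP; ring.
by rewrite /koranyi_dist mulVg expf_eq0/= => /eqP.
Qed.

Lemma koranyi_dist_eq0 p q : koranyi_dist p q = 0 -> p = q.
Proof.
move=> pq; have := koranyi4 (p^-1 * q)%g; rewrite [koranyi _]pq expr0n/= => /esym/eqP.
rewrite paddr_eq0 ?sqr_ge0// !sqrf_eq0 mulf_eq0 (negbTE (_ : 4 != 0 :> R))//=.
move=> /andP[/eqP/sq_eq0/= h /eqP/= v].
rewrite -[LHS]mulg1 (_ : 1%g = (p^-1 * q)%g) ?mulVKg//.
by rewrite [RHS](_ : _ = Heis 0 0)//; congr Heis.
Qed.

Lemma koranyi_dist_sym p q : koranyi_dist p q = koranyi_dist q p.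
Proof. by rewrite /koranyi_dist -koranyiV invgM invgK. Qed.

Lemma koranyi_dist_triangle q p r :
  koranyi_dist p r <= koranyi_dist p q + koranyi_dist q r.
Proof.
apply: le_trans (koranyi_mul _ _).
by rewrite /koranyi_dist mulgA -(mulgA _ q) mulgV mulg1.
Qed.

HB.instance Definition _ := isMetric.Build R (heisenberg R n)
  koranyi_distxx koranyi_dist_eq0 koranyi_dist_sym koranyi_dist_triangle.

End koranyi.

Definition horizontal_lines (R : realType) (n : nat) : set (set (heisenberg R n)) :=
  [set l | exists (p : heisenberg R n) (V : {vspace 'rV[R]_(n + n)}),
     \dim V = 1%N /\ l = [set (p * Heis v 0)%g | v in [set v | v \in V]]].

Arguments horizontal_lines R n : clear implicits.

(* Main.v *)
(* (1) A curve whose projection to the [(x_1, x_(n+1))]-plane is a graph and which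
   is horizontal is built by refining each edge of slope [g] and length [4^-m] into
   four edges of slopes [g + e, g - e, g - e, g + e]. The refinement is palindromic,
   so it preserves the vertices of the lift. The four edges deviate from a straight
   line by [4^-m * e] in the plane, but as areas enter the vertical coordinate, every
   horizontal line misses one of their vertices by a multiple of [4^-m * sqrt e]. So
   beta >= kappa * sqrt (e m) on a positive proportion of the cubes of generation
   [2 m]. With [e m] of order [m^(-2/p)] the Carleson sum diverges like the harmonic
   series, while the sum of the [e m ^ 2] stays small as long as [p < 4], which keeps
   the slopes bounded on most edges.

   (2) In the isotropic [(x_1, x_2)]-plane the Koranyi metric is Euclidean. Let [E]
   be the limit of replacing every segment of generation [m] by two segments of half
   its length, which start at its end points with slopes [s_m / c_m] and [- s_m / c_m]
   and leave a relative gap [1 - c_m] of order [s_m^2], where [s_m^2] is of order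
   [1 / m]. The gaps have infinite total length, so that no regular curve can bridge
   them all, whereas beta <= 4 s_m has a summable [p]-th power as soon as [p > 2]. *)
Require Import Defs.
From HB Require Import structures.
From mathcomp Require Import all_boot all_order all_algebra.
From mathcomp Require Import zify ring lra.
From mathcomp Require Import all_classical all_reals all_analysis.

Set Implicit Arguments.
Unset Strict Implicit.
Unset Printing Implicit Defensive.

Import Order.TTheory GRing.Theory Num.Theory.
Import numFieldNormedType.Exports.

Local Open Scope classical_set_scope.
Local Open Scope ring_scope.

(** * One-dimensional Hausdorff measure *)

(** The two exponents come from two trade-offs. A zigzag of slope [e] stays [sqrt e] away from
    horizontal lines while lengthening the curve only by order [e^2], so [e^(p/2)] competes with
    [e^2] and 4 is critical. A fold of slope [s] in an isotropic plane stays [s] away from lines and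
    leaves a gap [s^2], so 2 is critical.

    Nothing is known of a dyadic system beyond its axioms. For (1) one system has to violate the
    estimate. Its Carleson sum runs over sets, and one set may be a cube of several generations, so
    divergence is extracted from widely spaced generations, whose cubes are distinct. For (2) every
    system is summed generation by generation: the cubes of one generation are disjoint Borel sets,
    and Hausdorff measure is additive on them by Carathéodory's criterion.

    Every lower bound on length comes from a Lipschitz function onto an interval: the first
    coordinate on the curve, the binary address on the set [E], the distance to a piece of [E] on a
    connected set that contains [E]. The curve is parametrised by a half-line, so it is unbounded
    and all integers index generations. *)

Section metric_basics.
Context {R : realType} {T : metricType R}.
Implicit Types (A B : set T) (x y : T).

Lemma edistE x y : edist (x, y) = (mdist x y)%:E.
Proof.
apply/eqP; rewrite eq_le; apply/andP; split.
  apply/lee_addgt0Pr => e e0; rewrite -EFinD; apply: edist_fin => /=.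
    by rewrite ltr_wpDl// mdist_ge0.
  by rewrite ballEmdist/= ltrDl.
apply: le_ereal_inf_tmp => _ [r [r0 +] <-]; rewrite ballEmdist/= lee_fin.
exact: ltW.
Qed.

Lemma mdistC x y : mdist x y = mdist y x.
Proof. by have := edist_sym x y; rewrite !edistE => -[]. Qed.

Lemma mdist_triangleP y x z : mdist x z <= mdist x y + mdist y z.
Proof. by have := edist_triangle x y z; rewrite !edistE. Qed.

Lemma mdistxxP x : mdist x x = 0.
Proof. by have := edist_refl x; rewrite edistE => -[]. Qed.

Lemma diam_ge0 A : (0 <= diam A)%E.
Proof. by apply: ereal_sup_ubound; left. Qed.

Lemma mdist_le_diam A x y : A x -> A y -> ((mdist x y)%:E <= diam A)%E.
Proof. by move=> Ax Ay; apply: ereal_sup_ubound; right; exists (x, y). Qed.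

Lemma diam_le A (c : \bar R) : (0 <= c)%E ->
  (forall x y, A x -> A y -> ((mdist x y)%:E <= c)%E) -> (diam A <= c)%E.
Proof. by move=> c0 Ac; apply: ge_ereal_sup => _ [->//|[[x y] [/= Ax Ay] <-]]; exact: Ac. Qed.

Lemma le_diam A B : A `<=` B -> (diam A <= diam B)%E.
Proof.
by move=> AB; apply: diam_le => [|x y /AB Ax /AB Ay];
  [exact: diam_ge0|exact: mdist_le_diam].
Qed.

Lemma diam0 : diam (set0 : set T) = 0%E.
Proof. by apply/eqP; rewrite eq_le diam_ge0 andbT diam_le. Qed.

Lemma edist_inf_le A x y : A y -> (edist_inf A x <= (mdist x y)%:E)%E.
Proof. by move=> Ay; apply: ereal_inf_lbound; exists y; rewrite // edistE. Qed.

Lemma edist_inf_lt A x (c : R) : (edist_inf A x < c%:E)%E ->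
  exists2 y, A y & mdist x y < c.
Proof. by move=> /ereal_inf_lt[_ [y Ay <-]]; rewrite edistE lte_fin; exists y. Qed.

End metric_basics.

(** The outer extension [mu_ext] admits covers by measurable sets. Over the sigma-algebra generated
    by all sets these are arbitrary covers, so its sigma-subadditivity applies. *)
Lemma cover_inf_sigma_subadditive (R : realType) (T : pointedType)
  (mu : set T -> \bar R) : (forall A, 0 <= mu A)%E ->
  sigma_subadditive (fun A => ereal_inf
    [set \sum_(k <oo) mu (U k) | U in [set U : (set T)^nat | A `<=` \bigcup_k U k]])%E.
Proof.
move=> mu0 F.
pose ms := [set: set T].
have mT (A : set (g_sigma_algebraType ms)) : measurable A by exact: sub_sigma_algebra.
have E (A : set T) : ereal_inf [set (\sum_(k <oo) mu (U k))%E | U in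
    [set U : (set T)^nat | A `<=` \bigcup_k U k]] =
    @mu_ext _ (g_sigma_algebraType ms) R mu A.
  congr ereal_inf; apply/seteqP; split=> _ [G /= AG <-]; exists G => //.
  by case: AG.
rewrite E (eq_eseriesr (fun i _ => E (F i))).
exact: (@mu_ext_sigma_subadditive _ (g_sigma_algebraType ms) R mu mu0 F).
Qed.

(** * Hausdorff measure as an outer measure, additive on separated sets *)

Section hausdorff_outer_measure.
Context {R : realType} {T : metricType R}.
Implicit Types (A B : set T) (delta c e : R).
Local Open Scope ereal_scope.

(** Charging [+oo] for a diameter above [delta] turns the constrained covers of [hausdorff1_pre]
    into arbitrary ones, as in the previous lemma. *)
Let cost delta A := if diam A <= delta%:E then diam A else +oo.

Let cost_ge0 delta A : 0 <= cost delta A.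
Proof. by rewrite /cost; case: ifP => // _; exact: diam_ge0. Qed.

Lemma hausdorff1_pre_ge0 delta A : 0 <= hausdorff1_pre delta A.
Proof.
apply: le_ereal_inf_tmp => _ [U _ <-].
by apply: nneseries_ge0 => i _ _; exact: diam_ge0.
Qed.

Let preE delta A : hausdorff1_pre delta A =
  ereal_inf [set \sum_(k <oo) cost delta (U k) | U in
             [set U : (set T)^nat | A `<=` \bigcup_k U k]].
Proof.
apply/eqP; rewrite eq_le; apply/andP; split.
  apply: le_ereal_inf_tmp => _ [U AU <-].
  have [dU|/existsNP[i /negP dU]] := pselect (forall i, diam (U i) <= delta%:E).
    rewrite (eq_eseriesr (g := fun i => diam (U i))).
      by apply: ereal_inf_lbound; exists U.
    by move=> i _; rewrite /cost dU.
  rewrite (@eseries_pinfty _ _ xpredT i) ?leey//.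
  - by move=> n _; rewrite -ltNye (lt_le_trans _ (cost_ge0 _ _)).
  - by rewrite /cost (negbTE dU).
apply: le_ereal_inf_tmp => _ [U [AU dU] <-]; apply: ereal_inf_lbound.
by exists U => //; apply: eq_eseriesr => i _; rewrite /cost dU.
Qed.

Lemma hausdorff1_pre_sigma_subadditive delta : (0 <= delta)%R ->
  sigma_subadditive (hausdorff1_pre delta : set T -> \bar R).
Proof.
(* The general lemma wants a pointed type; an empty [T] is covered by copies of [set0] at cost 0. *)
move=> d0 F; have [[x]|T0] := pselect (inhabited T); last first.
  apply: (@le_trans _ _ 0); last first.
    by apply: nneseries_ge0 => i _ _; exact: hausdorff1_pre_ge0.
  apply: ereal_inf_lbound; exists (fun=> set0).
    split=> [t|_]; first by case: T0; exists.
    by apply: diam_le => //; rewrite lee_fin.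
  by apply: eseries0 => i _ _; exact: diam0.
pose pt := isPointed.Build T x.
have sub := @cover_inf_sigma_subadditive R (HB.pack T pt) (cost delta) (cost_ge0 delta) F.
by rewrite preE (eq_eseriesr (fun i _ => preE _ (F i))).
Qed.

Lemma le_hausdorff1_pre delta :
  {homo (hausdorff1_pre delta : set T -> _) : A B / A `<=` B >-> A <= B}.
Proof.
move=> A B AB; apply: ereal_inf_le_tmp => _ [U [BU dU] <-]; exists U => //.
by split=> //; exact: subset_trans BU.
Qed.

Lemma hausdorff1_pre_antitone delta delta' A : (delta <= delta')%R ->
  hausdorff1_pre delta' A <= hausdorff1_pre delta A.
Proof.
move=> dd'; apply: ereal_inf_le_tmp => _ [U [AU dU] <-]; exists U => //.
by split=> // i; rewrite (le_trans (dU i))// lee_fin.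
Qed.

Lemma hausdorff1_pre_le delta A : (0 < delta)%R ->
  hausdorff1_pre delta A <= hausdorff1 A.
Proof. by move=> d0; apply: ereal_sup_ubound; exists delta. Qed.

Lemma hausdorff1_le c A : (forall delta, (0 < delta)%R -> hausdorff1_pre delta A <= c%:E) ->
  hausdorff1 A <= c%:E.
Proof. by move=> Ac; apply: ge_ereal_sup => _ [d d0 <-]; exact: Ac. Qed.

Lemma hausdorff1_ge0 A : 0 <= hausdorff1 A.
Proof. by apply: le_trans (hausdorff1_pre_ge0 1%R A) _; exact: hausdorff1_pre_le. Qed.

Lemma le_hausdorff1 : {homo (hausdorff1 : set T -> _) : A B / A `<=` B >-> A <= B}.
Proof.
move=> A B AB; apply: ge_ereal_sup => _ [d d0 <-].
exact: le_trans (le_hausdorff1_pre d AB) (hausdorff1_pre_le _ d0).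
Qed.

Lemma hausdorff1_sigma_subadditive : sigma_subadditive (hausdorff1 : set T -> \bar R).
Proof.
move=> F; apply: ge_ereal_sup => _ [d d0 <-].
apply: le_trans (hausdorff1_pre_sigma_subadditive (ltW d0) _) _.
apply: lee_nneseries => [i _ _|i _]; first exact: hausdorff1_pre_ge0.
exact: hausdorff1_pre_le.
Qed.

Lemma hausdorff1_set0 : hausdorff1 (set0 : set T) = 0.
Proof.
apply/eqP; rewrite eq_le hausdorff1_ge0 andbT; apply: hausdorff1_le => d d0.
apply: ereal_inf_lbound; exists (fun=> set0); last by apply: eseries0 => i _ _; exact: diam0.
by split=> // i; rewrite diam0 lee_fin ltW.
Qed.

HB.instance Definition _ := isOuterMeasure.Build R T (hausdorff1 : set T -> _)
  hausdorff1_set0 hausdorff1_ge0 le_hausdorff1 hausdorff1_sigma_subadditive.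

(** A set of diameter at most [delta < e] cannot meet both [A] and [B], so the members of a cover
    that meet [A] and those that meet [B] are different ones. *)
Let pre_separated e delta A B : (0 < delta)%R -> (delta < e)%R ->
  (forall x y, A x -> B y -> e <= mdist x y)%R ->
  hausdorff1_pre delta A + hausdorff1_pre delta B <= hausdorff1_pre delta (A `|` B).
Proof.
move=> d0 de sep; apply: le_ereal_inf_tmp => _ [U [ABU dU] <-].
pose V C i := if pselect (U i `&` C !=set0) is left _ then U i else set0.
have preV C : C `<=` A `|` B -> hausdorff1_pre delta C <= \sum_(0 <= i <oo) diam (V C i).
  move=> CAB; apply: ereal_inf_lbound; exists (V C) => //; split.
    move=> x Cx; have [i _ Ux] := ABU _ (CAB _ Cx); exists i => //.
    by rewrite /V; case: pselect => // -[]; exists x.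
  by move=> i; rewrite /V; case: pselect => // _; rewrite diam0 lee_fin ltW.
apply: (le_trans (leeD (preV A _) (preV B _))); [exact: subsetUl|exact: subsetUr|].
rewrite -nneseriesD; try by move=> *; exact: diam_ge0.
apply: lee_nneseries => [i _ _|i _]; first by rewrite adde_ge0 ?diam_ge0.
rewrite /V; case: pselect => [[x [Ux Ax]]|_]; case: pselect => [[y [Uy By]]|_];
  rewrite ?diam0 ?adde0 ?add0e ?diam_ge0//.
have := le_trans (mdist_le_diam Ux Uy) (dU i).
by rewrite lee_fin leNgt (lt_le_trans de (sep _ _ Ax By)).
Qed.

Lemma hausdorff1_separated e A B : (0 < e)%R ->
  (forall x y, A x -> B y -> e <= mdist x y)%R ->
  hausdorff1 A + hausdorff1 B <= hausdorff1 (A `|` B).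
Proof.
move=> e0 sep; have ge0 := hausdorff1_ge0.
(* Two independent scales allow the suprema defining the two measures to be taken one after the
   other. *)
have key (d1 d2 : R) : (0 < d1)%R -> (0 < d2)%R ->
    hausdorff1_pre d1 A + hausdorff1_pre d2 B <= hausdorff1 (A `|` B).
  move=> d10 d20; pose d : R := (Num.min (e / 2) (Num.min d1 d2))%R.
  have d0 : (0 < d)%R by rewrite !lt_min d10 d20 divr_gt0.
  have de : (d < e)%R by rewrite /d gt_min ltr_pdivrMr// ltr_pMr// ltr1n.
  apply: le_trans _ (hausdorff1_pre_le _ d0); apply: le_trans (pre_separated d0 de sep).
  by apply: leeD; apply: hausdorff1_pre_antitone; rewrite /d !ge_min lexx !orbT.
have [->|] := eqVneq (hausdorff1 (A `|` B)) +oo; first exact: leey.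
move=> fin; have fAB : hausdorff1 (A `|` B) \is a fin_num.
  by rewrite ge0_fin_numE ?ltey.
have le1 C : C `<=` A `|` B -> hausdorff1 C \is a fin_num.
  by move=> CAB; rewrite ge0_fin_numE// (le_lt_trans (le_hausdorff1 CAB))// ltey.
have fA := le1 A (@subsetUl _ _ _); have fB := le1 B (@subsetUr _ _ _).
rewrite -leeBrDr//; apply: ge_ereal_sup => _ [d1 d10 <-].
have f1 : hausdorff1_pre d1 A \is a fin_num.
  rewrite ge0_fin_numE ?hausdorff1_pre_ge0//.
  by rewrite (le_lt_trans (hausdorff1_pre_le _ d10))// -ge0_fin_numE.
rewrite leeBrDr// addeC -leeBrDr//; apply: ge_ereal_sup => _ [d2 d20 <-].
by rewrite leeBrDr// addeC key.
Qed.

End hausdorff_outer_measure.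

(** * Measurability of Borel sets, and bounds for Hausdorff measure *)

Section metric_outer_measure.
Context {R : realType} {T : metricType R}.
Implicit Types (A B C X : set T) (delta c e : R).
Local Open Scope ereal_scope.

Notation H1 := (hausdorff1 : set T -> \bar R).

(** Carathéodory's argument for metric outer measures. The sets [D k] exhaust the complement of [C]
    and are separated from [C]. Shells [S k] of the same parity are separated from one another, so
    those of each parity have total measure at most [H1 X]. Hence the series of shells converges,
    and its tail bounds what is lost by replacing the complement of [C] by [D k]. *)
Lemma closed_caratheodory C : closed C -> H1.-caratheodory C.
Proof.
move=> clC; apply: le_caratheodory_measurable => X /=.
have [->|Xoo] := eqVneq (H1 X) +oo; first exact: leey.
have Xfin : H1 X < +oo by rewrite ltey.
pose r k : R := (k.+1%:R^-1)%R.
pose D k := [set x : T | forall y, C y -> (r k <= mdist x y)%R].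
have r_lt k : (r k.+1 < r k)%R by rewrite ltf_pV2 ?posrE// ltr_nat.
have r_le i j : (i <= j)%N -> (r j <= r i)%R.
  by move=> ij; rewrite lef_pV2 ?posrE// ler_nat.
have D_le i j : (i <= j)%N -> D i `<=` D j.
  by move=> ij x Dx y /Dx; apply: le_trans; exact: r_le.
have D_sep k x y : D k x -> ~ D k.+1 y -> (r k - r k.+1 <= mdist x y)%R.
  move=> Dx /existsNP[z /not_implyP[Cz /negP]]; rewrite -ltNge => yz.
  rewrite lerBlDr (le_trans (Dx _ Cz))// (le_trans (mdist_triangleP y _ _))//.
  by rewrite lerD2l ltW.
have D_cover : ~` C = \bigcup_k D k.
  apply/seteqP; split=> [x Cx|x [k _ Dx] Cx]; last first.
    by have := Dx _ Cx; rewrite mdistxxP leNgt invr_gt0 ltr0n.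
  have : nbhs x (~` C) by apply: open_nbhs_nbhs; split=> //; rewrite openC.
  rewrite -filter_from_ballE => -[e /= e0 xeC].
  have [k ke] : exists k, (r k < e)%R.
    by have [k _ ke] := near_infty_natSinv_lt (PosNum e0); exists k; apply: ke => /=.
  exists k => // y Cy; rewrite leNgt; apply/negP => xyk; apply: xeC Cy.
  by rewrite ballEmdist/= (lt_trans xyk).
pose S k := X `&` (D k.+1 `\` D k).
(* [b] is the parity. The last factor is empty for [n = 0], where the predecessor is cut off at 0,
   and everything otherwise. *)
have parity b n : \sum_(i < n) H1 (S (i.*2 + b)%N) <=
    H1 (X `&` D (n.*2 + b).-1%N `&` [set x | (0 < n)%N]).
  elim: n => [|n ih]; first by rewrite big_ord0 hausdorff1_ge0.
  rewrite big_ord_recr/=; apply: le_trans (leeD ih (lexx _)) _.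
  have [->|n0] := posnP n.
    rewrite (_ : _ `&` _ = set0) ?hausdorff1_set0 ?add0e; last by apply/seteqP; split=> ? [].
    by apply: le_hausdorff1 => x [Xx [Dx _]].
  have nb : ((n.*2 + b).-1.+1 = n.*2 + b)%N by rewrite prednK// addn_gt0 double_gt0 n0.
  apply: le_trans.
    apply: (@hausdorff1_separated _ _ (r (n.*2 + b).-1%N - r (n.*2 + b).-1.+1)).
      by rewrite subr_gt0.
    by move=> x y [[_ Dx] _] [_ [_ Dy]]; apply: D_sep Dx _; rewrite nb.
  apply: le_hausdorff1 => x [[[Xx Dx] _]|[Xx [Dx _]]]; split=> //; split=> //.
    by apply: D_le Dx; lia.
have sumS n : \sum_(i < n) H1 (S i) <= 2%:E * H1 X.
  apply: (@le_trans _ _ (\sum_(i < n.*2) H1 (S i))).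
    rewrite -!(big_mkord xpredT (fun i => H1 (S i))).
    apply: lee_sum_nneg_natr => //; first by move=> *; exact: hausdorff1_ge0.
    by rewrite -addnn leq_addr.
  have -> : \sum_(i < n.*2) H1 (S i) =
      \sum_(i < n) H1 (S (i.*2 + 0)%N) + \sum_(i < n) H1 (S (i.*2 + 1)%N).
    elim: n => [|n ih]; first by rewrite !big_ord0 adde0.
    by rewrite doubleS !big_ord_recr/= ih addn0 addn1 -addeA addeACA.
  rewrite mule_natl mule2n; apply: leeD; apply: le_trans (parity _ _) _;
    by apply: le_hausdorff1 => x [[]].
have sumSoo : \sum_(0 <= i <oo) H1 (S i) < +oo.
  apply: (@le_lt_trans _ _ (2%:E * H1 X)); last by rewrite lte_mul_pinfty.
  apply: lime_le; first by apply: is_cvg_nneseries => *; exact: hausdorff1_ge0.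
  by apply: nearW => n; rewrite big_mkord.
have tail := nneseries_tail_cvg sumSoo (fun k _ => hausdorff1_ge0 (S k)).
have bound k : H1 (X `&` C) + H1 (X `&` ~` C) <= H1 X + \sum_(k <= i <oo) H1 (S i).
  have XC : X `&` ~` C `<=` (X `&` D k) `|` \bigcup_(i in ~` `I_k) S i.
    rewrite D_cover => x [Xx [j _ Dx]].
    have [Dkx|nDkx] := pselect (D k x); [by left|right].
    pose P i := `[< D i x >].
    have exP : exists i, P i by exists j; apply/asboolP.
    have [i /asboolP Dix imin] := ex_minnP exP.
    case: i => [|i] in Dix imin *; first by case: nDkx; exact: D_le Dix.
    exists i.
      move=> /= ik; apply: nDkx; exact: D_le Dix.
    split=> //; split=> // Dix'; have := imin i; rewrite ltnn => /(_ _)/negP; apply.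
      by apply/asboolP.
    by [].
  apply: (@le_trans _ _ (H1 (X `&` C) + (H1 (X `&` D k) + \sum_(k <= i <oo) H1 (S i)))).
    rewrite leeD2l//; apply: le_trans (le_hausdorff1 XC) _.
    apply: le_trans (outer_measureU2 _ _ _) _; rewrite leeD2l//.
    exact: (outer_measure_sigma_subadditive_tail hausdorff1).
  rewrite addeA leeD2r// addeC; apply: le_trans.
    apply: (@hausdorff1_separated _ _ (r k)); first by rewrite invr_gt0.
    by move=> x y [_ Dx] [_ /Dx].
  by apply: le_hausdorff1 => x [[]|[]].
have lim : H1 X + \sum_(k <= i <oo) H1 (S i) @[k --> \oo] --> H1 X + 0.
  apply: cvgeD => //; last exact: cvg_cst.
  by rewrite fin_num_adde_defl// ge0_fin_numE// hausdorff1_ge0.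
by rewrite -[leRHS]adde0; apply: cvge_to_ge lim _; exact: nearW.
Qed.

Lemma borel_caratheodory A : borel A -> H1.-caratheodory A.
Proof.
move=> bA; apply: bA => /=; split; last first.
  move=> B oB; rewrite -[B]setCK; apply: caratheodory_measurable_setC.
  by apply: closed_caratheodory; exact: open_closedC.
split=> [|B mB|F mF]; first exact: caratheodory_measurable_set0.
  by rewrite setTD; exact: caratheodory_measurable_setC.
exact: caratheodory_measurable_bigcup.
Qed.

(** Carathéodory's criterion for [F i] splits the arbitrary test set [X]; the induction continues
    with the part of [X] outside [F i]. *)
Lemma hausdorff1_caratheodory_sum (I : eqType) (s : seq I) (F : I -> set T) X :
  uniq s -> (forall i, i \in s -> H1.-caratheodory (F i)) ->
  (forall i j, i \in s -> j \in s -> i != j -> F i `&` F j = set0) ->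
  \sum_(i <- s) H1 (X `&` F i) <= H1 X.
Proof.
elim: s X => [|i s ih] X /=; first by rewrite big_nil hausdorff1_ge0.
move=> /andP[nis us] mF dF; rewrite big_cons.
have mi := mF i (mem_head _ _); rewrite [leRHS](mi X) leeD2l//.
apply: le_trans (ih (X `&` ~` F i) us _ _); last 2 first.
- by move=> j js; apply: mF; rewrite inE js orbT.
- by move=> j k js ks; apply: dF; rewrite inE ?js ?ks orbT.
rewrite big_seq [leRHS]big_seq; apply: lee_sum => j js; apply: le_hausdorff1.
move=> x [Xx Fj]; split=> //; split=> // Fi.
have ij : i != j by apply: contraNneq nis => ->.
have := dF i j (mem_head _ _) _ ij; rewrite inE js orbT => /(_ isT) d0.
by have : (F i `&` F j) x by []; rewrite d0.
Qed.

Lemma hausdorff1_le_cover c A :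
  (forall delta, (0 < delta)%R -> exists (N : nat) (d : R) (U : nat -> set T),
    [/\ (0 <= d <= delta)%R, A `<=` \bigcup_(i < N) U i,
        forall i, diam (U i) <= d%:E & (N%:R * d <= c)%R]) ->
  H1 A <= c%:E.
Proof.
move=> cov; apply: hausdorff1_le => delta /cov[N [d [U [/andP[d0 dd] AU dU Nd]]]].
pose V i := if (i < N)%N then U i else set0.
apply: (@le_trans _ _ (\sum_(0 <= i <oo) diam (V i))).
  apply: ereal_inf_lbound; exists V => //; split=> [x /AU[i /= iN Ux]|i].
    by exists i => //; rewrite /V iN.
  rewrite /V; case: ifP => _; last by rewrite diam0 lee_fin (le_trans d0).
  by rewrite (le_trans (dU i)) ?lee_fin.
rewrite (nneseries_split _ N) => [|k _]; last exact: diam_ge0.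
rewrite [X in _ + X]eseries0 ?adde0; last first.
  by move=> i; rewrite add0n leqNgt /V => /negbTE -> _; exact: diam0.
apply: (@le_trans _ _ (N%:R * d)%:E); last by rewrite lee_fin.
rewrite add0n big_mkord (@le_trans _ _ (\sum_(i < N) d%:E))//.
  by apply: lee_sum => i _; rewrite /V ltn_ord.
by rewrite sumEFin lee_fin sumr_const card_ord mulr_natl.
Qed.

(** [f] sends the part of [A] in a covering set [U i] into an interval of length
    [2 * L * diam (U i)] centred at one of its values, and Lebesgue measure is countably
    subadditive. The centring costs the factor 2. *)
Lemma lipschitz_length_le (f : T -> R) (L a b : R) A :
  (0 < L)%R -> (forall x y, A x -> A y -> `|f x - f y| <= L * mdist x y)%R ->
  `]a, b[ `<=` f @` A -> ((b - a) / (2 * L))%:E <= H1 A.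
Proof.
move=> L0 lip abA; have [ba|ab] := leP b a.
  apply: le_trans (hausdorff1_ge0 _); rewrite lee_fin.
  by rewrite ler_pdivrMr ?mulr_gt0// mul0r subr_le0.
(* Working at scale 1 makes all diameters of the cover finite. *)
apply: le_trans (hausdorff1_pre_le A ltr01).
apply: le_ereal_inf_tmp => _ [U [AU dU] <-].
have fdU i : diam (U i) = (fine (diam (U i)))%:E.
  by rewrite fineK// ge0_fin_numE ?diam_ge0// (le_lt_trans (dU i))// ltry.
pose c i := if pselect (A `&` U i !=set0) is left h then f (projT1 (cid h)) else 0%R.
pose J i : set R := `[(c i - L * fine (diam (U i)))%R, (c i + L * fine (diam (U i)))%R]%classic.
have JE i : lebesgue_measure (J i) = (2 * L)%:E * diam (U i).
  have d0 : (0 <= L * fine (diam (U i)))%R.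
    by apply: mulr_ge0; [exact: ltW|apply: fine_ge0; exact: diam_ge0].
  rewrite /J lebesgue_measure_itv/= lte_fin fdU; case: ltP => h.
    by rewrite -EFinD -EFinM; congr EFin; ring.
  rewrite -EFinM; congr EFin; rewrite -mulrA; lra.
have abJ : `]a, b[%classic `<=` \bigcup_i J i.
  move=> t /abA[x Ax <-]; have [i _ Ux] := AU _ Ax; exists i => //.
  rewrite /J/= in_itv/= -ler_distl /c; case: pselect => [h|[]]; last by exists x.
  case: cid => y [Ay Uy] /=; apply: le_trans (lip _ _ Ax Ay) _.
  by rewrite ler_wpM2l ?(ltW L0)// -lee_fin -fdU mdist_le_diam.
have : lebesgue_measure (`]a, b[%classic : set R) <=
    \sum_(i <oo) lebesgue_measure (J i).
  apply: (@measure_sigma_subadditive _ R (measurableTypeR R) lebesgue_measure) abJ.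
    by move=> i; exact: measurable_itv.
  exact: measurable_itv.
rewrite lebesgue_measure_itv/= lte_fin ab (eq_eseriesr (fun i _ => JE i)).
rewrite nneseriesZl; last by move=> *; exact: diam_ge0.
by rewrite -lee_pdivrMl ?mulr_gt0// -EFinM mulrC.
Qed.

End metric_outer_measure.

(** * The Heisenberg group *)

Section heisenberg_metric.
Context {R : realType} {n : nat}.
Implicit Types (p q r : heisenberg R n) (x y : 'rV[R]_(n + n)).

Lemma horiz_mulg p q : horiz (p * q)%g = horiz p + horiz q. Proof. by []. Qed.

Lemma vert_mulg p q :
  vert (p * q)%g = vert p + vert q + omega (horiz p) (horiz q).
Proof. by []. Qed.

Lemma horiz_invg p : horiz (p^-1)%g = - horiz p. Proof. by []. Qed.

Lemma vert_invg p : vert (p^-1)%g = - vert p. Proof. by []. Qed.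

Definition heisE := (horiz_mulg, vert_mulg, horiz_invg, vert_invg).

Lemma heis_eq p q : horiz p = horiz q -> vert p = vert q -> p = q.
Proof. by case: p => ? ?; case: q => ? ? /= -> ->. Qed.

Definition sqnorm x : R := \sum_i x 0 i ^+ 2.

Lemma sqnorm_ge0 x : 0 <= sqnorm x.
Proof. by apply: sumr_ge0 => i _; exact: sqr_ge0. Qed.

Lemma sqnorm_coord x i : x 0 i ^+ 2 <= sqnorm x.
Proof. by rewrite /sqnorm (bigD1 i)//= lerDl sumr_ge0// => j _; exact: sqr_ge0. Qed.

Lemma koranyi_pow4 p : koranyi p ^+ 4 = sqnorm (horiz p) ^+ 2 + 16 * vert p ^+ 2.
Proof.
have h0 : 0 <= sqnorm (horiz p) ^+ 2 + 16 * vert p ^+ 2.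
  by rewrite addr_ge0 ?sqr_ge0// mulr_ge0 ?sqr_ge0.
rewrite /koranyi (_ : enorm _ ^+ 4 = sqnorm (horiz p) ^+ 2); last first.
  by rewrite (exprM _ 2 2) sqr_sqrtr ?sqnorm_ge0.
by rewrite -powR_mulrn ?powR_ge0// -powRrM mulVf// powRr1.
Qed.

Lemma koranyi_ge0 p : 0 <= koranyi p. Proof. exact: powR_ge0. Qed.

Lemma koranyi_le p (c : R) : 0 <= c ->
  sqnorm (horiz p) ^+ 2 + 16 * vert p ^+ 2 <= c ^+ 4 -> koranyi p <= c.
Proof. by move=> c0 h; rewrite -(@ler_pXn2r _ 4)// ?nnegrE ?koranyi_ge0// koranyi_pow4. Qed.

Lemma sqnorm_le_koranyi p : sqnorm (horiz p) <= koranyi p ^+ 2.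
Proof.
rewrite -(@ler_pXn2r _ 2)// ?nnegrE ?sqr_ge0 ?sqnorm_ge0// -exprM koranyi_pow4.
by rewrite lerDl mulr_ge0 ?sqr_ge0.
Qed.

Lemma coord_le_koranyi p i : `|horiz p 0 i| <= koranyi p.
Proof.
rewrite -(@ler_pXn2r _ 2)// ?nnegrE ?koranyi_ge0// real_normK ?num_real//.
exact: le_trans (sqnorm_coord _ _) (sqnorm_le_koranyi _).
Qed.

Lemma vert_le_koranyi p : 4 * `|vert p| <= koranyi p ^+ 2.
Proof.
rewrite -(@ler_pXn2r _ 2)// ?nnegrE ?sqr_ge0 ?mulr_ge0// -exprM koranyi_pow4.
by rewrite exprMn real_normK ?num_real//; have := sqr_ge0 (sqnorm (horiz p)); lra.
Qed.

(** [2 * omega x y] is the scalar product of [x] with a rotated copy [J y] of [y]. Multiplied by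
    [sqnorm y], the defect in Cauchy-Schwarz is the squared norm of
    [|y|^2 x - 2 omega(x, y) J y]. *)
Lemma omega_sqnorm x y : (2 * omega x y) ^+ 2 <= sqnorm x * sqnorm y.
Proof.
have sqE z : sqnorm z = \sum_(i < n) (z 0 (lshift n i) ^+ 2 + z 0 (rshift n i) ^+ 2).
  by rewrite /sqnorm big_split_ord/= big_split.
have [y0|y0] := eqVneq (sqnorm y) 0.
  have yi i : y 0 i = 0.
    by apply/eqP; rewrite -sqrf_eq0 eq_le sqr_ge0 andbT -y0 sqnorm_coord.
  rewrite y0 mulr0 /omega big1 ?mulr0 ?expr0n// => i _.
  by rewrite !yi !mulr0 subr0.
have B0 : 0 < sqnorm y by rewrite lt_def y0 sqnorm_ge0.
set B := sqnorm y in B0 *; set w := 2 * omega x y.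
have wE : w = \sum_(i < n) (x 0 (lshift n i) * y 0 (rshift n i)
                       - x 0 (rshift n i) * y 0 (lshift n i)).
  by rewrite /w /omega mulrA divff ?mul1r.
rewrite -subr_ge0 -(pmulr_rge0 _ B0).
have -> : B * (sqnorm x * B - w ^+ 2) =
    B ^+ 2 * sqnorm x + w ^+ 2 * sqnorm y - 2 * B * w * (2 * omega x y).
  by rewrite -/w -/B; ring.
rewrite -/w {3}wE; move: B w {wE B0 y0} => B w.
rewrite !sqE !mulr_sumr -sumrN -!big_split/=.
apply: sumr_ge0 => i _.
set a := x 0 (lshift _ _); set b := x 0 (rshift _ _).
set a' := y 0 (lshift _ _); set b' := y 0 (rshift _ _).
apply: (le_trans (addr_ge0 (sqr_ge0 (B * a - w * b')) (sqr_ge0 (B * b + w * a')))).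
rewrite le_eqVlt; apply/orP; left; apply/eqP; ring.
Qed.

Lemma omegaZl (c : R) x y : omega (c *: x) y = c * omega x y.
Proof.
rewrite /omega [RHS]mulrCA [in RHS]mulr_sumr; congr (_ * _).
by apply: eq_bigr => i _; rewrite !mxE; ring.
Qed.

Lemma omegaZr (c : R) x y : omega x (c *: y) = c * omega x y.
Proof. by rewrite omegaC omegaZl omegaC; ring. Qed.

Lemma omegaNr x y : omega x (- y) = - omega x y.
Proof. by rewrite omegaC omegaNl opprK omegaC. Qed.

Lemma omega_le_koranyi p q :
  `|omega (horiz p) (horiz q)| <= 2^-1 * (koranyi p * koranyi q).
Proof.
rewrite -ler_pdivrMl ?invr_gt0// invrK.
rewrite -(@ler_pXn2r _ 2)// ?nnegrE ?mulr_ge0 ?koranyi_ge0//.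
rewrite exprMn real_normK ?num_real// -exprMn; apply: le_trans (omega_sqnorm _ _) _.
by rewrite exprMn ler_pM ?sqnorm_ge0 ?sqnorm_le_koranyi.
Qed.

Lemma mdist_heisE p q : mdist p q = koranyi (p^-1 * q)%g.
Proof. by []. Qed.

Lemma mdist_mulg g p q : mdist (g * p)%g (g * q)%g = mdist p q.
Proof. by rewrite !mdist_heisE invgM -mulgA mulKg. Qed.

Lemma coord_lipschitz i p q : `|horiz p 0 i - horiz q 0 i| <= mdist p q.
Proof.
rewrite mdistC; apply: le_trans (coord_le_koranyi (q^-1 * p)%g i).
by rewrite /= !mxE addrC.
Qed.

End heisenberg_metric.

(** * Limits of geometrically converging sequences *)

Section geometric_limits.
Context {R : realType}.

Lemma expr_small (r K e : R) : 0 <= r < 1 -> 0 < e ->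
  exists M, forall m, (M <= m)%N -> K * r ^+ m < e.
Proof.
move=> /andP[r0 r1] e0.
have [K0|K0] := leP K 0.
  by exists 0%N => m _; rewrite (le_lt_trans _ e0)// mulr_le0_ge0// exprn_ge0.
have : r ^+ m @[m --> \oo] --> (0 : R) by apply: cvg_expr; rewrite ger0_norm.
move=> /cvgr0Pnorm_lt /(_ _ (divr_gt0 e0 K0)) [M _ hM]; exists M => m Mm.
by have := hM _ Mm; rewrite ger0_norm ?exprn_ge0// ltr_pdivlMr// mulrC.
Qed.

Lemma le_of_small (a b K r : R) : 0 <= r < 1 ->
  (forall m : nat, a <= b + K * r ^+ m) -> a <= b.
Proof.
move=> hr h; apply/ler_addgt0Pr => e e0.
have [M hM] := expr_small K hr e0.
by apply: le_trans (h M) _; rewrite lerD2l ltW// hM.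
Qed.

(** As [r <= 1/2], the intervals of radius [2 * C * r ^+ m] around [u m] are nested; the limit is
    the supremum of their left ends. *)
Lemma geometric_limit (u : nat -> R) (C r : R) : 0 <= C -> 0 <= r <= 2^-1 ->
  (forall m, `|u m.+1 - u m| <= C * r ^+ m) ->
  exists l, forall m, `|u m - l| <= 2 * C * r ^+ m.
Proof.
move=> C0 /andP[r0 r2] hu.
have rm m : 0 <= C * r ^+ m by rewrite mulr_ge0 ?exprn_ge0.
have rS m : C * r ^+ m.+1 <= 2^-1 * (C * r ^+ m).
  by rewrite exprS mulrCA ler_wpM2r.
have wS m : u m - 2 * C * r ^+ m <= u m.+1 - 2 * C * r ^+ m.+1.
  by have := hu m; have := rS m; rewrite ler_norml -!mulrA => ? /andP[]; lra.
have vS m : u m.+1 + 2 * C * r ^+ m.+1 <= u m + 2 * C * r ^+ m.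
  by have := hu m; have := rS m; rewrite ler_norml -!mulrA => ? /andP[]; lra.
have wmono i j : (i <= j)%N -> u i - 2 * C * r ^+ i <= u j - 2 * C * r ^+ j.
  by move=> /subnK <-; elim: (j - i)%N => // k ih; rewrite addSn (le_trans ih).
have vmono i j : (i <= j)%N -> u j + 2 * C * r ^+ j <= u i + 2 * C * r ^+ i.
  by move=> /subnK <-; elim: (j - i)%N => // k ih; rewrite addSn (le_trans _ ih).
have wv i j : u i - 2 * C * r ^+ i <= u j + 2 * C * r ^+ j.
  have := wmono _ _ (leq_maxl i j); have := vmono _ _ (leq_maxr i j).
  by have := rm (maxn i j); rewrite -!mulrA; lra.
pose S := range (fun m => u m - 2 * C * r ^+ m).
have S0 : S !=set0 by exists (u 0%N - 2 * C * r ^+ 0), 0%N.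
exists (sup S) => m; rewrite distrC ler_distl; apply/andP; split.
  apply: ub_le_sup; last by exists m.
  by exists (u 0%N + 2 * C * r ^+ 0) => _ [i _ <-].
by apply: ge_sup => // _ [i _ <-].
Qed.

End geometric_limits.

Section heisenberg_complete.
Context {R : realType} {n : nat}.
Implicit Types p q : heisenberg R n.

(** Horizontal coordinates are Lipschitz, but an increment of the vertical one contains [omega] of
    the position with the step. It is still geometrically small, because the sequence stays in a
    ball of radius [K] around the identity. *)
Lemma heisenberg_geometric_limit (q : nat -> heisenberg R n) (C r : R) :
  0 <= C -> 0 <= r <= 2^-1 ->
  (forall m, mdist (q m) (q m.+1) <= C * r ^+ m) ->
  exists p, forall m, mdist (q m) p <= 2 * C * r ^+ m.
Proof.
move=> C0 hr hq; have /andP[r0 r2] := hr.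
have r1 : 0 <= r < 1 by rewrite r0/=; lra.
have rm m : 0 <= C * r ^+ m by rewrite mulr_ge0 ?exprn_ge0.
have rle m : C * r ^+ m <= C by rewrite ler_piMr// exprn_ile1//; lra.
have rS m : C * r ^+ m.+1 <= 2^-1 * (C * r ^+ m).
  by rewrite exprS mulrCA ler_wpM2r.
have qq k m : mdist (q m) (q (k + m)%N) <= 2 * (C * r ^+ m) - 2 * (C * r ^+ (k + m)).
  elim: k => [|k ih]; first by rewrite add0n mdistxxP subrr.
  apply: le_trans (mdist_triangleP (q (k + m)%N) _ _) _.
  by have := hq (k + m)%N; have := rS (k + m)%N; rewrite addSn; lra.
pose K := koranyi (q 0%N) + 2 * C.
have qK m : koranyi (q m) <= K.
  have kE z : koranyi z = mdist (1%g : heisenberg R n) z.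
    by rewrite mdist_heisE invg1 mul1g.
  rewrite /K !kE; apply: le_trans (mdist_triangleP (q 0%N) _ _) _; rewrite lerD2l.
  have := qq m 0%N; rewrite addn0; have := rm m; have := rle 0%N; lra.
have K0 : 0 <= K by apply: le_trans (qK 0%N); exact: koranyi_ge0.
have hx i m : `|horiz (q m.+1) 0 i - horiz (q m) 0 i| <= C * r ^+ m.
  by rewrite distrC; exact: le_trans (coord_lipschitz _ _ _) (hq m).
have /choice[x xP] : forall i, exists l, forall m, `|horiz (q m) 0 i - l| <= 2 * C * r ^+ m.
  by move=> i; exact: geometric_limit.
have ht m : `|vert (q m.+1) - vert (q m)| <= (C + K) * C * r ^+ m.
  have -> : vert (q m.+1) - vert (q m) =
      vert ((q m)^-1 * q m.+1)%g + omega (horiz (q m)) (horiz ((q m)^-1 * q m.+1)%g).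
    by rewrite !heisE omegaNl omegaDr (omegaC _ (- _)) omegaNl omegaxx; ring.
  apply: le_trans (ler_normD _ _) _.
  have := vert_le_koranyi ((q m)^-1 * q m.+1)%g.
  have := omega_le_koranyi (q m) ((q m)^-1 * q m.+1)%g.
  rewrite -mdist_heisE; set a := `|vert _|; set b := `|omega _ _|.
  have d0 := mdist_ge0 (q m) (q m.+1).
  move=> hb ha; have hd := hq m; have hK := qK m; have k0 := koranyi_ge0 (q m).
  have hC := rle m.
  have : koranyi (q m) * mdist (q m) (q m.+1) <= K * (C * r ^+ m) by rewrite ler_pM.
  have : mdist (q m) (q m.+1) ^+ 2 <= C * (C * r ^+ m).
    by rewrite expr2 ler_pM// (le_trans hd).
  have := mulr_ge0 K0 (rm m); have := mulr_ge0 C0 (rm m).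
  rewrite (_ : (C + K) * C * r ^+ m = C * (C * r ^+ m) + K * (C * r ^+ m)); last by ring.
  by lra.
have [t tP] := geometric_limit (mulr_ge0 (addr_ge0 C0 K0) C0) hr ht.
pose p : heisenberg R n := Heis (\row_i x i) t.
(* Convergence of the coordinates gives a rate only for the fourth power of the distance. This
   suffices to identify the limit. *)
have [L LP] : exists L, forall m, mdist (q m) p ^+ 4 <= L * r ^+ m.
  pose A := (2 * C) ^+ 2 *+ (n + n); pose B := 2 * ((C + K) * C).
  have A0 : 0 <= A by rewrite mulrn_wge0// sqr_ge0.
  pose G := A ^+ 2 + 16 * (2 * B ^+ 2 + 2^-1 * (K ^+ 2 * A)); exists G => m.
  have rho0 : 0 <= r ^+ m by rewrite exprn_ge0.
  have rho1 : r ^+ m <= 1 by rewrite exprn_ile1//; lra.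
  set rho := r ^+ m in rho0 rho1 *.
  have rho2 : rho ^+ 2 <= rho by rewrite expr2 ler_piMr.
  pose D := horiz p - horiz (q m).
  have DA : sqnorm D <= A * rho ^+ 2.
    rewrite /A mulrnAl -exprMn -[X in _ *+ X]card_ord -sumr_const.
    apply: ler_sum => i _; rewrite /D !mxE -[leLHS]real_normK ?num_real//.
    by rewrite distrC lerXn2r ?nnegrE ?mulr_ge0// xP.
  have D0 := sqnorm_ge0 D.
  rewrite mdist_heisE koranyi_pow4.
  have -> : horiz ((q m)^-1 * p)%g = D by rewrite !heisE /D addrC.
  have -> : vert ((q m)^-1 * p)%g = (t - vert (q m)) - omega (horiz (q m)) D.
    by rewrite !heisE /D omegaDr (omegaC _ (- horiz (q m))) !omegaNl omegaxx (_ : vert p = t)//; ring.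
  set w := omega _ D.
  have hw : (2 * w) ^+ 2 <= K ^+ 2 * (A * rho ^+ 2).
    apply: le_trans (omega_sqnorm _ _) _; apply: ler_pM => //; first exact: sqnorm_ge0.
    apply: le_trans (sqnorm_le_koranyi _) _.
    by rewrite lerXn2r ?nnegrE ?koranyi_ge0.
  have hv : (t - vert (q m)) ^+ 2 <= B ^+ 2 * rho ^+ 2.
    rewrite -exprMn -[leLHS]real_normK ?num_real// distrC lerXn2r ?nnegrE ?tP//.
    by rewrite !mulr_ge0// addr_ge0.
  have hD : sqnorm D ^+ 2 <= A ^+ 2 * rho ^+ 2.
    apply: (@le_trans _ _ ((A * rho ^+ 2) ^+ 2)); first by rewrite lerXn2r ?nnegrE ?mulr_ge0 ?sqr_ge0.
    by rewrite exprMn ler_wpM2l ?sqr_ge0// expr2 ler_piMr ?sqr_ge0// (le_trans rho2).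
  have h2 : (t - vert (q m) - w) ^+ 2 <= 2 * (t - vert (q m)) ^+ 2 + 2^-1 * (2 * w) ^+ 2.
    by have := sqr_ge0 (t - vert (q m) + w); nra.
  have G0 : 0 <= G.
    rewrite /G; have := sqr_ge0 A; have := sqr_ge0 B.
    by have := mulr_ge0 (sqr_ge0 K) A0; lra.
  apply: (@le_trans _ _ (G * rho ^+ 2)); last by rewrite ler_wpM2l.
  by rewrite /G; lra.
(* The rate in the statement is recovered through a far term [q (M + m)]: [qq] bounds the way to it,
   and the rest is at most [e]. *)
exists p => m; apply/ler_addgt0Pr => e e0.
have [M hM] := expr_small L r1 (exprn_gt0 4 e0).
have small : mdist (q (M + m)%N) p <= e.
  rewrite -(@ler_pXn2r _ 4)// ?nnegrE ?mdist_ge0 ?(ltW e0)//.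
  by rewrite (le_trans (LP _))// ltW// hM// leq_addr.
apply: le_trans (mdist_triangleP (q (M + m)%N) _ _) _.
by have := qq M m; have := rm (M + m)%N; rewrite -mulrA; lra.
Qed.

End heisenberg_complete.

Section planar_vectors.
Context {R : realType} {n : nat}.
Implicit Types (i j k : 'I_(n + n)) (a b : R).

Definition planar i j a b : 'rV[R]_(n + n) :=
  \row_k (a * (k == i)%:R + b * (k == j)%:R).

Lemma planar1 i j a b : i != j -> planar i j a b 0 i = a.
Proof. by move=> /negbTE ij; rewrite mxE eqxx ij mulr1 mulr0 addr0. Qed.

Lemma planar2 i j a b : i != j -> planar i j a b 0 j = b.
Proof. by move=> /negbTE ij; rewrite mxE eqxx eq_sym ij mulr1 mulr0 add0r. Qed.

Lemma planarD i j a b a' b' :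
  planar i j a b + planar i j a' b' = planar i j (a + a') (b + b').
Proof. by apply/rowP => k; rewrite !mxE; ring. Qed.

Lemma planarN i j a b : - planar i j a b = planar i j (- a) (- b).
Proof. by apply/rowP => k; rewrite !mxE; ring. Qed.

Lemma planarZ i j c a b : c *: planar i j a b = planar i j (c * a) (c * b).
Proof. by apply/rowP => k; rewrite !mxE; ring. Qed.

Lemma sqnorm_planar i j a b : i != j -> sqnorm (planar i j a b) = a ^+ 2 + b ^+ 2.
Proof.
move=> ij; rewrite /sqnorm (bigD1 i)//= (bigD1 j) 1?eq_sym//= planar1// planar2//.
rewrite big1 ?addr0// => k /andP[/negbTE ki /negbTE kj].
by rewrite mxE ki kj !mulr0 addr0 expr0n.
Qed.

Lemma omega_planar_r (k : 'I_n) (v : 'rV[R]_(n + n)) a b :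
  omega v (planar (lshift n k) (rshift n k) a b) =
  2^-1 * (v 0 (lshift n k) * b - v 0 (rshift n k) * a).
Proof.
rewrite /omega (bigD1 k)//= big1 ?addr0 => [|i /negbTE ik];
  rewrite !mxE !eq_lrshift !eq_rlshift ?eq_lshift ?eq_rshift ?eqxx ?ik /=; last by ring.
by congr (_ * _); ring.
Qed.

Lemma omega_planar_conjugate (k : 'I_n) a b a' b' :
  omega (planar (lshift n k) (rshift n k) a b)
        (planar (lshift n k) (rshift n k) a' b') = 2^-1 * (a * b' - b * a').
Proof. by rewrite omega_planar_r planar1 ?planar2// eq_lrshift. Qed.

Lemma omega_planar_isotropic (k l : 'I_n) a b a' b' :
  omega (planar (lshift n k) (lshift n l) a b)
        (planar (lshift n k) (lshift n l) a' b') = 0.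
Proof.
by rewrite /omega big1 ?mulr0// => i _; rewrite !mxE !eq_rlshift /=; ring.
Qed.

End planar_vectors.

(** * A zigzag curve *)

Section slopes.
Context {R : realType}.
Variable e : nat -> R.
Hypothesis e01 : forall m, 0 <= e m <= 1.

Definition pattern_sign (r : nat) : R := if (r == 0%N) || (r == 3)%N then 1 else -1.

(** Edge [4 k + r] of generation [m + 1] is the [r]-th quarter of edge [k]. A slope that has left
    [[-1, 1]] is frozen from then on, so no slope exceeds 2 and the curve is Lipschitz. Generation 0
    is flat for every [k], so the same slopes recur over each [[K, K + 1]]. *)
Fixpoint slope m k : R :=
  if m is m'.+1 then
    let g := slope m' (k %/ 4)%N in
    if `|g| <= 1 then g + pattern_sign (k %% 4)%N * e m' else g
  else 0.

Lemma slopeS m k r : (r < 4)%N -> slope m.+1 (4 * k + r)%N =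
  if `|slope m k| <= 1 then slope m k + pattern_sign r * e m else slope m k.
Proof. by move=> r4 /=; rewrite mulnC divnMDl// modnMDl divn_small// modn_small// addn0. Qed.

Lemma pattern_signM r (x : R) : `|pattern_sign r * x| = `|x|.
Proof. by rewrite normrM /pattern_sign; case: ifP => _; rewrite ?normrN normr1 mul1r. Qed.

Lemma slope_bound m k : `|slope m k| <= 2.
Proof.
elim: m k => [|m ih] k /=; first by rewrite normr0.
case: ifPn => [g1|_]; last exact: ih.
apply: le_trans (ler_normD _ _) _; rewrite pattern_signM.
by have /andP[e0 e1] := e01 m; rewrite (ger0_norm e0); lra.
Qed.

End slopes.

(** * The horizontal lift of the zigzag and its limit curve *)

Section lifted_curve.
Context {R : realType} {n : nat}.
Variables (k0 : 'I_n) (e : nat -> R).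
Hypothesis e01 : forall m, 0 <= e m <= 1.

Local Notation h m := ((4^-1 : R) ^+ m).
Local Notation i1 := (lshift n k0).
Local Notation i2 := (rshift n k0).

Definition edge m k : heisenberg R n :=
  Heis (planar i1 i2 (h m) (h m * slope e m k)) 0.

Fixpoint vertex m k : heisenberg R n :=
  if k is k'.+1 then (vertex m k' * edge m k')%g else 1%g.

Let i12 : i1 != i2. Proof. by rewrite eq_lrshift. Qed.

Let hS m : h m = 4 * h m.+1.
Proof. by rewrite exprS mulrA divff ?mul1r. Qed.

Let h_gt0 m : 0 < h m. Proof. by rewrite exprn_gt0. Qed.

(* A palindromic product of horizontal elements has zero vertical part. *)
Lemma edge_refine m k :
  (edge m.+1 (4 * k) * edge m.+1 (4 * k + 1) * edge m.+1 (4 * k + 2) *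
   edge m.+1 (4 * k + 3))%g = edge m k.
Proof.
rewrite -{1}[(4 * k)%N]addn0 /edge !slopeS// /pattern_sign/=.
set g := slope e m k; set x := h m.+1.
rewrite [h m]hS -/x.
apply: heis_eq; rewrite !heisE/= !planarD.
  by congr planar; [ring|case: ifP => _; ring].
by rewrite !omega_planar_conjugate; case: ifP => _; field.
Qed.

Lemma vertex_refine m k : vertex m.+1 (4 * k) = vertex m k.
Proof.
elim: k => [|k ih]; first by rewrite muln0.
have -> : (4 * k.+1 = (4 * k).+4)%N by lia.
by rewrite /= ih -(edge_refine m k) addn1 addn2 addn3 !mulgA.
Qed.

Lemma vertex_refineX m m' k : vertex (m' + m) (4 ^ m' * k) = vertex m k.
Proof.
by elim: m' => [|m' ih]; [rewrite mul1n|rewrite addSn expnS -mulnA vertex_refine].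
Qed.

(** As slopes are at most 2, the norm is at most [sqrt 5] times [h m]; its rounding 3 becomes the
    Lipschitz constant of the curve. *)
Lemma koranyi_edge m k : koranyi (edge m k) <= 3 * h m.
Proof.
apply: koranyi_le; first by rewrite mulr_ge0// ltW// h_gt0.
rewrite /= sqnorm_planar ?i12// [in (h m * _) ^+ 2]exprMn.
have := h_gt0 m; have := slope_bound e01 m k.
set x := h m; set g := slope e m k; rewrite ler_norml => /andP[g1 g2] x0.
have : g ^+ 2 <= 4 by nra.
move: (g ^+ 2) (sqr_ge0 g) (exprn_gt0 4 x0) => G G0 x4 G4.
rewrite expr0n/= mulr0 addr0.
have : (1 + G) ^+ 2 <= 81 by nra.
by rewrite (_ : (x ^+ 2 + x ^+ 2 * G) ^+ 2 = x ^+ 4 * (1 + G) ^+ 2);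
  [rewrite exprMn; nra|ring].
Qed.

Lemma mdist_vertex m k l : (k <= l)%N ->
  mdist (vertex m k) (vertex m l) <= 3 * h m * (l%:R - k%:R).
Proof.
move=> /subnK <-; elim: (l - k)%N => [|d ih].
  by rewrite add0n mdistxxP subrr mulr0.
apply: le_trans (mdist_triangleP (vertex m (d + k)) _ _) _.
have : mdist (vertex m (d + k)) (vertex m (d + k).+1) <= 3 * h m.
  by rewrite /= -[X in mdist X _]mulg1 mdist_mulg mdist_heisE invg1 mul1g koranyi_edge.
by rewrite addSn -[in leRHS]natr1; lra.
Qed.

Lemma vertex_coord m k : horiz (vertex m k) 0 i1 = h m * k%:R.
Proof.
elim: k => [|k ih]; first by rewrite mxE mulr0.
by rewrite /= mxE ih planar1 ?i12// -natr1; ring.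
Qed.

Let idx m (x : R) := Num.truncn (x / h m).

Let idxP m x : 0 <= x -> h m * (idx m x)%:R <= x < h m * (idx m x).+1%:R.
Proof.
move=> x0; have := truncn_itv (divr_ge0 x0 (ltW (h_gt0 m))).
by rewrite ler_pdivlMr ?h_gt0// ltr_pdivrMr ?h_gt0// ![_ * h m]mulrC.
Qed.

Let idx_uniq m x k : h m * k%:R <= x < h m * k.+1%:R -> idx m x = k.
Proof.
move=> kx; apply: truncn_def.
by rewrite ler_pdivlMr ?h_gt0// ltr_pdivrMr ?h_gt0// ![_ * h m]mulrC.
Qed.

Let idxS m x : 0 <= x -> (4 * idx m x <= idx m.+1 x <= 4 * idx m x + 3)%N.
Proof.
move=> x0; have /andP[a1 a2] := idxP m x0; have /andP[b1 b2] := idxP m.+1 x0.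
have h0 := h_gt0 m.+1; rewrite hS in a1 a2; apply/andP; split.
  rewrite -ltnS -(@ltr_nat R) natrM -(ltr_pM2l h0); lra.
rewrite -ltnS -addnS -(@ltr_nat R) natrD natrM -(ltr_pM2l h0).
have nS : (idx m x).+1%:R = (idx m x)%:R + 1 :> R by rewrite natr1.
by rewrite nS in a2; lra.
Qed.

(** [gamma x] is the limit of the last vertices of generation [m] not beyond [x]. Refinement keeps
    the old vertices, so consecutive approximations are at most three short edges apart, and at a
    grid point the sequence becomes constant. *)
Lemma lifted_curve_exists : exists gamma : R -> heisenberg R n,
  [/\ forall x y, 0 <= x -> 0 <= y -> mdist (gamma x) (gamma y) <= 3 * `|x - y|,
      forall x, 0 <= x -> horiz (gamma x) 0 i1 = x &
      forall m k, gamma (h m * k%:R) = vertex m k].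
Proof.
have r14 : 0 <= (4^-1 : R) <= 2^-1 by lra.
have r1 : 0 <= (4^-1 : R) < 1 by lra.
have /choice[gamma gammaP] : forall x, exists p, 0 <= x ->
    forall m, mdist (vertex m (idx m x)) p <= 6 * h m.
  move=> x; have [x0|x0] := leP 0 x; last by exists 1%g.
  have step m : mdist (vertex m (idx m x)) (vertex m.+1 (idx m.+1 x)) <= 3 * h m.
    have /andP[le1 le2] := idxS m x0.
    rewrite -vertex_refine; apply: le_trans (mdist_vertex _ le1) _.
    rewrite -mulrA ler_pM2l// [leRHS]hS mulrC ler_pM2r ?h_gt0//.
    by rewrite lerBlDl -natrD ler_nat (leq_trans le2)// leq_add2l.
  have [//|p hp] := heisenberg_geometric_limit _ r14 step.
  by exists p => _ m; rewrite (le_trans (hp m))//; have := h_gt0 m; lra.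
have lip x y : 0 <= x -> 0 <= y -> mdist (gamma x) (gamma y) <= 3 * `|x - y|.
  wlog xy : x y / x <= y.
    move=> H x0 y0; have [xy|/ltW xy] := leP x y; first exact: H.
    by rewrite mdistC distrC; exact: H.
  (* 15 is twice the approximation error 6 plus 3 for one grid step. *)
  move=> x0 y0; apply: (@le_of_small _ _ _ 15 4^-1 r1) => m.
  have gx := gammaP x x0 m; have gy := gammaP y y0 m.
  have /andP[a1 a2] := idxP m x0; have /andP[b1 b2] := idxP m y0.
  have h0 := h_gt0 m.
  have ixy : (idx m x <= idx m y)%N.
    by rewrite -ltnS -(@ltr_nat R) -(ltr_pM2l h0); lra.
  have := mdist_vertex m ixy.
  have := mdist_triangleP (vertex m (idx m x)) (gamma x) (gamma y).
  have := mdist_triangleP (vertex m (idx m y)) (vertex m (idx m x)) (gamma y).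
  rewrite (mdistC (gamma x) (vertex _ _)) ler0_norm; last by lra.
  have nS : (idx m x).+1%:R = (idx m x)%:R + 1 :> R by rewrite natr1.
  by rewrite nS in a2; rewrite mulrBr -!mulrA; lra.
exists gamma; split=> // [x x0|m k].
  apply/eqP; rewrite -subr_eq0 -normr_le0.
  apply: (@le_of_small _ _ _ 7 4^-1 r1) => m.
  have := gammaP x x0 m; have := coord_lipschitz i1 (gamma x) (vertex m (idx m x)).
  have /andP[a1 a2] := idxP m x0; rewrite vertex_coord.
  have nS : (idx m x).+1%:R = (idx m x)%:R + 1 :> R by rewrite natr1.
  rewrite nS in a2.
  rewrite mdistC ler_norml => /andP[c1 c2] c3.
  by rewrite ler_norml; apply/andP; split; lra.
have x0 : 0 <= h m * k%:R by rewrite mulr_ge0// ltW// h_gt0.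
apply/esym/mdist_positivity/eqP; rewrite eq_le mdist_ge0 andbT.
apply: (@le_of_small _ _ _ (6 * h m) 4^-1 r1) => m'; rewrite add0r.
have := gammaP _ x0 (m' + m)%N; rewrite (_ : idx _ _ = 4 ^ m' * k)%N.
  by rewrite vertex_refineX exprD mulrA mulrAC.
have E : h (m' + m) * (4 ^ m' * k)%:R = h m * k%:R.
  by rewrite natrM natrX exprD mulrACA -exprMn mulVf// expr1n mul1r.
by apply: idx_uniq; rewrite E lexx -[X in _ < _ * X]natr1 mulrDr mulr1 E ltrDl h_gt0.
Qed.

End lifted_curve.

(** * Deviation of a zigzag from horizontal lines *)

Section line_deviation.
Context {R : realType} {n : nat}.
Implicit Types (p q r : heisenberg R n) (v d : 'rV[R]_(n + n)).

(** [r] and [r'] are the displacements of consecutive points from the line, and [c *: v] is the step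
    along it. As the edge has no vertical part, comparing vertical parts leaves two terms of at most
    [delta^2 / 4] and one [omega] of at most [delta^2 / 2]. *)
Let line_step r r' v (c delta : R) d :
  Heis d 0 = (r^-1 * Heis (c *: v) 0 * r')%g ->
  koranyi r <= delta -> koranyi r' <= delta ->
  [/\ `|c * (omega v (horiz r) + omega v (horiz r'))| <= delta ^+ 2,
      omega v d = omega v (horiz r') - omega v (horiz r) &
      forall i, d 0 i = c * v 0 i + horiz r' 0 i - horiz r 0 i].
Proof.
move=> E kr kr'; have Eh : d = - horiz r + c *: v + horiz r' by have := congr1 (@horiz R n) E.
split.
- have := congr1 (@vert R n) E; rewrite /= omegaDl omegaNl (omegaC (horiz r) (c *: v)).
  rewrite omegaNl !omegaZl => E0.
  have {E0} -> : c * (omega v (horiz r) + omega v (horiz r')) =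
      vert r - vert r' + omega (horiz r) (horiz r') by lra.
  have := omega_le_koranyi r r'; have := vert_le_koranyi r; have := vert_le_koranyi r'.
  have k0 := koranyi_ge0 r; have k0' := koranyi_ge0 r'.
  have d0 : 0 <= delta := le_trans k0 kr.
  have e1 : koranyi r ^+ 2 <= delta ^+ 2 by rewrite lerXn2r ?nnegrE.
  have e2 : koranyi r' ^+ 2 <= delta ^+ 2 by rewrite lerXn2r ?nnegrE.
  have e3 : koranyi r * koranyi r' <= delta ^+ 2 by rewrite expr2 ler_pM.
  move=> t' t w; apply: le_trans (ler_normD _ _) _.
  by have := ler_normB (vert r) (vert r'); lra.
- by rewrite Eh !omegaDr omegaNr omegaZr omegaxx; ring.
- by move=> i; rewrite Eh !mxE; ring.
Qed.

(* If [p_0, ..., p_3] are close to the points [q_i] of the line, then the sums of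
   the normal deviations [u_i = omega v (q_i^-1 p_i)] of consecutive points are
   quadratically small, since all the vertical parts vanish. As
   [u_2 - u_1 = u_3 - u_2], so are the [u_i] themselves, which bounds the angle
   between the two edge directions. *)
Lemma zigzag_line_deviation (k : 'I_n) (p : nat -> heisenberg R n) l (a g e delta : R) :
  let d b := planar (lshift n k) (rshift n k) a b in
  0 < a -> 0 <= e -> 4 * delta <= a ->
  p 1%N = (p 0%N * Heis (d (a * (g + e))%R) 0)%g ->
  p 2%N = (p 1%N * Heis (d (a * (g - e))%R) 0)%g ->
  p 3%N = (p 2%N * Heis (d (a * (g - e))%R) 0)%g ->
  horizontal_lines R n l ->
  (forall i, (i < 4)%N -> exists2 q, l q & mdist (p i) q <= delta) ->
  a ^+ 2 * e <= 8 * delta ^+ 2.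
Proof.
move=> d a0 e0 da p1 p2 p3 [p' [V [V1 ->]]] close.
pose v0 := (vbasis V)`_0.
have Vv0 v : v \in V -> exists c, v = c *: v0.
  have : V = <[v0]>%VS.
    have := span_basis (vbasisP V); rewrite /v0; case: (vbasis V) => s /= /eqP.
    by rewrite V1; case: s => [//|w [|]//] _ <-; rewrite span_seq1.
  by move=> -> /vlineP.
have /choice[s sP] : forall i, exists c, (i < 4)%N ->
    mdist (p i) (p' * Heis (c *: v0) 0)%g <= delta.
  move=> i; have [i4|] := ltnP i 4; last by exists 0.
  by have [_ [v /Vv0[c ->] <-] ?] := close _ i4; exists c.
pose q i := (p' * Heis (s i *: v0) 0)%g.
pose r i := ((q i)^-1 * p i)%g.
have kr i : (i < 4)%N -> koranyi (r i) <= delta.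
  by move=> /sP; rewrite mdistC.
have qS i : Heis ((s i.+1 - s i) *: v0) 0 = ((q i)^-1 * q i.+1)%g.
  rewrite /q invgM -mulgA mulKg; apply: heis_eq; rewrite !heisE/=.
    by rewrite scalerBl addrC.
  by rewrite omegaNl omegaZl omegaZr omegaxx; ring.
have step i dd : p i.+1 = (p i * Heis dd 0)%g ->
    Heis dd 0 = ((r i)^-1 * Heis ((s i.+1 - s i)%R *: v0) 0 * r i.+1)%g.
  move=> pS; rewrite qS /r; move: (q i) (q i.+1) => x y.
  by rewrite invgM invgK -!mulgA !mulVKg pS mulKg.
pose i1 := lshift n k.
have i12 : i1 != rshift n k by rewrite eq_lrshift.
have dx i : (i < 4)%N -> `|horiz (r i) 0 i1| <= delta.
  by move=> i4; rewrite (le_trans (coord_le_koranyi _ _))// kr.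
(* With first coordinate 1 in the direction, [c i] is the advance in that coordinate. It is at least
   [a / 2], since both ends are moved by at most [delta <= a / 4]. *)
pose v := (v0 0 i1)^-1 *: v0; pose c i := (s i.+1 - s i) * v0 0 i1.
have cv i dd : p i.+1 = (p i * Heis dd 0)%g -> (i < 3)%N -> dd 0 i1 = a ->
    [/\ a <= 2 * c i, Heis dd 0 = ((r i)^-1 * Heis (c i *: v) 0 * r i.+1)%g &
    v0 0 i1 != 0].
  move=> /step E i3 ddx.
  have [_ _ /(_ i1)] := line_step E (kr _ (leqW i3)) (kr _ (i3 : (i.+1 < 4)%N)).
  rewrite ddx => Ea; have ca : a <= 2 * c i.
    have := dx i (leqW i3); have := dx i.+1 i3; rewrite !ler_norml /c.
    by move=> /andP[? ?] /andP[? ?]; lra.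
  have v00 : v0 0 i1 != 0 by apply/eqP => v00; move: ca; rewrite /c v00; lra.
  by split=> //; rewrite /v /c scalerA mulfK.
have dE b : planar i1 (rshift n k) a b 0 i1 = a by rewrite planar1.
have [c0 /line_step/(_ (kr _ _) (kr _ _))[//|//|w0 u0 _] v00] := cv _ _ p1 isT (dE _).
have [c1 /line_step/(_ (kr _ _) (kr _ _))[//|//|w1 u1 _] _] := cv _ _ p2 isT (dE _).
have [c2 /line_step/(_ (kr _ _) (kr _ _))[//|//|w2 u2 _] _] := cv _ _ p3 isT (dE _).
have div x y (D : R) : a <= 2 * x -> `|x * y| <= D -> a * `|y| <= 2 * D.
  move=> ax; rewrite normrM => xy; have x0 : 0 < x by lra.
  by rewrite gtr0_norm// in xy; have := normr_ge0 y; nra.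
have {}w0 := div _ _ _ c0 w0; have {}w1 := div _ _ _ c1 w1.
have {}w2 := div _ _ _ c2 w2.
have vx : v 0 i1 = 1 by rewrite mxE mulVf.
have ae : omega v (d (a * (g + e))) - omega v (d (a * (g - e))) = a * e.
  by rewrite !omega_planar_r vx; field.
(* The first and third edges turn [a e] into [u_1 - u_0 - (u_3 - u_2)], that is [2 (u_1 + u_2) -
   (u_0 + u_1) - (u_2 + u_3)]. Each sum is at most [2 delta^2 / a] in modulus, whence the factor
   8. *)
rewrite u0 in ae; rewrite {}u2 in u1 ae; rewrite expr2 -mulrA -{}ae.
move: (omega v _) (omega v _) (omega v _) (omega v _) u1 w0 w1 w2 => U0 U1 U2 U3 U.
have abs y D : a * `|y| <= D -> - D <= a * y <= D by rewrite -ler_norml normrM (gtr0_norm a0).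
move=> /abs/andP[w0 w0'] /abs/andP[w1 w1'] /abs/andP[w2 w2'].
have : a * (U3 - U2) = a * (U2 - U1) by rewrite U.
by lra.
Qed.

End line_deviation.

Section dilation.
Context {R : realType} {T : metricType R}.
Implicit Types (E Q A : set T) (x y : T).

Lemma dilate2_near E Q x z : Q z -> E x -> ((mdist x z)%:E <= diam Q)%E -> dilate 2 E Q x.
Proof.
move=> Qz Ex xz; split=> //; rewrite (_ : 2 - 1 = 1); last by ring.
by rewrite mul1e (le_trans _ xz)// edist_inf_le.
Qed.

Lemma diam_dilate2 E Q (d : R) : (diam Q <= d%:E)%E -> (diam (dilate 2 E Q) <= (3 * d)%:E)%E.
Proof.
move=> Qd; have d0 : 0 <= d by rewrite -lee_fin (le_trans (diam_ge0 Q)).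
apply: diam_le => [|x y [_ xQ] [_ yQ]]; first by rewrite lee_fin mulr_ge0.
rewrite lee_fin; apply/ler_addgt0Pr => e e0.
have close z : (edist_inf Q z <= (2 - 1)%:E * diam Q)%E -> exists2 w, Q w & mdist z w < d + e / 2.
  move=> zQ; apply: edist_inf_lt; apply: le_lt_trans zQ _.
  rewrite (_ : 2 - 1 = 1); last by ring.
  by rewrite mul1e (le_lt_trans Qd)// lte_fin ltrDl divr_gt0.
have [x' Qx xx'] := close _ xQ; have [y' Qy yy'] := close _ yQ.
have := le_trans (mdist_le_diam Qx Qy) Qd; rewrite lee_fin => xy'.
have := mdist_triangleP x' x y; have := mdist_triangleP y' x' y.
by rewrite (mdistC y' y); lra.
Qed.

End dilation.

(** * Regularity of a Lipschitz graph over the half-line *)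

Section unit_speed_graph.
Context {R : realType} {n : nat}.
Variables (i1 : 'I_(n + n)) (gamma : R -> heisenberg R n).
Hypothesis lip : forall x y, 0 <= x -> 0 <= y ->
  mdist (gamma x) (gamma y) <= 3 * `|x - y|.
Hypothesis coord : forall x, 0 <= x -> horiz (gamma x) 0 i1 = x.

Local Notation Gamma := (gamma @` [set` `[0, +oo[ ]).

Let GammaP x : 0 <= x -> Gamma (gamma x).
Proof. by move=> x0; exists x => //=; rewrite in_itv/= x0. Qed.

Let ge_param z : Gamma z -> exists2 x, 0 <= x & z = gamma x.
Proof. by move=> [x /=]; rewrite in_itv/= andbT => x0 <-; exists x. Qed.

Lemma mdist_graph_ge x y : 0 <= x -> 0 <= y -> `|x - y| <= mdist (gamma x) (gamma y).
Proof. by move=> x0 y0; rewrite -{1}(coord x0) -{1}(coord y0) coord_lipschitz. Qed.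

Lemma graph_length_ge (s r : R) A : 0 <= s -> 0 < r ->
  (forall x, s <= x < s + r -> A (gamma x)) -> ((r / 2)%:E <= hausdorff1 A)%E.
Proof.
move=> s0 r0 sA.
have := @lipschitz_length_le R _ (fun z : heisenberg R n => horiz z 0 i1) 1 s (s + r) A.
rewrite (_ : (s + r - s) / (2 * 1) = r / 2); last by field.
apply=> // [x y _ _|x]; first by rewrite mul1r coord_lipschitz.
rewrite /= in_itv/= => /andP[sx xr].
by exists (gamma x); [apply: sA; rewrite (ltW sx)|rewrite coord// (le_trans s0)// ltW].
Qed.

Lemma graph_closed : closed Gamma.
Proof.
move=> z zG.
have near e : 0 < e -> exists2 x, 0 <= x & mdist z (gamma x) < e.
  move=> e0; have [y [/ge_param[x x0 ->]]] := zG _ (nbhsx_ballx z _ e0).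
  by rewrite ballEmdist /=; exists x.
have z0 : 0 <= horiz z 0 i1.
  apply/ler_addgt0Pr => e /near[x x0 zx].
  have := le_lt_trans (coord_lipschitz i1 z (gamma x)) zx.
  by rewrite coord// ltr_norml => /andP[? ?]; lra.
suff -> : z = gamma (horiz z 0 i1) by exact: GammaP.
apply: mdist_positivity; apply/eqP; rewrite eq_le mdist_ge0 andbT.
apply/ler_addgt0Pr => e e0; have /near[x x0 zx] : 0 < e / 4 by rewrite divr_gt0.
have := coord_lipschitz i1 z (gamma x); rewrite coord// => h1.
have := lip x0 z0; have := mdist_triangleP (gamma x) z (gamma (horiz z 0 i1)).
by rewrite distrC; lra.
Qed.

Lemma graph_curve : curve Gamma.
Proof.
(* [gamma] is controlled at nonnegative parameters; composed with the absolute value it is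
   continuous on the whole line. *)
exists `[0, +oo[, (fun x => gamma `|x|); split; last first.
  by apply: eq_imagel => x /=; rewrite in_itv/= andbT => x0; rewrite ger0_norm.
apply: continuous_subspaceT => x; apply/cvg_ballP => e e0.
have e3 : 0 < e / 3 by rewrite divr_gt0.
near=> y; rewrite ballEmdist /=; apply: le_lt_trans (lip _ _) _ => //.
have xy : `|x - y| < e / 3 by near: y; exact: (nbhsx_ballx x _ e3).
by have := ler_dist_dist x y; lra.
Unshelve. all: by end_near.
Qed.

Lemma graph_unbounded : diam Gamma = +oo%E.
Proof.
apply: eq_infty => r.
apply: le_trans (mdist_le_diam (GammaP (lexx 0)) (GammaP (normr_ge0 r))).
rewrite lee_fin (le_trans (ler_norm r))//.
by have := mdist_graph_ge (lexx 0) (normr_ge0 r); rewrite sub0r normrN normr_id.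
Qed.

(** The first coordinate is 1-Lipschitz, so the ball meets the graph over an interval of length
    [2 r]; each of its [N] equal pieces has an image of diameter at most [3 * (2 r / N)]. *)
Lemma graph_ball_upper z (r : R) : Gamma z -> 0 < r ->
  (hausdorff1 (ball z r `&` Gamma) <= (6 * r)%:E)%E.
Proof.
move=> /ge_param[x x0 ->] r0; apply: hausdorff1_le_cover => delta d0.
pose N := (Num.truncn (6 * r / delta)).+1.
have N0 : 0 < N%:R :> R by rewrite ltr0n.
have Nd : 6 * r / N%:R <= delta.
  by rewrite ler_pdivrMr// [leRHS]mulrC -ler_pdivrMr// ltW// truncnS_gt.
pose w := 2 * r / N%:R; have w0 : 0 < w by rewrite divr_gt0// mulr_gt0.
pose U i := gamma @` [set y | 0 <= y /\ x - r + i%:R * w <= y <= x - r + i.+1%:R * w].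
exists N, (6 * r / N%:R), U; split.
- by rewrite Nd andbT divr_ge0// mulr_ge0// ltW.
- move=> t [xt /ge_param[y y0 ty]]; move: xt; rewrite {t}ty ballEmdist/= => xy.
  have := le_lt_trans (mdist_graph_ge x0 y0) xy; rewrite ltr_distlC => /andP[xy1 xy2].
  have t0 : 0 <= (y - (x - r)) / w by rewrite divr_ge0 ?ltW//; lra.
  have := truncn_itv t0; set i := Num.truncn _; rewrite ler_pdivlMr// ltr_pdivrMr// => /andP[i1' i2'].
  exists i; last by exists y => //=; split=> //; apply/andP; split; lra.
  rewrite /= -(@ltr_nat R) -(ltr_pM2r w0); apply: le_lt_trans i1' _.
  by rewrite /w mulrCA divff ?gt_eqF//; lra.
- move=> i; apply: diam_le => [|_ _ [y [y0 /andP[y1 y2]] <-] [y' [y0' /andP[y1' y2']] <-]].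
    by rewrite lee_fin divr_ge0 ?mulr_ge0// ltW.
  rewrite lee_fin; apply: le_trans (lip y0 y0') _.
  have -> : 6 * r / N%:R = 3 * w by rewrite /w; field; rewrite gt_eqF.
  rewrite ler_pM2l// ler_norml.
  have nS : i.+1%:R = i%:R + 1 :> R by rewrite natr1.
  by rewrite nS mulrDl mul1r in y2 y2'; apply/andP; split; lra.
- by rewrite mulrCA divff ?gt_eqF// mulr1.
Qed.

(** The arc of parameter length [r / 3] to the right of [x] stays in the ball; [graph_length_ge]
    costs another factor 2. *)
Lemma graph_ball_lower x (r : R) A : 0 <= x -> 0 < r ->
  ball (gamma x) r `&` Gamma `<=` A -> ((r / 6)%:E <= hausdorff1 A)%E.
Proof.
move=> x0 r0 rA; rewrite (_ : r / 6 = r / 3 / 2); last by field.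
apply: (graph_length_ge x0) => [|y /andP[xy yr]]; first by rewrite divr_gt0.
have y0 := le_trans x0 xy.
apply: rA; split; last exact: GammaP.
rewrite ballEmdist/=; apply: le_lt_trans (lip x0 y0) _.
by rewrite distrC ger0_norm; lra.
Qed.

Lemma graph_regular : Reg1 6 Gamma.
Proof.
split=> [||| _ r /ge_param[x x0 ->] r0 _]; first by lra.
- exact: graph_closed.
- by rewrite graph_unbounded.
- rewrite graph_ball_upper ?andbT//; last exact: GammaP.
  by rewrite mulrC; apply: (graph_ball_lower x0 r0).
Qed.

End unit_speed_graph.

(** * How many edges have a small slope *)

Section slope_counting.
Context {R : realType}.
Variable e : nat -> R.
Hypothesis e01 : forall m, 0 <= e m <= 1.

Lemma sum_blocks4 (F : nat -> R) N :
  \sum_(i < 4 * N) F i = \sum_(i < N) \sum_(r < 4) F (4 * i + r)%N.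
Proof.
elim: N => [|N ih]; first by rewrite muln0 !big_ord0.
rewrite (_ : (4 * N.+1 = (4 * N).+4)%N); last by lia.
rewrite 5!big_ord_recr/= ih !big_ord_recr big_ord0/=.
by rewrite addn0 addn1 addn2 addn3 add0r !addrA.
Qed.

(** The slope is a stopped martingale: over the four children the mean square is [g^2 + e^2], and a
    frozen edge adds nothing. [K] selects a unit interval. *)
Lemma slope_second_moment K m :
  \sum_(i < 4 ^ m) slope e m (4 ^ m * K + i) ^+ 2 <=
  4 ^+ m * \sum_(j < m) e j ^+ 2.
Proof.
elim: m => [|m ih].
  by rewrite expn0 big_ord1 big_ord0 /= expr0n mulr0.
rewrite expnS; rewrite (sum_blocks4 (fun i => slope e m.+1 (4 * 4 ^ m * K + i) ^+ 2)).
rewrite big_ord_recr/= exprS.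
apply: (@le_trans _ _ (\sum_(i < 4 ^ m) 4 * (slope e m (4 ^ m * K + i) ^+ 2 + e m ^+ 2))).
  apply: ler_sum => i _.
  pose G r := slope e m.+1 (4 * 4 ^ m * K + (4 * i + r)).
  set g := slope e m (4 ^ m * K + i).
  have GE r : (r < 4)%N -> G r = if `|g| <= 1 then g + pattern_sign r * e m else g.
    by move=> r4; rewrite /G addnA -mulnA -mulnDr slopeS.
  rewrite -[leLHS]/(\sum_(r < 4) G r ^+ 2); clearbody G.
  rewrite !big_ord_recr big_ord0/= !GE// /pattern_sign/=; case: ifP => _; first by lra.
  by have := sqr_ge0 (e m); lra.
rewrite -mulr_sumr -mulrA ler_pM2l// big_split/= mulrDr lerD//.
by rewrite sumr_const card_ord -[leLHS]mulr_natl natrX.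
Qed.

(** Chebyshev's inequality: [1 - 4 g^2] is at most the indicator of [|g| <= 1/2], and its mean is at
    least [1 - 4/8]. *)
Lemma slope_small_count K m : \sum_(j < m) e j ^+ 2 <= 8^-1 ->
  4 ^+ m / 2 <= \sum_(i < 4 ^ m) ((`|slope e m (4 ^ m * K + i)| <= 2^-1)%R%:R : R).
Proof.
move=> he; have h4 : 0 < 4 ^+ m :> R by rewrite exprn_gt0.
have : \sum_(i < 4 ^ m) (1 - 4 * slope e m (4 ^ m * K + i) ^+ 2) <=
    \sum_(i < 4 ^ m) ((`|slope e m (4 ^ m * K + i)| <= 2^-1)%R%:R : R).
  apply: ler_sum => i _; set g := slope _ _ _; have := sqr_ge0 g.
  case: (leP `|g| 2^-1) => hg /=; first by lra.
  have : 2^-1 ^+ 2 <= `|g| ^+ 2 by rewrite lerXn2r ?nnegrE// ltW.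
  by rewrite real_normK ?num_real//; lra.
apply: le_trans; rewrite sumrB -mulr_sumr sumr_const card_ord natrX.
have := slope_second_moment K m; have : 4 ^+ m * \sum_(j < m) e j ^+ 2 <= 4 ^+ m * 8^-1.
  by rewrite ler_pM2l.
by lra.
Qed.

(** First children change the slope by at most [eps] per generation, in total by at most 1/2. A cube
    is tested on a zigzag [b] generations finer than the vertex it contains, and there the slope
    must not be frozen yet. *)
Lemma slope_descend m b k (eps : R) : (forall m', (m <= m')%N -> e m' <= eps) ->
  b%:R * eps <= 2^-1 -> `|slope e m k| <= 2^-1 -> `|slope e (b + m) (4 ^ b * k)| <= 1.
Proof.
move=> hm hb h0.
have eps0 : 0 <= eps by have /andP[? _] := e01 m; apply: le_trans (hm m _).
suff H j : (j <= b)%N -> `|slope e (j + m) (4 ^ j * k)| <= 2^-1 + j%:R * eps.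
  by apply: le_trans (H b _) _ => //; lra.
elim: j => [|j ih] jb; first by rewrite expn0 mul1n add0n mul0r addr0.
rewrite addSn expnS -mulnA -[(4 * _)%N]addn0 slopeS//.
have {ih}h := ih (ltnW jb); have hj := hm (j + m)%N (leq_addl _ _).
have jS : j.+1%:R = j%:R + 1 :> R by rewrite natr1.
rewrite jS mulrDl mul1r; case: ifP => _; last by lra.
apply: le_trans (ler_normD _ _) _; rewrite pattern_signM.
by have /andP[e0 _] := e01 (j + m)%N; rewrite (ger0_norm e0); lra.
Qed.

End slope_counting.

Section beta_lower_bound.
Context {R : realType} {n : nat}.
Variables (k0 : 'I_n) (e : nat -> R).

Lemma beta_zigzag_ge (S : set (heisenberg R n)) m k (d : R) :
  0 < e m -> e m <= 1 -> `|slope e m k| <= 1 -> (diam S <= d%:E)%E ->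
  (0 < diam S)%E ->
  (forall i, (i < 4)%N -> S (vertex k0 e m.+1 (4 * k + i))) ->
  ((4^-1 ^+ m * Num.sqrt (e m) / (16 * d))%:E <= beta_infty (horizontal_lines R n) S)%E.
Proof.
move=> e0 e1 g1 Sd S0 pS; apply: le_ereal_inf_tmp => _ [l ll <-].
set rho := Num.sqrt (e m); set h := 4^-1 ^+ m.
have h0 : 0 < h by rewrite exprn_gt0.
have rho0 : 0 < rho by rewrite sqrtr_gt0.
have rho2 : rho ^+ 2 = e m by rewrite sqr_sqrtr// ltW.
have rho1 : rho <= 1 by rewrite -(@ler_pXn2r _ 2)// ?nnegrE ?(ltW rho0)// rho2 expr1n.
have fS : diam S = (fine (diam S))%:E.
  by rewrite fineK// ge0_fin_numE ?diam_ge0// (le_lt_trans Sd)// ltry.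
set s := fine (diam S) in fS *; rewrite fS lte_fin in S0; rewrite fS lee_fin in Sd.
rewrite leNgt; apply/negP => lt.
(* Edges advancing by [h / 4] with all four vertices within [delta] of a line would give
   [h^2 e / 16 <= 8 delta^2 = h^2 e / 32]. *)
pose delta := h * rho / 16.
have vS r : (r < 4)%N -> vertex k0 e m.+1 (4 * k + r.+1) =
    (vertex k0 e m.+1 (4 * k + r) * Heis (planar (lshift n k0) (rshift n k0)
      (4^-1 * h)%R (4^-1 * h * (slope e m k + pattern_sign r * e m))%R) 0)%g.
  by move=> r4; rewrite addnS /= /edge slopeS// g1 -exprS.
have : (4^-1 * h) ^+ 2 * e m <= 8 * delta ^+ 2.
  apply: (@zigzag_line_deviation _ _ k0 (fun i => vertex k0 e m.+1 (4 * k + i)) l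
    (4^-1 * h) (slope e m k) (e m) delta) => //.
  - by rewrite mulr_gt0.
  - exact: ltW.
  - have : h * rho <= h by rewrite ler_piMr// ltW.
    by rewrite /delta; lra.
  - by rewrite (vS 0%N)// /pattern_sign/= mul1r.
  - by rewrite (vS 1%N)// /pattern_sign/= mulN1r.
  - by rewrite (vS 2%N)// /pattern_sign/= mulN1r.
  move=> i i4; have /edist_inf_lt : (edist_inf l (vertex k0 e m.+1 (4 * k + i)) < delta%:E)%E.
    have := le_lt_trans (ereal_sup_ubound (ex_intro2 _ _ _ (pS i i4) erefl)) lt.
    rewrite lte_pdivrMr//; move=> /lt_le_trans; apply.
    have dd0 : 0 < d := lt_le_trans S0 Sd.
    rewrite -EFinM lee_fin (_ : _ * s = delta * (s / d)).
      rewrite ler_piMr ?divr_ge0 ?mulr_ge0 ?(ltW h0) ?(ltW rho0)//.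
      by rewrite ler_pdivrMr ?mul1r.
    by rewrite /delta; field; rewrite gt_eqF.
  by move=> [y ly /ltW]; exists y.
rewrite /delta -rho2; have : 0 < (h * rho) ^+ 2 by rewrite exprn_gt0// mulr_gt0.
by rewrite !exprMn; lra.
Qed.

End beta_lower_bound.

Section power_series.
Context {R : realType}.

Lemma harmonic_unbounded (B : R) : exists N, B <= \sum_(i < N) i.+1%:R^-1.
Proof.
apply: contrapT => /forallNP bounded; apply: (@dvg_harmonic R).
apply: nondecreasing_is_cvgn.
  by apply/nondecreasing_seqP => N; rewrite /series/= big_nat_recr//= lerDl.
exists B => _ [N _ <-]; rewrite /series/= big_mkord.
by have /negP := bounded N; rewrite -ltNge => /ltW.
Qed.

(** Cauchy condensation: the terms with [2^l <= j < 2^(l+1)] sum to at most [q^l], where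
    [q = 2^(1 - a) < 1]. *)
Lemma riemann_bounded (a : R) : 1 < a ->
  exists S, forall m, \sum_(j < m) j.+1%:R `^ (- a) <= S.
Proof.
move=> a1; pose f j : R := j%:R `^ (- a).
have f0 j : 0 <= f j by exact: powR_ge0.
pose q : R := 2 * 2 `^ (- a).
have q0 : 0 <= q by rewrite mulr_ge0 ?powR_ge0.
have q1 : q < 1.
  rewrite /q -{1}(powRr1 (ler0n R 2)) -powRD; last by rewrite pnatr_eq0 implybT.
  by rewrite /powR pnatr_eq0/= -[ltRHS]expR0 ltr_expR pmulr_llt0 ?ln_gt0 ?ltr1n// subr_lt0.
have block l : \sum_(1 <= j < 2 ^ l) f j <= (1 - q)^-1 - q ^+ l / (1 - q).
  elim: l => [|l ih].
    by rewrite expn0 big_geq// expr0 mul1r subrr.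
  rewrite (big_cat_nat (n := 2 ^ l)) ?expn_gt0 ?leq_exp2l//=.
  have -> : (1 - q)^-1 - q ^+ l.+1 / (1 - q) = (1 - q)^-1 - q ^+ l / (1 - q) + q ^+ l.
    by rewrite exprS; field; rewrite subr_eq0 gt_eqF.
  apply: lerD => //.
  apply: (@le_trans _ _ (\sum_(2 ^ l <= j < 2 ^ l.+1) f (2 ^ l)%N)).
    rewrite [leLHS]big_nat [leRHS]big_nat; apply: ler_sum => j /andP[lj _].
    rewrite /f !powRN lef_pV2 ?posrE ?powR_gt0 ?ltr0n ?expn_gt0//.
      by rewrite ge0_ler_powR ?nnegrE ?ler_nat// ltW// (lt_trans ltr01).
    by rewrite (leq_trans _ lj)// expn_gt0.
  have fl : f (2 ^ l)%N = (2 `^ (- a)) ^+ l.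
    by rewrite /f natrX -powR_mulrn// -powRrM mulrC powRrM powR_mulrn ?powR_ge0.
  rewrite big_const_nat iter_addr_0 expnS mul2n -addnn addnK fl.
  by rewrite -[leLHS]mulr_natl natrX /q exprMn.
exists (1 - q)^-1 => m.
have -> : \sum_(j < m) j.+1%:R `^ (- a) = \sum_(1 <= j < m.+1) f j.
  by rewrite big_add1/= big_mkord.
have m2 : (m.+1 <= 2 ^ m.+1)%N by rewrite ltnW// ltn_expl.
apply: (@le_trans _ _ (\sum_(1 <= j < 2 ^ m.+1) f j)).
  by rewrite [leRHS](big_cat_nat (n := m.+1))//= lerDl sumr_ge0.
apply: le_trans (block _) _; rewrite gerBl divr_ge0 ?exprn_ge0// subr_ge0 ltW//.
Qed.

End power_series.

Section scales.
Context {R : realType}.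

Lemma exp2_fine N : (2 : R) ^ (- (2 * N)%:Z) = 4^-1 ^+ N.
Proof. by rewrite -exprnN -exprVn exprM; congr (_ ^+ _); rewrite expr2; field. Qed.

Lemma exp2_coarse N : (2 : R) ^ (- - (2 * N)%:Z) = 4 ^+ N.
Proof. by rewrite opprK -exprnP exprM; congr (_ ^+ _); rewrite expr2 -natrM. Qed.

End scales.

Lemma sum_le_esum (R : realType) (T : choiceType) (A : set T) (f : T -> \bar R) (s : seq T) :
  uniq s -> (forall x, x \in s -> A x) -> (\sum_(x <- s) f x <= \esum_(x in A) f x)%E.
Proof.
move=> us sA; apply: esum_ge; exists [set` s].
  by split=> // x /= /sA.
by rewrite fsbig_seq.
Qed.

(** * Divergence of the Carleson sum of the zigzag curve *)

Section zigzag_curve.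
Context {R : realType} {n : nat}.
Variables (k0 : 'I_n) (e : nat -> R) (gamma : R -> heisenberg R n).
Local Notation h m := ((4^-1 : R) ^+ m).
Local Notation i1 := (lshift n k0).
Hypothesis e0 : forall m, 0 < e m.
Hypothesis e1 : forall m, e m <= 1.
Hypothesis e_small : forall eps, 0 < eps -> exists M, forall m, (M <= m)%N -> e m <= eps.
Hypothesis e_sum : forall m, \sum_(j < m) e j ^+ 2 <= 8^-1.
Hypothesis lip : forall x y, 0 <= x -> 0 <= y ->
  mdist (gamma x) (gamma y) <= 3 * `|x - y|.
Hypothesis coord : forall x, 0 <= x -> horiz (gamma x) 0 i1 = x.
Hypothesis gammaE : forall m k, gamma (h m * k%:R) = vertex k0 e m k.

Local Notation Gamma := (gamma @` [set` `[0, +oo[ ]).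

Let GammaP x : 0 <= x -> Gamma (gamma x).
Proof. by move=> x0; exists x => //=; rewrite in_itv/= x0. Qed.

Variables (c : R) (D : int -> set (set (heisenberg R n))).
Hypothesis c01 : 0 < c < 1.
Hypothesis dyaD : dyadic_system c Gamma D.

Let index j : dyadic_index Gamma j.
Proof. by left; exact: (graph_unbounded coord). Qed.

(** The inner ball of the cube contains an arc that starts at its centre; running to the right keeps
    the parameter nonnegative. *)
Let cube_segment j Q : D j Q -> exists2 s, 0 <= s &
  forall y, s <= y < s + c * 2 ^ (- j) / 3 -> Q (gamma y).
Proof.
move=> DQ; have [x [s]] := dyadic_ball dyaD (index j) DQ.
rewrite /= in_itv/= andbT => s0 <- xQ; exists s => // y /andP[sy yr].
have y0 := le_trans s0 sy; apply: xQ; split; last exact: GammaP.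
rewrite ballEmdist/=; apply: le_lt_trans (lip s0 y0) _.
by rewrite distrC ger0_norm; lra.
Qed.

Let rho_gt0 (j : int) : 0 < c * 2 ^ (- j).
Proof. by rewrite mulr_gt0 ?exprz_gt0//; have /andP[] := c01. Qed.

Let cube_diam_ge j Q : D j Q -> ((c * 2 ^ (- j) / 4)%:E <= diam Q)%E.
Proof.
move=> /cube_segment[s s0 sQ]; have r0 := rho_gt0 j; set r := c * _ in r0 sQ *.
have s1 : 0 <= s + r / 4 by lra.
have A : Q (gamma s) by apply: sQ; lra.
have B : Q (gamma (s + r / 4)) by apply: sQ; lra.
apply: le_trans (mdist_le_diam A B); rewrite lee_fin.
apply: le_trans (mdist_graph_ge coord s0 s1).
by rewrite opprD addNKr normrN ger0_norm//; lra.
Qed.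

Let cube_measure_ge j Q : D j Q -> ((c * 2 ^ (- j) / 6)%:E <= hausdorff1 Q)%E.
Proof.
move=> /cube_segment[s s0 sQ]; have r0 := rho_gt0 j.
rewrite (_ : c * 2 ^ (- j) / 6 = c * 2 ^ (- j) / 3 / 2); last by field.
by apply: (graph_length_ge coord s0) sQ; rewrite divr_gt0.
Qed.

(** [A] quaternary generations absorb the constant [c]: cubes of generation [gen m] have diameter at
    most [c^-1 * h m * h A < h m], so each contains at most one vertex of generation [m]. A zigzag
    [b] generations further down is small enough for the dilated cube. *)
Let A := xget 0%N [set A | h A < c].

Let A_c : h A < c.
Proof.
rewrite /A; case: xgetP => // /(_ _)/= none.
have r01 : 0 <= (4^-1 : R) < 1 by lra.
have /andP[c0 _] := c01.
have [N /(_ N (leqnn N))] := expr_small 1 r01 c0; rewrite mul1r => hN.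
by have := none N.
Qed.

Let b := (2 * A + 2)%N.
Let gen m : int := (2 * (m + A))%:Z.

Let genE m : (2 : R) ^ (- gen m) = h m * h A.
Proof. by rewrite exp2_fine exprD. Qed.

(** 48 is the 16 of [beta_zigzag_ge] times the 3 of [diam_dilate2]. *)
Let kappa := c * h (A + 2) / 48.

Let h_gt0 m : 0 < h m. Proof. by rewrite exprn_gt0. Qed.

Let kappa_gt0 : 0 < kappa.
Proof. by have /andP[c0 _] := c01; rewrite divr_gt0// mulr_gt0. Qed.

(** The vertex in [Q] is also a vertex of every later generation. The next three vertices of
    generation [b + m + 1] stay within [diam Q] of it, hence in the dilated cube. *)
Let cube_beta_ge m k Q : D (gen m) Q -> Q (vertex k0 e m k) ->
  `|slope e (b + m) (4 ^ b * k)| <= 1 ->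
  ((kappa * Num.sqrt (e (b + m)))%:E <=
   beta_infty (horizontal_lines R n) (dilate 2 Gamma Q))%E.
Proof.
move=> DQ Qk sl; have /andP[c0 c1] := c01.
have dQ := dyadic_diam dyaD (index _) DQ.
have vG m' k' : Gamma (vertex k0 e m' k').
  by rewrite -gammaE; apply: GammaP; rewrite mulr_ge0// ltW.
have QG : Q `<=` Gamma by have [] := dyadic_borel dyaD (index _) DQ.
have hb : h (b + m) = h m * h A * h (A + 2).
  by rewrite -!exprD; congr (_ ^+ _); rewrite /b; lia.
have near i : (i < 4)%N -> dilate 2 Gamma Q (vertex k0 e (b + m).+1 (4 * (4 ^ b * k) + i)).
  move=> i4; apply: (dilate2_near Qk (vG _ _)).
  apply: le_trans (cube_diam_ge DQ); rewrite lee_fin genE.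
  rewrite -(vertex_refineX k0 e m b.+1) mdistC expnS -mulnA.
  apply: le_trans.
    by apply: mdist_vertex (leq_addr i _) => m'; rewrite e1 ltW.
  rewrite natrD addrC addKr -mulrA mulrCA.
  have i3 : i%:R <= 3 :> R by rewrite ler_nat.
  have hS : h (b + m).+1 = h m * h A * h (A + 2) / 4 by rewrite exprS hb mulrC.
  have hA2 : h (A + 2) <= c / 16.
    by rewrite exprD; have := A_c; rewrite (_ : h 2 = 16^-1); [lra|rewrite expr2; field].
  have P0 : 0 < h m * h A by rewrite mulr_gt0.
  rewrite addSn hS; apply: (@le_trans _ _ (h m * h A * (c / 16) / 4 * (3 * 3))).
    have : h m * h A * h (A + 2) <= h m * h A * (c / 16) by rewrite ler_pM2l.
    have : 0 < h m * h A * h (A + 2) by rewrite mulr_gt0.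
    by nra.
  have : 0 < h m * h A * c by rewrite mulr_gt0.
  by lra.
have := beta_zigzag_ge (e0 _) (e1 _) sl (diam_dilate2 Gamma dQ) _ near.
move=> H; apply: le_trans (H _); last first.
  apply: lt_le_trans (le_trans (cube_diam_ge DQ) (le_diam _)).
    by rewrite lte_fin divr_gt0.
  move=> x Qx; apply: (dilate2_near Qx (QG _ Qx)); rewrite mdistxxP; exact: diam_ge0.
rewrite lee_fin le_eqVlt; apply/orP; left; apply/eqP.
rewrite genE hb /kappa; field.
by rewrite !gt_eqF// exprn_gt0.
Qed.

Let cube_gen_sep m k k' Q : D (gen m) Q -> Q (vertex k0 e m k) -> Q (vertex k0 e m k') -> k = k'.
Proof.
move=> DQ Qk Qk'; apply/eqP; apply/negPn/negP => kk'.
have /andP[c0 c1] := c01.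
have := le_trans (mdist_le_diam Qk Qk') (dyadic_diam dyaD (index _) DQ).
rewrite lee_fin genE leNgt => /negP; apply.
apply: lt_le_trans (coord_lipschitz i1 _ _).
rewrite !vertex_coord -mulrBr normrM gtr0_norm//.
apply: (@lt_le_trans _ _ (h m)).
  by rewrite mulrCA -ltr_pdivlMl// mulVf ?gt_eqF// mulrC ltr_pdivrMr// mul1r A_c.
rewrite ler_peMr ?(ltW (h_gt0 m))//.
move: kk'; rewrite neq_ltn => /orP[] lt.
  by rewrite distrC -natrB ?(ltnW lt)// ger0_norm// ler1n subn_gt0.
by rewrite -natrB ?(ltnW lt)// ger0_norm// ler1n subn_gt0.
Qed.

(** The lower and upper diameter bounds for cubes of one generation differ by the factor [c^2 / 4],
    which [2 * A + 1] quaternary generations outweigh. *)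
Let cube_gen_inj m m' Q : (m + 2 * A + 1 <= m')%N -> D (gen m) Q -> ~ D (gen m') Q.
Proof.
move=> mm' DQ DQ'; have /andP[c0 c1] := c01.
have := le_trans (cube_diam_ge DQ) (dyadic_diam dyaD (index _) DQ').
rewrite lee_fin !genE -(subnK mm') leNgt => /negP; apply.
set d := (m' - _)%N; have -> : h (d + (m + 2 * A + 1)) = h d * h m * h A * h A / 4.
  rewrite (_ : (d + (m + 2 * A + 1) = d + m + A + A + 1)%N); last by lia.
  by rewrite !exprD expr1.
have hd : h d <= 1 by rewrite exprn_ile1// invf_le1 ?ler1n.
have P0 : 0 < h m * h A by rewrite mulr_gt0.
have hAA : h A * h A < c * c by rewrite ltr_pM// A_c.
rewrite mulrC ltr_pdivrMr//.
apply: (@le_lt_trans _ _ (h m * h A * (h A * h A) / 4)).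
  have : h d * (h m * h A * (h A * h A)) <= h m * h A * (h A * h A).
    by rewrite ler_piMl ?mulr_ge0// ltW.
  by lra.
have : h m * h A * (h A * h A) < h m * h A * (c * c) by rewrite ltr_pM2l.
by lra.
Qed.

(** Among the [4 ^ ms i] edges of generation [ms i] over [[K, K + 1]], at least half have small
    slope. Their initial vertices lie in distinct cubes of measure at least of order [h (ms i)], on
    which the [p]-th power of beta is at least of order [1 / ms i]. So each chosen generation
    contributes at least a multiple of [1 / (i + 1)]. *)
Lemma zigzag_carleson_diverges (p M kappa1 : R) : 0 < p -> 0 < kappa1 ->
  (forall m, kappa1 / m.+1%:R <= Num.sqrt (e m) `^ p) ->
  ~ (forall Q0, cubes Gamma D Q0 ->
    (\esum_(Q in [set Q | cubes Gamma D Q /\ Q `<=` Q0])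
       (beta_infty (horizontal_lines R n) (dilate 2 Gamma Q) `^ p * hausdorff1 Q)
     <= M%:E * hausdorff1 Q0)%E).
Proof.
move=> p0 kappa10 e_pow packing; have /andP[c0 c1] := c01.
have r1 : 0 <= (4^-1 : R) < 1 by lra.
have cover j x : 0 <= x -> exists2 Q, D j Q & Q (gamma x).
  by move=> x0; have := GammaP x0; rewrite {1}(dyadic_cover dyaD (index j)) => -[Q]; exists Q.
(* 12 gives [Q0] an arc of parameter length above 4, which contains the unit interval starting at
   the first integer [K] beyond [s]. *)
have [B /(_ B (leqnn _)) hB] := expr_small 12 r1 c0.
pose j0 : int := - (2 * B)%:Z.
have [Q0 DQ0 _] := cover j0 0 (lexx 0).
have [s s0 sQ0] := cube_segment DQ0; rewrite exp2_coarse in sQ0.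
have cB : 12 < c * 4 ^+ B.
  by rewrite -ltr_pdivrMr ?exprn_gt0// -exprVn.
pose K := (Num.truncn s).+1.
have Q0K m k : (k < 4 ^ m)%N -> Q0 (vertex k0 e m (4 ^ m * K + k)).
  move=> km; rewrite -gammaE; apply: sQ0.
  rewrite natrD natrM natrX mulrDr mulrA -exprMn mulVf// expr1n mul1r.
  have /andP[tr1 tr2] := truncn_itv s0.
  have KS : K%:R = (Num.truncn s)%:R + 1 :> R by rewrite natr1.
  have : h m * k%:R < 1.
    by rewrite exprVn mulrC ltr_pdivrMr ?exprn_gt0// mul1r -natrX ltr_nat.
  have : 0 <= h m * k%:R by rewrite mulr_ge0// ltW.
  by rewrite KS in tr2 *; move=> ? ?; apply/andP; split; lra.
have /choice[Qf QfP] : forall mk : nat * nat, exists Q,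
    D (gen mk.1) Q /\ Q (vertex k0 e mk.1 mk.2).
  move=> [m k]; rewrite /= -gammaE.
  by have [|Q] := cover (gen m) (h m * k%:R); [rewrite mulr_ge0// ltW|exists Q].
have b0 : (0 < b)%N by rewrite /b addn2.
(* From generation [M0] on, [b] refinements change a slope by at most 1/2, as [slope_descend]
   requires. *)
have [M0 hM0] := @e_small (2 * b%:R)^-1 (ltac:(by rewrite invr_gt0 mulr_gt0// ltr0n)).
pose ms i := (M0 + (2 * A + 1) * i)%N.
pose small i k := `|slope e (ms i) (4 ^ ms i * K + k)| <= 2^-1.
pose ks i := [seq k <- iota 0 (4 ^ ms i) | small i k].
pose F i k := Qf (ms i, 4 ^ ms i * K + k)%N.
(* [W] absorbs all shifts, [b + ms i + 1 <= W * (i + 1)], for the comparison with the harmonic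
   series. *)
pose W : R := (b + M0 + 1 + (2 * A + 1))%:R.
have W0 : 0 < W by rewrite ltr0n addn1.
pose val i := kappa `^ p * (kappa1 / (b + ms i).+1%:R) * (c * (h (ms i) * h A) / 6).
have val_ge i k : k \in ks i -> ((val i)%:E <=
    beta_infty (horizontal_lines R n) (dilate 2 Gamma (F i k)) `^ p * hausdorff1 (F i k))%E.
  rewrite mem_filter mem_iota add0n => /andP[sk /andP[_ kms]].
  have [DF FP] := QfP (ms i, 4 ^ ms i * K + k)%N.
  have := cube_beta_ge DF FP; rewrite /= => /(_ _)beta_ge.
  have {}beta_ge : ((kappa * Num.sqrt (e (b + ms i)))%:E <=
      beta_infty (horizontal_lines R n) (dilate 2 Gamma (F i k)))%E.
    apply: beta_ge.
    have e01 m : 0 <= e m <= 1 by rewrite e1 ltW.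
    apply: (@slope_descend R e e01 (ms i) b _ (2 * b%:R)^-1) => //.
    - by move=> m' mm'; apply: hM0; rewrite (leq_trans _ mm')// leq_addr.
    - by rewrite invfM mulrCA divff ?mulr1// pnatr_eq0 -lt0n.
  have k_ge0 : 0 <= kappa * Num.sqrt (e (b + ms i)) by rewrite mulr_ge0 ?sqrtr_ge0// ltW.
  rewrite /val EFinM; apply: lee_pmul.
  - by rewrite lee_fin mulr_ge0 ?powR_ge0// divr_ge0// ltW.
  - by rewrite lee_fin divr_ge0// mulr_ge0 ?ltW// mulr_gt0.
  - apply: (@le_trans _ _ ((kappa * Num.sqrt (e (b + ms i)))%:E `^ p)%E).
      by rewrite poweR_EFin lee_fin powRM ?sqrtr_ge0 ?(ltW kappa_gt0)// ler_wpM2l ?powR_ge0.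
    have beta0 : (0%:E <= beta_infty (horizontal_lines R n) (dilate 2 Gamma (F i k)))%E.
      by apply: le_trans beta_ge; rewrite lee_fin.
    by apply: (gt0_ler_poweR (ltW p0) _ _ beta_ge); rewrite in_itv/= leey andbT ?lee_fin.
  - by have := cube_measure_ge DF; rewrite genE.
have sum_val i : kappa `^ p * kappa1 * c * h A / 12 / W * i.+1%:R^-1 <=
    \sum_(k <- ks i) val i.
  have -> : \sum_(k <- ks i) val i =
      val i * \sum_(k < 4 ^ ms i) (small i k)%:R.
    rewrite big_filter mulr_sumr.
    rewrite -(big_mkord xpredT (fun k => val i * (small i k)%:R)) /index_iota subn0 big_mkcond.
    by apply: eq_bigr => k _; case: ifP => _; rewrite ?mulr1 ?mulr0.
  have v0 : 0 <= val i.
    rewrite mulr_ge0//; last by rewrite divr_ge0// !mulr_ge0// ltW.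
    by rewrite mulr_ge0 ?powR_ge0// divr_ge0// ltW.
  have := slope_small_count K (e_sum (ms i)) => /(ler_wpM2l v0); apply: le_trans.
  have iW : (b + ms i).+1%:R <= W * i.+1%:R.
    rewrite /W -natrM ler_nat /ms; move: (b) (M0) (2 * A + 1)%N => x y z.
    rewrite mulnS mulnDl; move: ((x + y + 1) * i)%N (z * i)%N => u v; clear; lia.
  have hh : h (ms i) * 4 ^+ ms i = 1 by rewrite -exprMn mulVf// expr1n.
  have -> : val i * (4 ^+ ms i / 2) = kappa `^ p * kappa1 * c * h A / 12 *
      ((b + ms i).+1%:R)^-1 * (h (ms i) * 4 ^+ ms i).
    rewrite /val; have : (b + ms i).+1%:R != 0 :> R by rewrite pnatr_eq0.
    by move: (h (ms i)) (4 ^+ ms i) ((b + ms i).+1%:R) => x y z z0; field.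
  rewrite hh mulr1.
  rewrite -mulrA -invfM ler_wpM2l//.
    by rewrite !mulr_ge0// ?powR_ge0// ltW.
  by rewrite lef_pV2 ?posrE// mulr_gt0.
have uniq_F N : uniq [seq F i k | i <- iota 0 N, k <- ks i].
  apply: allpairs_uniq_dep; first exact: iota_uniq.
    by move=> i _; rewrite filter_uniq// iota_uniq.
  have lt_absurd i i' k k' : (i < i')%N -> F i k = F i' k' -> False.
    move=> ii' FF; have [DF _] := QfP (ms i, 4 ^ ms i * K + k)%N.
    have [DF' _] := QfP (ms i', 4 ^ ms i' * K + k')%N.
    apply: (cube_gen_inj _ DF); last by rewrite -/(F i k) FF; exact: DF'.
    have := leq_mul (leqnn (2 * A + 1)) ii'; rewrite /= /ms mulnS.
    by move: ((2 * A + 1) * i)%N ((2 * A + 1) * i')%N (A) => x y a; clear; lia.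
  move=> [i k] [i' k'] _ _ /= FF.
  case: (ltngtP i i') => [ii'|ii'|ii'].
  - by case: (lt_absurd _ _ _ _ ii' FF).
  - by case: (lt_absurd _ _ _ _ ii' (esym FF)).
  - subst i'; congr Tagged; apply/eqP; rewrite -(eqn_add2l (4 ^ ms i * K)%N); apply/eqP.
    have [DF FP] := QfP (ms i, 4 ^ ms i * K + k)%N.
    have [_ FP'] := QfP (ms i, 4 ^ ms i * K + k')%N.
    by apply: (cube_gen_sep DF FP); rewrite -/(F i k) FF.
have Q0s : Q0 (gamma s).
  by apply: sQ0; rewrite lexx ltrDl divr_gt0// (lt_trans _ cB).
(* Finiteness makes the right-hand side of the Carleson estimate a real number, which the harmonic
   series exceeds. *)
have Q0fin : hausdorff1 Q0 \is a fin_num.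
  pose r := c^-1 * 4 ^+ B + 1.
  have r0 : 0 < r by rewrite addr_gt0// mulr_gt0 ?invr_gt0 ?exprn_gt0.
  rewrite ge0_fin_numE ?hausdorff1_ge0//.
  apply: (@le_lt_trans _ _ (6 * r)%:E); last by rewrite ltry.
  apply: le_trans (graph_ball_upper lip coord (GammaP s0) r0).
  apply: le_hausdorff1 => z Qz; split; last by have [_] := dyadic_borel dyaD (index j0) DQ0; apply.
  rewrite ballEmdist/=; have := le_trans (mdist_le_diam Q0s Qz) (dyadic_diam dyaD (index j0) DQ0).
  by rewrite exp2_coarse lee_fin /r; lra.
have := packing Q0 (ex_intro2 _ _ j0 (index j0) DQ0).
rewrite -(fineK Q0fin) -EFinM; set X := M * _.
pose kappa2 := kappa `^ p * kappa1 * c * h A / 12 / W.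
have kappa20 : 0 < kappa2.
  by rewrite !divr_gt0// !mulr_gt0// powR_gt0.
have [N hN] := harmonic_unbounded ((X + 1) / kappa2).
rewrite leNgt => /negP; apply.
apply: (@lt_le_trans _ _ (\sum_(Q <- [seq F i k | i <- iota 0 N, k <- ks i])
   (beta_infty (horizontal_lines R n) (dilate 2 Gamma Q) `^ p * hausdorff1 Q))%E); last first.
  apply: sum_le_esum => // _ /allpairsPdep[i [k [_ ik ->]]].
  have [DF FP] := QfP (ms i, 4 ^ ms i * K + k)%N.
  split; first by exists (gen (ms i)).
  have km : (k < 4 ^ ms i)%N by move: ik; rewrite mem_filter mem_iota add0n => /andP[_ /andP[]].
  have ij0 : j0 <= gen (ms i) by rewrite /j0 /gen; move: (2 * B)%N (2 * _)%N => x y; clear; lia.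
  have [//|disj] := dyadic_nested dyaD (index _) (index _) ij0 DQ0 DF.
  have : (Q0 `&` F i k) (vertex k0 e (ms i) (4 ^ ms i * K + k)) by split=> //; exact: Q0K.
  by rewrite disj.
rewrite big_allpairs_dep.
apply: (@lt_le_trans _ _ (\sum_(i <- iota 0 N) \sum_(k <- ks i) (val i)%:E)%E); last first.
  apply: lee_sum => i _; rewrite big_seq [leRHS]big_seq; apply: lee_sum => k ik.
  exact: val_ge.
have -> : (\sum_(i <- iota 0 N) \sum_(k <- ks i) (val i)%:E)%E =
    (\sum_(i <- iota 0 N) \sum_(k <- ks i) val i)%:E.
  by rewrite -sumEFin; apply: eq_bigr => i _; rewrite sumEFin.
rewrite lte_fin; apply: (@lt_le_trans _ _ (\sum_(i <- iota 0 N) kappa2 * i.+1%:R^-1)); last first.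
  by apply: ler_sum => i _; exact: sum_val.
rewrite -mulr_sumr -ltr_pdivrMl//.
have -> : \sum_(i <- iota 0 N) (i.+1%:R^-1 : R) = \sum_(i < N) i.+1%:R^-1.
  by rewrite -(big_mkord xpredT (fun i => i.+1%:R^-1 : R)) /index_iota subn0.
apply: lt_le_trans hN; rewrite mulrC ltr_pM2r ?invr_gt0//; lra.
Qed.

End zigzag_curve.

(** [sqrt (e m) ^ p] is exactly [eta^p / (m + 1)]. The squares of the [e m] form a convergent series
    of exponent [4 / p > 1], and [eta] brings its sum below the 1/8 that [slope_small_count]
    demands. *)
Lemma zigzag_exponents (R : realType) (p : R) : 0 < p < 4 ->
  exists (e : nat -> R) (kappa : R), [/\ forall m, 0 < e m <= 1,
    forall eps, 0 < eps -> exists M, forall m, (M <= m)%N -> e m <= eps,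
    forall m, \sum_(j < m) e j ^+ 2 <= 8^-1, 0 < kappa &
    forall m, kappa / m.+1%:R <= Num.sqrt (e m) `^ p].
Proof.
move=> /andP[p0 p4]; have p41 : 1 < 4 / p by rewrite ltr_pdivlMr ?mul1r.
have [S hS] := riemann_bounded p41.
have S0 : 0 <= S by have := hS 0%N; rewrite big_ord0.
pose eta := (8 * (1 + S))^-1.
have eta0 : 0 < eta by rewrite invr_gt0 mulr_gt0// ltr_wpDr.
have etaS : eta * (8 * (1 + S)) = 1 by rewrite mulVf// gt_eqF// mulr_gt0// ltr_wpDr.
have eta1 : eta <= 1 by nra.
have eta4 : eta ^+ 4 <= eta by rewrite exprS ler_piMr ?(ltW eta0)// exprn_ile1// ltW.
pose rho m := eta * m.+1%:R `^ (- p^-1).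
have rho0 m : 0 < rho m by rewrite mulr_gt0// powR_gt0.
have rho4 m : rho m ^+ 4 = eta ^+ 4 * m.+1%:R `^ (- (4 / p)).
  rewrite exprMn; congr (_ * _); rewrite -powR_mulrn ?powR_ge0// -powRrM.
  by congr (_ `^ _); rewrite mulNr mulrC.
have pow_le1 m : m.+1%:R `^ (- (4 / p)) <= m.+1%:R^-1 :> R.
  rewrite powRN lef_pV2 ?posrE ?powR_gt0//.
  by rewrite le1r_powR ?ler1n// ltW.
have e4 m : (rho m ^+ 2) ^+ 2 <= m.+1%:R^-1.
  rewrite -exprM rho4; apply: le_trans (pow_le1 m).
  by rewrite ler_piMl ?powR_ge0// (le_trans eta4).
exists (fun m => rho m ^+ 2), (eta `^ p); split.
- move=> m; rewrite exprn_gt0//= -(@ler_pXn2r _ 2)// ?nnegrE ?sqr_ge0//.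
  by rewrite expr1n (le_trans (e4 m))// invf_le1 ?ler1n.
- move=> eps eps0; exists (Num.truncn (eps ^- 2)) => m Mm.
  rewrite -(@ler_pXn2r _ 2)// ?nnegrE ?sqr_ge0 ?(ltW eps0)//.
  apply: le_trans (e4 m) _; rewrite -[leRHS]invrK lef_pV2 ?posrE ?invr_gt0 ?exprn_gt0//.
  by apply: (le_trans (ltW (truncnS_gt _))); rewrite ler_nat.
- move=> m; under eq_bigr do rewrite -exprM rho4.
  rewrite -mulr_sumr; apply: (@le_trans _ _ (eta * S)); last by nra.
  by rewrite ler_pM// ?exprn_ge0 ?(ltW eta0)// sumr_ge0// => j _; exact: powR_ge0.
- by rewrite powR_gt0.
- move=> m; rewrite sqrtr_sqr gtr0_norm// powRM ?powR_ge0 ?(ltW eta0)//.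
  by rewrite -powRrM mulNr mulVf ?gt_eqF// powR_inv1.
Qed.

Lemma exists_curve_not_GLem (R : realType) (n : nat) (c0 : R -> R) (p : R) : (0 < n)%N ->
  dyadic_constant (heisenberg R n) c0 -> 0 < p < 4 ->
  exists Gamma : set (heisenberg R n), regular1_curve Gamma /\
    forall C : R, Reg1 C Gamma ->
      ~ GLem (c0 C) (beta_infty (horizontal_lines R n)) p Gamma.
Proof.
move=> n0 dc /[dup] p04 /andP[p0 _]; pose k0 := Ordinal n0.
have [e [kappa [e01 e_small e_sum kappa0 e_pow]]] := zigzag_exponents p04.
have e01w m : 0 <= e m <= 1 by have /andP[a ->] := e01 m; rewrite ltW.
have [gamma [lip coord gammaE]] := lifted_curve_exists k0 e01w.
exists (gamma @` [set` `[0, +oo[ ]); split.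
  by split; [exact: graph_curve lip|exists 6; exact: graph_regular lip coord].
move=> C regC [M packing]; have [c01 /(_ _ regC)[D dyaD]] := dc C (let: And4 h _ _ _ := regC in h).
apply: (@zigzag_carleson_diverges R n k0 e gamma _ _ e_small e_sum lip coord gammaE
  (c0 C) D c01 dyaD p M kappa p0 kappa0 e_pow) => [m|m|Q0 DQ0].
- by have /andP[] := e01 m.
- by have /andP[] := e01 m.
- exact: packing dyaD _ DQ0.
Qed.

(** * A set not contained in a regular curve *)

Section distance_to_set.
Context {R : realType} {T : metricType R}.
Implicit Types (A : set T) (x y z : T).

Lemma edist_inf_fin A z : A !=set0 -> edist_inf A z \is a fin_num.
Proof.
move=> [a Aa]; rewrite ge0_fin_numE ?edist_inf_ge0//.
by rewrite (le_lt_trans (edist_inf_le z Aa))// ltry.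
Qed.

Lemma edist_inf_lipschitz A x y : A !=set0 ->
  `|fine (edist_inf A x) - fine (edist_inf A y)| <= mdist x y.
Proof.
move=> A0.
have half u v : fine (edist_inf A u) - fine (edist_inf A v) <= mdist u v.
  have := @edist_inf_triangle _ _ A u v.
  rewrite edistE -[X in (X <= _)%E -> _](fineK (edist_inf_fin u A0)).
  by rewrite -[X in (_ <= _ + X)%E -> _](fineK (edist_inf_fin v A0)) -EFinD lee_fin; lra.
rewrite ler_norml; have := half x y; have := half y x.
by rewrite (mdistC y) => ? ?; apply/andP; split; lra.
Qed.

Lemma lipschitz_continuous (f : T -> R) (L : R) : 0 < L ->
  (forall x y, `|f x - f y| <= L * mdist x y) -> continuous f.
Proof.
move=> L0 lip x; apply/cvgrPdist_lt => e e0.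
have e3 : 0 < e / L by rewrite divr_gt0.
near=> y; apply: le_lt_trans (lip _ _) _.
have : ball x (e / L) y by near: y; exact: nbhsx_ballx.
by rewrite ballEmdist/= ltr_pdivlMr// mulrC.
Unshelve. all: by end_near.
Qed.

Lemma curve_connected A : curve A -> connected A.
Proof.
move=> [I [f [fc ->]]]; apply: connected_continuous_connected fc.
by apply/connected_intervalP; exact: interval_is_interval.
Qed.

End distance_to_set.

(** * Trees whose gaps have infinite total length *)

Section tree_not_in_curve.
Context {R : realType} {T : metricType R}.
Variables (C : nat -> nat -> set T) (G : nat -> R).
Hypothesis C_nonempty : forall m N, (N < 2 ^ m)%N -> C m N !=set0.
Hypothesis C_nested : forall m N, C m.+1 N `<=` C m N./2.
Hypothesis C_separated : forall m N p q,
  C m.+1 (2 * N)%N p -> C m.+1 (2 * N + 1)%N q -> G m <= mdist p q.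
Hypothesis G_gt0 : forall m, 0 < G m.
Hypothesis G_half : forall m, 2 * G m.+1 <= G m.
Hypothesis G_sum : forall B, exists M, B <= \sum_(m < M) 2 ^+ m * G m.

(** A quarter of the gap keeps the neighbourhoods of two siblings disjoint. *)
Let w m := G m / 4.

Let nbh (r : R) (A : set T) : set T := \bigcup_(p in A) ball p r.

Let nbh_open r A : open (nbh r A).
Proof.
rewrite openE => x [p Ap]; rewrite ballEmdist/= => px.
apply/nbhs_ballP; exists (r - mdist p x); first by rewrite /= subr_gt0.
move=> y; rewrite ballEmdist/= => xy; exists p => //.
by rewrite ballEmdist/= (le_lt_trans (mdist_triangleP x _ _))//; lra.
Qed.

(* These annuli are pairwise disjoint, and each one has to be crossed by a
   connected set containing the tree. *)
Let annulus m N := nbh (w m) (C m.+1 N) `\` nbh (w m.+1) (C m.+1 N).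

Let w_gt0 m : 0 < w m. Proof. by rewrite divr_gt0. Qed.

Let w_half m : 2 * w m.+1 <= w m.
Proof. by have := G_half m; rewrite /w; lra. Qed.

Let le_nbh r r' A B : r <= r' -> A `<=` B -> nbh r A `<=` nbh r' B.
Proof.
move=> rr' AB x [p Ap px]; exists p; first exact: AB.
exact: le_ball px.
Qed.

Let annulus_caratheodory m N :
  (hausdorff1 : set T -> \bar R).-caratheodory (annulus m N).
Proof.
have op r A : (hausdorff1 : set T -> \bar R).-caratheodory (nbh r A).
  rewrite -[nbh r A]setCK; apply: caratheodory_measurable_setC.
  by apply: closed_caratheodory; apply: open_closedC; exact: nbh_open.
by apply: caratheodory_measurable_setD; exact: op.
Qed.

(** Siblings are [G m > 2 * w m] apart. Otherwise the parents' neighbourhoods, of larger radius, are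
    disjoint by induction and contain those of the children. *)
Let nbh_disjoint m N N' : (N < 2 ^ m.+1)%N -> (N' < 2 ^ m.+1)%N -> N != N' ->
  nbh (w m) (C m.+1 N) `&` nbh (w m) (C m.+1 N') = set0.
Proof.
have sib k q : nbh (w k) (C k.+1 (2 * q)) `&` nbh (w k) (C k.+1 (2 * q + 1)) = set0.
  rewrite -subset0 => x [[p Cp xp] [p' Cp' xp']].
  move: xp xp'; rewrite !ballEmdist/= => xp xp'.
  have := C_separated Cp Cp'; have := mdist_triangleP x p p'.
  by have := G_gt0 k; rewrite (mdistC x p') /w in xp xp' *; lra.
have sib2 k M M' : M./2 = M'./2 -> ~~ odd M -> odd M' ->
    nbh (w k) (C k.+1 M) `&` nbh (w k) (C k.+1 M') = set0.
  move=> h oM oM'; rewrite -(odd_double_half M) -(odd_double_half M') (negbTE oM) oM' h.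
  by rewrite add0n addnC -muln2 mulnC sib.
elim: m N N' => [|m ih] N N' hN hN' NN'; have [h|h] := eqVneq N./2 N'./2.
- move: (h); have [oN|oN] := boolP (odd N); have [oN'|oN'] := boolP (odd N') => h'.
  + by move: NN'; rewrite -(odd_double_half N) -(odd_double_half N') oN oN' h eqxx.
  + by rewrite setIC; apply: sib2.
  + exact: sib2.
  + by move: NN'; rewrite -(odd_double_half N) -(odd_double_half N') (negbTE oN) (negbTE oN') h eqxx.
- by move: h; case: N hN {NN'} => [|[|//]]; case: N' hN' => [|[|//]].
- move: (h); have [oN|oN] := boolP (odd N); have [oN'|oN'] := boolP (odd N') => h'.
  + by move: NN'; rewrite -(odd_double_half N) -(odd_double_half N') oN oN' h eqxx.
  + by rewrite setIC; apply: sib2.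
  + exact: sib2.
  + by move: NN'; rewrite -(odd_double_half N) -(odd_double_half N') (negbTE oN) (negbTE oN') h eqxx.
- have half k : (k < 2 ^ m.+2)%N -> (k./2 < 2 ^ m.+1)%N.
    by rewrite (expnS 2 m.+1) => hk; lia.
  rewrite -subset0 -(ih _ _ (half _ hN) (half _ hN') h).
  have wm : w m.+1 <= w m by have := w_half m; have := w_gt0 m.+1; lra.
  by apply: setISS; exact: le_nbh wm (@C_nested _ _).
Qed.

Let ancestor d m N : (N < 2 ^ (d + m))%N -> exists2 N', (N' < 2 ^ m)%N & C (d + m) N `<=` C m N'.
Proof.
elim: d N => [|d ih] N; first by rewrite add0n => hN; exists N.
rewrite addSn => hN; have [|N' hN' sub] := ih N./2.
  by move: hN; rewrite expnS; lia.
by exists N' => //; apply: subset_trans sub; exact: C_nested.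
Qed.

Let w_mono d m : w (d + m) <= w m.
Proof.
elim: d => [|d ih] //; rewrite addSn (le_trans _ ih)//.
by have := w_half (d + m); have := w_gt0 (d + m).+1; lra.
Qed.

(** The annulus of the later generation lies within [w m.+1] of its ancestor of generation [m.+1].
    If this ancestor is the cell [N], that is the hole of the other annulus; if not, [nbh_disjoint]
    applies. *)
Let annulus_disjoint m N m' N' : (N < 2 ^ m.+1)%N -> (N' < 2 ^ m'.+1)%N ->
  (m, N) != (m', N') -> annulus m N `&` annulus m' N' = set0.
Proof.
wlog mm' : m N m' N' / (m <= m')%N.
  move=> H hN hN' NN'; have [mm'|/ltnW mm'] := leqP m m'; first exact: H.
  by rewrite setIC; apply: H => //; rewrite eq_sym.
move=> hN hN' NN'; rewrite -subset0 => x [[xN nxN] [xN' _]].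
move: mm'; rewrite leq_eqVlt => /orP[/eqP mm'|mm'].
  subst m'; have {}NN' : N != N' by apply: contra NN' => /eqP ->.
  by have := nbh_disjoint hN hN' NN'; rewrite -subset0; apply; split.
have E : (m'.+1 = (m' - m) + m.+1)%N by rewrite addnS subnK// ltnW.
rewrite E in hN'; have [N'' hN'' sub] := ancestor hN'.
have xN'' : nbh (w m.+1) (C m.+1 N'') x.
  rewrite E in xN'; apply: le_nbh xN' => //.
  by rewrite -(subnK mm'); exact: w_mono.
have [NE|NE] := eqVneq N N''; first by apply: nxN; rewrite NE.
have := nbh_disjoint hN hN'' NE; rewrite -subset0; apply; split=> //.
by apply: le_nbh xN'' => //; have := w_half m; have := w_gt0 m.+1; lra.
Qed.

Let C_root m N : (N < 2 ^ m)%N -> C m N `<=` C 0%N 0%N.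
Proof.
rewrite -[m in (N < 2 ^ m)%N]addn0 => /ancestor[N' + sub]; rewrite expn0 ltnS leqn0 => /eqP N0.
by move: sub; rewrite addn0 N0.
Qed.

(** The distance to the cell is 0 on it and at least [w m] on its sibling, so on a connected set it
    takes all values from [w m.+1] to [w m], which are attained in the annulus. It is 1-Lipschitz,
    and [w m - w m.+1 >= w m / 2]. *)
Let annulus_length (Gamma : set T) m N : connected Gamma -> C 0%N 0%N `<=` Gamma ->
  (N < 2 ^ m.+1)%N -> ((w m / 4)%:E <= hausdorff1 (Gamma `&` annulus m N))%E.
Proof.
move=> cG CG hN; have C0 := C_nonempty hN.
pose f z := fine (edist_inf (C m.+1 N) z).
have flip x y : `|f x - f y| <= 1 * mdist x y by rewrite mul1r edist_inf_lipschitz.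
have fE z : edist_inf (C m.+1 N) z = (f z)%:E by rewrite fineK// edist_inf_fin.
have nbhE r z : nbh r (C m.+1 N) z <-> f z < r.
  split=> [[p Cp]|]; last first.
    by rewrite -lte_fin -fE => /edist_inf_lt[p Cp zp]; exists p => //; rewrite ballEmdist/= mdistC.
  by rewrite ballEmdist/= mdistC => pz; rewrite -lte_fin -fE (le_lt_trans (edist_inf_le _ Cp)).
have /connected_intervalP fG : connected (f @` Gamma).
  apply: connected_continuous_connected cG _; apply: continuous_subspaceT.
  exact: lipschitz_continuous ltr01 flip.
have [p Cp] := C0; have Gp : Gamma p := CG _ (C_root hN Cp).
have fp : f p = 0 by rewrite /f edist_inf0.
pose sib := if odd N then N.-1 else N.+1.
have hsib : (sib < 2 ^ m.+1)%N.
  move: hN; rewrite /sib expnS; case: ifP => oN; first by lia.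
  by move=> hN; have := odd_double_half N; rewrite oN; lia.
have [q Cq] := C_nonempty hsib; have Gq : Gamma q := CG _ (C_root hsib Cq).
have fq : w m <= f q.
  rewrite leNgt; apply/negP => /nbhE[p' Cp']; rewrite ballEmdist/= => pq.
  have : G m <= mdist p' q.
    move: Cp' Cq; rewrite /sib; have := odd_double_half N; rewrite -muln2 mulnC.
    move: (N./2) => k; case: ifP => _ /= <-; rewrite ?add1n ?add0n /= => Cp' Cq.
      by rewrite mdistC; apply: (C_separated Cq); rewrite addn1.
    by apply: (C_separated Cp'); rewrite addn1.
  by have := G_gt0 m; rewrite /w in pq *; lra.
have := @lipschitz_length_le R T f 1 (w m.+1) (w m) (Gamma `&` annulus m N) ltr01.
move=> /(_ (fun x y _ _ => flip x y)) H; apply: le_trans (H _).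
  by rewrite lee_fin; have := w_half m; lra.
move=> t; rewrite /= in_itv/= => /andP[t1 t2].
have [] := fG _ _ (ex_intro2 _ _ p Gp fp) (ex_intro2 _ _ q Gq erefl) t.
  by rewrite (le_trans (ltW t2) fq) andbT (le_trans _ (ltW t1))// ltW.
move=> z Gz fz; exists z => //; split=> //; split; first by apply/nbhE; rewrite fz.
by move=> /nbhE; rewrite fz ltNge (ltW t1).
Qed.

(** Each of the [2^(m+1)] annuli of generation [m] contains a length of at least [G m / 16] of the
    curve. All annuli meet the curve inside one ball of radius [r], where regularity allows only
    [K * r]. *)
Lemma tree_not_in_regular_curve z0 (r : R) : C 0%N 0%N z0 ->
  (forall z, C 0%N 0%N z -> mdist z0 z + G 0%N < r) ->
  (r%:E < 2%:E * diam (C 0%N 0%N))%E ->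
  ~ exists2 Gamma, regular1_curve Gamma & C 0%N 0%N `<=` Gamma.
Proof.
move=> Cz0 Cr rd [Gamma [cuG [K [K1 _ _ regG]]] CG].
have r0 : 0 < r.
  by have := Cr _ Cz0; rewrite mdistxxP add0r; apply: lt_trans.
have rdG : (r%:E < 2%:E * diam Gamma)%E.
  by apply: lt_le_trans rd _; apply: lee_wpmul2l (le_diam CG); rewrite lee_fin.
have /andP[_ up] := regG z0 r (CG _ Cz0) r0 rdG.
(* The total length is an eighth of the series, so 16 yields [2 (K r + 1)]. *)
have [M hM] := G_sum (16 * (K * r + 1)).
pose s := [seq (m, N) | m <- iota 0 M, N <- iota 0 (2 ^ m.+1)].
have sP i : i \in s -> (i.2 < 2 ^ i.1.+1)%N.
  by move=> /allpairsPdep[m [N [_ + ->]]]; rewrite mem_iota add0n.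
have us : uniq s.
  apply: allpairs_uniq_dep => [|m _|[m N] [m' N'] _ _ /= [-> ->]//]; exact: iota_uniq.
have := @hausdorff1_caratheodory_sum R T _ s (fun i => annulus i.1 i.2) (ball z0 r `&` Gamma) us.
move=> /(_ (fun i _ => annulus_caratheodory i.1 i.2)) H.
have disj i j : i \in s -> j \in s -> i != j -> annulus i.1 i.2 `&` annulus j.1 j.2 = set0.
  move=> /sP hi /sP hj; case: i j hi hj => [m N] [m' N'] /= hN hN'.
  exact: annulus_disjoint.
have {H disj} tot := le_trans (H disj) up.
have sub i : i \in s -> Gamma `&` annulus i.1 i.2 `<=` ball z0 r `&` Gamma `&` annulus i.1 i.2.
  move=> /sP hi z [Gz Az]; have [[p Cp pz] _] := Az; split=> //; split=> //.
  move: pz; rewrite !ballEmdist/= => pz; apply: le_lt_trans (mdist_triangleP p _ _) _.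
  apply: lt_trans (Cr _ (C_root hi Cp)); rewrite ltrD2l (lt_le_trans pz)//.
  apply: (@le_trans _ _ (w 0%N)); first by rewrite -[i.1]addn0 w_mono.
  by have := G_gt0 0; rewrite /w; lra.
move: tot; rewrite leNgt => /negP; apply.
apply: (@lt_le_trans _ _ (\sum_(i <- s) (w i.1 / 4)%:E)%E); last first.
  rewrite big_seq [leRHS]big_seq; apply: lee_sum => i si.
  apply: le_trans (annulus_length (curve_connected cuG) CG (sP i si)) _.
  by apply: le_hausdorff1; exact: sub.
rewrite sumEFin lte_fin big_allpairs_dep/=.
have -> : \sum_(m <- iota 0 M) \sum_(N <- iota 0 (2 ^ m.+1)) w m / 4 =
    8^-1 * \sum_(m < M) 2 ^+ m * G m.
  rewrite mulr_sumr -(big_mkord xpredT (fun m => 8^-1 * (2 ^+ m * G m))) /index_iota subn0.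
  apply: eq_bigr => m _; rewrite big_const_seq count_predT size_iota iter_addr_0.
  by rewrite -[LHS]mulr_natl natrX exprS /w; field.
have : 0 < K * r by rewrite mulr_gt0// (lt_le_trans ltr01).
by lra.
Qed.

End tree_not_in_curve.

(** * Nested triangles in the plane *)

Section folded_triangles.
Context {R : realType}.
Variables c s : nat -> R.
Hypothesis c2s2 : forall m, c m ^+ 2 + s m ^+ 2 = 1.
Hypothesis s_gt0 : forall m, 0 < s m.
Hypothesis s_le : forall m, s m <= 4^-1.
Hypothesis c_ge0 : forall m, 0 <= c m.
Hypothesis s_decr : forall m, s m.+1 <= s m.
Implicit Types (z w : R * R) (m N : nat).

Definition pdist z w : R := Num.sqrt ((z.1 - w.1) ^+ 2 + (z.2 - w.2) ^+ 2).

(* Coordinates adapted to the [N]-th triangle of generation [m], whose base is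
   [[0, 1]] * {0}; passing to a child halves the base and reflects. *)
Fixpoint chart m N z : R * R :=
  if m is m'.+1 then
    let w := chart m' N./2 z in
    if odd N then (1 - 2 * (c m' * (1 - w.1) + s m' * w.2),
                   2 * (s m' * (1 - w.1) - c m' * w.2))
    else (2 * (c m' * w.1 + s m' * w.2), 2 * (s m' * w.1 - c m' * w.2))
  else z.

Fixpoint unchart m N w : R * R :=
  if m is m'.+1 then
    unchart m' N./2
      (if odd N then (1 - 2^-1 * (c m' * (1 - w.1) + s m' * w.2),
                      2^-1 * (s m' * (1 - w.1) - c m' * w.2))
       else (2^-1 * (c m' * w.1 + s m' * w.2), 2^-1 * (s m' * w.1 - c m' * w.2)))
  else w.

Lemma chartK m N : cancel (unchart m N) (chart m N).
Proof.
elim: m N => [//|m ih] N [x y] /=; rewrite ih; have cs := c2s2 m.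
case: (odd N) => /=; congr pair.
- rewrite [LHS](_ : _ = 1 - (1 - x) * (c m ^+ 2 + s m ^+ 2)); last by field.
  by rewrite cs; ring.
- rewrite [LHS](_ : _ = y * (c m ^+ 2 + s m ^+ 2)); last by field.
  by rewrite cs mulr1.
- rewrite [LHS](_ : _ = x * (c m ^+ 2 + s m ^+ 2)); last by field.
  by rewrite cs mulr1.
- rewrite [LHS](_ : _ = y * (c m ^+ 2 + s m ^+ 2)); last by field.
  by rewrite cs mulr1.
Qed.

Lemma pdist_chart m N z w : pdist (chart m N z) (chart m N w) = 2 ^+ m * pdist z w.
Proof.
elim: m N z w => [|m ih] N z w; first by rewrite mul1r.
rewrite exprS -mulrA -(ih N./2) /=; set u := chart _ _ z; set v := chart _ _ w.
have -> : 2 * pdist u v = Num.sqrt (2 ^+ 2 * ((u.1 - v.1) ^+ 2 + (u.2 - v.2) ^+ 2)).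
  by rewrite sqrtrM ?sqr_ge0// sqrtr_sqr ger0_norm.
rewrite /pdist; congr Num.sqrt; rewrite -[RHS]mulr1 -(c2s2 m).
by case: (odd N) => /=; ring.
Qed.

(** The isosceles triangle whose legs, of slopes [s / c] and [- s / c], carry the bases of the two
    children. The reflection in [chart] makes the children point into the parent. *)
Definition triangle m w : Prop :=
  [/\ 0 <= w.2, c m * w.2 <= s m * w.1 & c m * w.2 <= s m * (1 - w.1)].

Definition cell m N z : Prop := triangle m (chart m N z).

Lemma c_ge m : 2^-1 + s m <= c m.
Proof. by have := c2s2 m; have := s_le m; have := c_ge0 m; have := s_gt0 m; nra. Qed.

Lemma c_le1 m : c m <= 1.
Proof. by have := c2s2 m; have := c_ge0 m; have := s_gt0 m; nra. Qed.

Lemma c_incr m : c m <= c m.+1.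
Proof.
by have := c2s2 m; have := c2s2 m.+1; have := s_decr m; have := c_ge0 m;
  have := c_ge0 m.+1; have := s_gt0 m.+1; nra.
Qed.

Lemma gap_ge m : s m ^+ 2 / 2 <= 1 - c m.
Proof. by have := c2s2 m; have := c_le1 m; have := c_ge0 m; nra. Qed.

Lemma triangle_le1 m w : triangle m w -> [/\ 0 <= w.1 <= 1, w.2 <= w.1 & w.2 <= 1 - w.1].
Proof.
case=> w20 h1 h2; have := c_ge m; have s0 := s_gt0 m => cs.
have a : w.2 <= w.1 by nra.
have b : w.2 <= 1 - w.1 by nra.
by split=> //; apply/andP; split; lra.
Qed.

(** All bounds are centred at the inner end [(c / 2, s / 2)] of the child's base: the distance to it
    along the base is at most four times the horizontal one in the parent, and the height differs
    from [s / 2] by at most [s] times it. They yield the Lipschitz bound for the code and the bound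
    for beta. *)
Let left_child m X Y X' Y' : triangle m.+1 (X', Y') ->
  X' = 2 * (c m * X + s m * Y) -> Y' = 2 * (s m * X - c m * Y) ->
  [/\ triangle m (X, Y), 1 - X' <= 4 * (c m / 2 - X), 0 <= 1 - X' &
      `|Y - s m / 2| <= s m * (1 - X')].
Proof.
move=> /[dup] T [/= Y0 h1 h2] EX EY; have [/andP[X0 X1] YX YX1] := triangle_le1 T.
rewrite /= in X0 X1 YX YX1.
have cs := c2s2 m; have c1 := c_ge m; have c1' := c_ge m.+1; have ci := c_incr m.
have sd := s_decr m; have s0 := s_gt0 m; have s0' := s_gt0 m.+1.
have hX : 2 * X = c m * X' + s m * Y'.
  by transitivity (2 * X * (c m ^+ 2 + s m ^+ 2)); [rewrite cs mulr1|rewrite EX EY; ring].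
have hY : 2 * Y = s m * X' - c m * Y'.
  by transitivity (2 * Y * (c m ^+ 2 + s m ^+ 2)); [rewrite cs mulr1|rewrite EX EY; ring].
(* As [s] decreases and [c] increases, the child is flatter than a triangle with the parameters of
   generation [m]. *)
have k1 : c m * Y' <= s m * X' by nra.
have k2 : c m * Y' <= s m * (1 - X') by nra.
have cm := c_le1 m.
have hcY : (c m ^+ 2 + s m ^+ 2) * Y' = Y' by rewrite cs mul1r.
have h3 : s m * Y' <= s m * (1 - X') by rewrite ler_pM2l.
have h4 : 2^-1 * (1 - X') <= (c m - s m) * (1 - X') by rewrite ler_wpM2r//; lra.
split.
- split=> /=; first by lra.
  + by have : c m * (2 * Y) <= s m * (2 * X); [rewrite hX hY|]; lra.
  + have h5 : s m * (c m * X') <= s m by rewrite ler_piMr ?mulr_ile1// ltW.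
    have h6 : 0 <= (c m ^+ 2 - s m ^+ 2) * Y'.
      by rewrite mulr_ge0// subr_sqr mulr_ge0//; lra.
    by have : c m * (2 * Y) <= s m * (2 - 2 * X); [rewrite hX hY|]; lra.
- by lra.
- by lra.
- by rewrite ler_norml; apply/andP; split; nra.
Qed.

Lemma chart_childL m N z : chart m.+1 (2 * N) z =
  (2 * (c m * (chart m N z).1 + s m * (chart m N z).2),
   2 * (s m * (chart m N z).1 - c m * (chart m N z).2)).
Proof. by rewrite /= mul2n odd_double doubleK. Qed.

Lemma chart_childR m N z : chart m.+1 (2 * N + 1) z =
  (1 - 2 * (c m * (1 - (chart m N z).1) + s m * (chart m N z).2),
   2 * (s m * (1 - (chart m N z).1) - c m * (chart m N z).2)).
Proof.
by rewrite /= (_ : (2 * N + 1)./2 = N)%N; [rewrite oddD oddM|lia].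
Qed.

Lemma cell_childL m N z : cell m.+1 (2 * N) z ->
  let X := (chart m N z).1 in let X' := (chart m.+1 (2 * N) z).1 in
  [/\ cell m N z, 1 - X' <= 4 * (c m / 2 - X), 0 <= 1 - X',
      (chart m.+1 (2 * N) z).2 <= 1 - X' &
      `|(chart m N z).2 - s m / 2| <= s m * (1 - X')].
Proof.
move=> h; have [_ _ hY] := triangle_le1 h; move: h hY.
rewrite /cell chart_childL => h hY.
have [t h1 h2 h3] := left_child h erefl erefl.
by split=> //; move: t; rewrite -surjective_pairing.
Qed.

Lemma cell_childR m N z : cell m.+1 (2 * N + 1) z ->
  let X := (chart m N z).1 in let X' := (chart m.+1 (2 * N + 1) z).1 in
  [/\ cell m N z, X' <= 4 * (X - (1 - c m / 2)), 0 <= X',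
      (chart m.+1 (2 * N + 1) z).2 <= X' &
      `|(chart m N z).2 - s m / 2| <= s m * X'].
Proof.
move=> h; have [/andP[hX _] hY _] := triangle_le1 h; move: h hX hY.
rewrite /cell chart_childR => -[/= Y0 h1 h2] hX hY.
set X := (chart m N z).1 in Y0 h1 h2 hX hY *.
set Y := (chart m N z).2 in Y0 h1 h2 hX hY *.
(* Replacing [x] by [1 - x] turns the right child into a left one. *)
have T : triangle m.+1 (2 * (c m * (1 - X) + s m * Y), 2 * (s m * (1 - X) - c m * Y)).
  by split=> //=; rewrite -?[X in _ <= _ * X]opprB; move: h1 h2; lra.
have [[/= t1 t2 t3] k1 k2 k3] := left_child T erefl erefl.
split=> //; last by lra.
by split=> //; rewrite -/X -/Y; lra.
Qed.

End folded_triangles.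

(** * The limit set and its binary code *)

Section triangle_limit_set.
Context {R : realType}.
Variables c s : nat -> R.
Hypothesis c2s2 : forall m, c m ^+ 2 + s m ^+ 2 = 1.
Hypothesis s_gt0 : forall m, 0 < s m.
Hypothesis s_le : forall m, s m <= 4^-1.
Hypothesis c_ge0 : forall m, 0 <= c m.
Hypothesis s_decr : forall m, s m.+1 <= s m.
Implicit Types (z w p q : R * R) (m N : nat).

Local Notation chart := (chart c s).
Local Notation unchart := (unchart c s).
Local Notation cell := (cell c s).

Let childL m N z := @cell_childL R c s c2s2 s_gt0 s_le c_ge0 s_decr m N z.
Let childR m N z := @cell_childR R c s c2s2 s_gt0 s_le c_ge0 s_decr m N z.

Let c_lt1 m : c m < 1.
Proof.
rewrite -subr_gt0; apply: lt_le_trans (gap_ge c2s2 s_gt0 c_ge0 m).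
by rewrite divr_gt0// exprn_gt0.
Qed.

Lemma pdist_ge0 z w : 0 <= pdist z w. Proof. exact: sqrtr_ge0. Qed.

Lemma pdistC z w : pdist z w = pdist w z.
Proof. by rewrite /pdist -sqrrN opprB -[(z.2 - _) ^+ 2]sqrrN opprB. Qed.

Lemma pdist_ge1 z w : `|z.1 - w.1| <= pdist z w.
Proof. by rewrite -sqrtr_sqr ler_wsqrtr// lerDl sqr_ge0. Qed.

Lemma pdist_ge2 z w : `|z.2 - w.2| <= pdist z w.
Proof. by rewrite -sqrtr_sqr ler_wsqrtr// lerDr sqr_ge0. Qed.

Lemma pdist_le z w : pdist z w <= `|z.1 - w.1| + `|z.2 - w.2|.
Proof.
rewrite -[leRHS]ger0_norm ?addr_ge0// -sqrtr_sqr ler_wsqrtr// [leRHS]sqrrD.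
rewrite !real_normK ?num_real// lerD2r lerDl mulrn_wge0// mulr_ge0//.
Qed.

Variant child_spec m N : Prop :=
  | ChildL K of N = (2 * K)%N & N./2 = K
  | ChildR K of N = (2 * K + 1)%N & N./2 = K.

Lemma childP m N : child_spec m N.
Proof.
have := odd_double_half N; rewrite -mul2n; case: (odd N) => /= h.
  by apply: (@ChildR _ _ N./2); rewrite // -{1}h addnC.
by apply: (@ChildL _ _ N./2); rewrite // -{1}h add0n.
Qed.

Lemma cell_nested m N z : cell m.+1 N z -> cell m N./2 z.
Proof. by case: (childP m N) => K -> ->; [case/childL|case/childR]. Qed.

Let siblings m N p q : cell m.+1 (2 * N) p -> cell m.+1 (2 * N + 1) q ->
  (chart m N p).1 <= c m / 2 /\ 1 - c m / 2 <= (chart m N q).1.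
Proof. by move=> /childL[_ h1 h2 _ _] /childR[_ h3 h4 _ _]; split; lra. Qed.

Lemma cell_uniq m N N' z : (N < 2 ^ m)%N -> (N' < 2 ^ m)%N ->
  cell m N z -> cell m N' z -> N = N'.
Proof.
elim: m N N' => [|m ih] N N'; first by rewrite expn0 !ltnS !leqn0 => /eqP -> /eqP ->.
move=> hN hN' cN cN'; have hh : N./2 = N'./2.
  by apply: ih; [rewrite expnS in hN; lia|rewrite expnS in hN'; lia|exact: cell_nested|exact: cell_nested].
have := c_lt1 m; case: (childP m N) hh cN => K -> -> hh cN;
  case: (childP m N') hh cN' => K' -> -> hh cN'; subst K' => // hc.
- by exfalso; have [? ?] := siblings cN cN'; lra.
- by exfalso; have [? ?] := siblings cN' cN; lra.
Qed.

Lemma cell_siblings_dist m N p q : cell m.+1 (2 * N) p -> cell m.+1 (2 * N + 1) q ->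
  1 - c m <= 2 ^+ m * pdist p q.
Proof.
move=> cp cq; have [h1 h2] := siblings cp cq; rewrite -(pdist_chart c2s2 _ N).
by apply: le_trans (pdist_ge1 _ _); rewrite distrC (le_trans _ (ler_norm _))//; lra.
Qed.

Lemma cell_diam m N p q : cell m N p -> cell m N q -> 2 ^+ m * pdist p q <= 2.
Proof.
move=> hp hq; have [p0 _ _] := hp; have [q0 _ _] := hq.
have [/andP[a1 a2] a3 a4] := triangle_le1 c2s2 s_gt0 s_le c_ge0 hp.
have [/andP[b1 b2] b3 b4] := triangle_le1 c2s2 s_gt0 s_le c_ge0 hq.
rewrite -(pdist_chart c2s2 _ N); apply: le_trans (pdist_le _ _) _.
have h1 : `|(chart m N p).1 - (chart m N q).1| <= 1 by rewrite ler_norml; apply/andP; split; lra.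
have h2 : `|(chart m N p).2 - (chart m N q).2| <= 1 by rewrite ler_norml; apply/andP; split; lra.
by lra.
Qed.

Definition limit_set p := forall m, exists2 N, (N < 2 ^ m)%N & cell m N p.

(* [x] is the binary address of [p], read off from the cells containing [p]. *)
Definition coded p (x : R) := forall m, exists N,
  [/\ (N < 2 ^ m)%N, cell m N p & N%:R <= 2 ^+ m * x <= N.+1%:R].

Lemma coded_limit_set p x : coded p x -> limit_set p.
Proof. by move=> h m; have [N [? ? _]] := h m; exists N. Qed.

(** In each generation only one cell contains [p], so the corresponding dyadic intervals are nested;
    [x] is the supremum of their left ends. *)
Lemma coded_exists p : limit_set p -> exists x, coded p x.
Proof.
move=> Lp; have /choice[N NP] : forall m, exists N, (N < 2 ^ m)%N /\ cell m N p.
  by move=> m; have [N ? ?] := Lp m; exists N.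
have N2 m : (N m.+1)./2 = N m.
  have [h1 c1] := NP m; have [h2 c2] := NP m.+1.
  apply: cell_uniq (cell_nested c2) c1 => //.
  by move: h2; rewrite expnS; lia.
have step d m : (2 ^ d * N m <= N (d + m) < 2 ^ d * (N m).+1)%N.
  elim: d => [|d /andP[ih1 ih2]]; first by rewrite expn0 !mul1n add0n leqnn ltnSn.
  have := N2 (d + m)%N; rewrite addSn expnS -!mulnA => E.
  have := odd_double_half (N (d + m).+1); rewrite E -mul2n; move: ih1 ih2.
  move: (2 ^ d * N m)%N (2 ^ d * (N m).+1)%N (N (d + m)%N) (N (d + m).+1) => a b x y.
  by case: (odd y) => /=; lia.
have p2 m : 0 < 2 ^+ m :> R by rewrite exprn_gt0.
have le i j : (N i)%:R / 2 ^+ i <= (N j).+1%:R / 2 ^+ j :> R.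
  rewrite ler_pdivrMr// mulrAC ler_pdivlMr// -!natrX -!natrM ler_nat.
  have [ij|/ltnW ij] := leqP i j.
    have /andP[h _] := step (j - i)%N i; rewrite subnK// in h.
    by rewrite -[X in (2 ^ X)%N](subnK ij) expnD mulnA (mulnC (N i)) leq_mul// leqW.
  have /andP[_ h] := step (i - j)%N j; rewrite subnK// in h.
  by rewrite -[X in (_ <= _ * 2 ^ X)%N](subnK ij) expnD [leqRHS]mulnA (mulnC _.+1) leq_mul// ltnW.
pose S := range (fun m => (N m)%:R / 2 ^+ m : R).
have Sub : has_ubound S by exists ((N 0%N).+1%:R / 2 ^+ 0) => _ [m _ <-].
have S0 : S !=set0 by exists ((N 0%N)%:R / 2 ^+ 0), 0%N.
exists (sup S) => m; exists (N m); have [h1 h2] := NP m; split=> //.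
rewrite mulrC; apply/andP; split.
  by rewrite -ler_pdivrMr//; apply: ub_le_sup => //; exists m.
by rewrite -ler_pdivlMr//; apply: ge_sup => // _ [i _ <-].
Qed.

Let half_pow d : 0 <= (2^-1 : R) ^+ d. Proof. by rewrite exprn_ge0. Qed.

Lemma child_index m N N1 p : (N < 2 ^ m)%N -> cell m N p -> (N1 < 2 ^ m.+1)%N -> cell m.+1 N1 p ->
  N1 = (2 * N)%N \/ N1 = (2 * N + 1)%N.
Proof.
move=> hN cN hN1 cN1; have E : N1./2 = N.
  apply: cell_uniq (cell_nested cN1) cN => //.
  by move: hN1; rewrite expnS; lia.
by case: (childP m N1) => K EN EK; [left|right]; rewrite {1}EN -E EK.
Qed.

(** Induction on the depth [d] of the address. In the right child the corner [(1, 0)] is the same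
    point and both distances double; a point of the left child is at least 1/2 away from it, so the
    trivial bound 1 suffices. *)
Lemma code_end_dist d m N p x : (N < 2 ^ m)%N -> cell m N p -> coded p x ->
  N.+1%:R - 2 ^+ m * x <= 2 * pdist (chart m N p) (1, 0) + 2^-1 ^+ d.
Proof.
elim: d m N => [|d ih] m N hN cN px.
  have [N1 [hN1 cN1 /andP[h _]]] := px m; rewrite -(cell_uniq hN hN1 cN cN1) in h.
  have := pdist_ge0 (chart m N p) (1, 0); rewrite expr0 mulrSr.
  by lra.
have [N1 [hN1 cN1 h]] := px m.+1.
have [E|E] := child_index hN cN hN1 cN1; subst N1.
  have [_ h1 h2 _ _] := childL cN1; have := c_lt1 m.
  have := pdist_ge1 (chart m N p) (1, 0); rewrite distrC /= => h3.
  have := ler_norm (1 - (chart m N p).1).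
  have [N2 [hN2 cN2 /andP[h4 _]]] := px m; rewrite -(cell_uniq hN hN2 cN cN2) in h4.
  have nS : N.+1%:R = N%:R + 1 :> R by rewrite natr1.
  by have := half_pow d.+1; rewrite nS; lra.
have := ih _ _ hN1 cN1 px.
have -> : pdist (chart m.+1 (2 * N + 1) p) (1, 0) = 2 * pdist (chart m N p) (1, 0).
  have E0 : chart m.+1 (2 * N + 1) (unchart m N (1, 0)) = (1, 0).
    by rewrite chart_childR (chartK c2s2)/=; congr pair; ring.
  by rewrite -{1}E0 (pdist_chart c2s2) exprS -mulrA -(pdist_chart c2s2 m N) (chartK c2s2).
rewrite !exprS; have -> : (2 * N + 1).+1%:R = 2 * N.+1%:R :> R by rewrite -natrM; congr _%:R; lia.
by lra.
Qed.

Lemma code_start_dist d m N p x : (N < 2 ^ m)%N -> cell m N p -> coded p x ->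
  2 ^+ m * x - N%:R <= 2 * pdist (chart m N p) (0, 0) + 2^-1 ^+ d.
Proof.
elim: d m N => [|d ih] m N hN cN px.
  have [N1 [hN1 cN1 /andP[_ h]]] := px m; rewrite -(cell_uniq hN hN1 cN cN1) in h.
  have := pdist_ge0 (chart m N p) (0, 0); rewrite expr0; rewrite mulrSr in h.
  by lra.
have [N1 [hN1 cN1 h]] := px m.+1.
have [E|E] := child_index hN cN hN1 cN1; subst N1; last first.
  have [_ h1 h2 _ _] := childR cN1; have := c_lt1 m.
  have := pdist_ge1 (chart m N p) (0, 0); rewrite /= subr0 => h3.
  have := ler_norm (chart m N p).1.
  have [N2 [hN2 cN2 /andP[_ h4]]] := px m; rewrite -(cell_uniq hN hN2 cN cN2) in h4.
  have nS : N.+1%:R = N%:R + 1 :> R by rewrite natr1.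
  by rewrite nS in h4; have := half_pow d.+1; lra.
have := ih _ _ hN1 cN1 px.
have -> : pdist (chart m.+1 (2 * N) p) (0, 0) = 2 * pdist (chart m N p) (0, 0).
  have E0 : chart m.+1 (2 * N) (unchart m N (0, 0)) = (0, 0).
    by rewrite chart_childL (chartK c2s2)/=; congr pair; ring.
  by rewrite -{1}E0 (pdist_chart c2s2) exprS -mulrA -(pdist_chart c2s2 m N) (chartK c2s2).
by rewrite !exprS natrM; lra.
Qed.

Let half_lt1 : 0 <= (2^-1 : R) < 1. Proof. by lra. Qed.

(** The codes lie on both sides of the common end of two dyadic intervals. Their distances to it are
    bounded by those of [p] and [q] to the inner corners, hence by horizontal distances to the gap.
    The factors 2, 2 and 4, divided by the scale 2 of the children, give 8. *)
Let split_lipschitz k N p q x y : (N < 2 ^ k)%N ->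
  cell k.+1 (2 * N) p -> cell k.+1 (2 * N + 1) q -> coded p x -> coded q y ->
  `|x - y| <= 8 * pdist p q.
Proof.
move=> hN cp cq px qy.
have hL : (2 * N < 2 ^ k.+1)%N by rewrite expnS; lia.
have hR : (2 * N + 1 < 2 ^ k.+1)%N by rewrite expnS; lia.
have [_ p1 p2 p3 _] := childL cp; have [_ q1 q2 q3 _] := childR cq.
have [p4 _ _] := cp; have [q4 _ _] := cq.
have N1 : (2 * N).+1%:R = (2 * N + 1)%:R :> R by rewrite addn1.
have px1 : (2 * N + 1)%:R - 2 ^+ k.+1 * x <= 2 * pdist (chart k.+1 (2 * N) p) (1, 0).
  apply: (@le_of_small _ _ _ 1 2^-1 half_lt1) => d; rewrite mul1r -N1.
  exact: code_end_dist hL cp px.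
have qy1 : 2 ^+ k.+1 * y - (2 * N + 1)%:R <= 2 * pdist (chart k.+1 (2 * N + 1) q) (0, 0).
  apply: (@le_of_small _ _ _ 1 2^-1 half_lt1) => d; rewrite mul1r.
  exact: code_start_dist hR cq qy.
have px2 : 2 ^+ k.+1 * x <= (2 * N + 1)%:R.
  have [N2 [hN2 cN2 /andP[_]]] := px k.+1.
  by rewrite -(cell_uniq hL hN2 cp cN2) N1.
have qy2 : (2 * N + 1)%:R <= 2 ^+ k.+1 * y.
  have [N2 [hN2 cN2 /andP[h _]]] := qy k.+1.
  by move: h; rewrite -(cell_uniq hR hN2 cq cN2).
have dp := pdist_le (chart k.+1 (2 * N) p) (1, 0).
have dq := pdist_le (chart k.+1 (2 * N + 1) q) (0, 0).
rewrite /= !subr0 distrC !ger0_norm// in dp dq.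
have := pdist_ge1 (chart k N p) (chart k N q); rewrite (pdist_chart c2s2).
move=> /(le_trans (ler_norm _)); have := c_lt1 k.
have e0 : 0 < 2 ^+ k :> R by rewrite exprn_gt0.
rewrite exprS -!mulrA in px1 px2 qy1 qy2.
have xy : 2 ^+ k * x <= 2 ^+ k * y by lra.
rewrite ler_pM2l// in xy; rewrite distrC ger0_norm ?subr_ge0//.
move=> h1 h2; rewrite -(ler_pM2l e0) mulrBr.
have := pdist_ge1 (chart k N q) (chart k N p); rewrite (pdist_chart c2s2) (pdistC q p).
by move=> /(le_trans (ler_norm _)) h3; lra.
Qed.

(** At the first generation that separates [p] from [q] they lie in siblings. If there is none, the
    codes agree up to [2^-m] for all [m]. *)
Lemma coded_lipschitz p q x y : coded p x -> coded q y -> `|x - y| <= 8 * pdist p q.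
Proof.
move=> px qy; pose same m := `[< exists N, [/\ (N < 2 ^ m)%N, cell m N p & cell m N q] >].
have [all_same|/existsNP[m0 nm0]] := pselect (forall m, same m).
  apply: (@le_trans _ _ 0); last by rewrite mulr_ge0// pdist_ge0.
  apply: (@le_of_small _ _ _ 1 2^-1 half_lt1) => m; rewrite add0r mul1r exprVn.
  have [N [hN cp cq]] := asboolW (all_same m).
  have [N1 [hN1 cN1 /andP[h1 h2]]] := px m; have [N2 [hN2 cN2 /andP[h3 h4]]] := qy m.
  rewrite -(cell_uniq hN hN1 cp cN1) mulrSr in h1 h2; rewrite -(cell_uniq hN hN2 cq cN2) mulrSr in h3 h4.
  have e0 : 0 < 2 ^+ m :> R by rewrite exprn_gt0.
  rewrite -[leRHS]mul1r ler_pdivlMr// -[X in _ * X](gtr0_norm e0) -normrM mulrC mulrBr.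
  by rewrite ler_norml; apply/andP; split; lra.
have ex_diff : exists m, ~~ same m by exists m0; apply/negP.
case: (ex_minnP ex_diff) => -[|k] /negP nk kmin.
  by case: nk; apply/asboolP; exists 0%N; have [[|//] ? ?] := coded_limit_set px 0;
    have [[|//] ? ?] := coded_limit_set qy 0; split.
have /asboolP[N [hN cp cq]] : same k.
  by apply: contrapT => /negP /kmin; rewrite ltnn.
have [Np [hNp cNp _]] := px k.+1; have [Nq [hNq cNq _]] := qy k.+1.
have neq : Np <> Nq by move=> E; apply: nk; apply/asboolP; exists Np; split=> //; rewrite E.
have [Ep|Ep] := child_index hN cp hNp cNp; have [Eq|Eq] := child_index hN cq hNq cNq; subst Np Nq => //.
- exact: split_lipschitz hN cNp cNq px qy.
- by rewrite distrC pdistC; exact: split_lipschitz hN cNq cNp qy px.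
Qed.

Lemma cell_closed m N p : (forall eps, 0 < eps -> exists2 q, pdist q p < eps & cell m N q) ->
  cell m N p.
Proof.
move=> h; set u := chart m N p.
have near eps : 0 < eps -> exists v, [/\ triangle c s m v, `|v.1 - u.1| < eps & `|v.2 - u.2| < eps].
  move=> e0; have [|q qp cq] := h (eps / 2 ^+ m); first by rewrite divr_gt0// exprn_gt0.
  have qp' : pdist (chart m N q) u < eps.
    by rewrite (pdist_chart c2s2) mulrC -ltr_pdivlMr// exprn_gt0.
  exists (chart m N q); split=> //; apply: le_lt_trans qp'; [exact: pdist_ge1|exact: pdist_ge2].
have c1 := c_le1 c2s2 s_gt0 c_ge0 m; have c0 := c_ge0 m.
have s0 := s_gt0 m; have s1 := s_le m.
split; apply/ler_addgt0Pr => e e0; have [|v [[v1 v2 v3] h1 h2]] := near (e / 2);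
  rewrite ?divr_gt0//; move: h1 h2; rewrite !ltr_norml => /andP[h1 h1'] /andP[h2 h2'].
- by lra.
- by rewrite -/u; nra.
- by rewrite -/u; nra.
Qed.

(** The binary digits of [x] select nested cells. Their left base corners move by at most [2^-m],
    and the limit stays in each cell by closedness. *)
Lemma coded_point x : 0 <= x < 1 -> exists p, coded p x.
Proof.
move=> /andP[x0 x1]; pose N m := Num.truncn (2 ^+ m * x).
have p2 m : 0 < 2 ^+ m :> R by rewrite exprn_gt0.
have NP m : (N m)%:R <= 2 ^+ m * x < (N m).+1%:R by apply: truncn_itv; rewrite mulr_ge0// ltW.
have hN m : (N m < 2 ^ m)%N.
  have /andP[h _] := NP m; rewrite -(@ltr_nat R) natrX (le_lt_trans h)//.
  by rewrite -[ltRHS]mulr1 ltr_pM2l.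
have N2 m : (N m.+1)./2 = N m.
  apply/esym/truncn_def; have /andP[h1 h2] := NP m.+1; rewrite exprS -mulrA in h1 h2.
  have := odd_double_half (N m.+1); set K := (N m.+1)./2 => NE.
  have E : (N m.+1)%:R = (odd (N m.+1))%:R + 2 * K%:R :> R.
    by rewrite -{1}NE natrD -mul2n natrM.
  have b0 : 0 <= (odd (N m.+1))%:R :> R by [].
  have b1 : (odd (N m.+1))%:R <= 1 :> R by rewrite -[1]/(1%:R) ler_nat leq_b1.
  have nS k : k.+1%:R = k%:R + 1 :> R by rewrite natr1.
  by rewrite nS in h2 *; apply/andP; split; lra.
pose P m := unchart m (N m) (0, 0).
have Pstep m : pdist (P m.+1) (P m) <= 1 * 2^-1 ^+ m.
  rewrite mul1r exprVn -[leRHS]mul1r ler_pdivlMr// mulrC -(pdist_chart c2s2 m (N m)).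
  rewrite /P /= N2 !(chartK c2s2).
  have c1 := c_le1 c2s2 s_gt0 c_ge0 m; have cs := c_ge c2s2 s_gt0 s_le c_ge0 m.
  have s0 := s_gt0 m; apply: le_trans (pdist_le _ _) _.
  by case: (odd _) => /=; rewrite !subr0 ?mulr0 ?mulr1 ?addr0 ?subr0 ?mulr0 ?normr0 ?addr0//;
    rewrite !ger0_norm; lra.
have half : 0 <= (2^-1 : R) <= 2^-1 by lra.
have [l1 l1P] := @geometric_limit R (fun m => (P m).1) 1 2^-1 ler01 half
  (fun m => le_trans (pdist_ge1 _ _) (Pstep m)).
have [l2 l2P] := @geometric_limit R (fun m => (P m).2) 1 2^-1 ler01 half
  (fun m => le_trans (pdist_ge2 _ _) (Pstep m)).
exists (l1, l2) => m; exists (N m); split=> //; last first.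
  by have /andP[-> /ltW ->] := NP m.
apply: cell_closed => eps e0.
have [M hM] := expr_small 4 half_lt1 e0.
exists (P (M + m)%N).
  apply: le_lt_trans (hM (M + m)%N (leq_addr _ _)); apply: le_trans (pdist_le _ _) _.
  by have := l1P (M + m)%N; have := l2P (M + m)%N; rewrite /=; lra.
have : cell (M + m) (N (M + m)%N) (P (M + m)%N).
  by rewrite /cell /P (chartK c2s2); split=> /=; rewrite ?mulr0 ?subr0 ?mulr1// ltW.
move: (P _) => z; elim: (M) => [//|d ih]; rewrite addSn => /cell_nested.
by rewrite N2.
Qed.

End triangle_limit_set.

(** * The set in the Heisenberg group: closedness, gaps and length *)

Section isotropic_set.
Context {R : realType} {n : nat}.
Variables c s : nat -> R.
Hypothesis c2s2 : forall m, c m ^+ 2 + s m ^+ 2 = 1.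
Hypothesis s_gt0 : forall m, 0 < s m.
Hypothesis s_le : forall m, s m <= 4^-1.
Hypothesis c_ge0 : forall m, 0 <= c m.
Hypothesis s_decr : forall m, s m.+1 <= s m.
Variables k l : 'I_n.
Hypothesis kl : k != l.
Implicit Types (p q : R * R) (z w : heisenberg R n).

Local Notation chart := (chart c s).
Local Notation unchart := (unchart c s).
Local Notation cell := (cell c s).
Local Notation limit_set := (limit_set c s).
Local Notation coded := (coded c s).

Local Notation i1 := (lshift n k).
Local Notation i2 := (lshift n l).

Definition embed p : heisenberg R n := Heis (planar i1 i2 p.1 p.2) 0.

Let i12 : i1 != i2. Proof. by rewrite eq_lshift. Qed.

Lemma embed_dist p q : mdist (embed p) (embed q) = pdist p q.
Proof.
apply: (@pexpIrn _ 4); rewrite ?nnegrE ?mdist_ge0 ?pdist_ge0//.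
rewrite mdist_heisE koranyi_pow4 !heisE/= planarN planarD sqnorm_planar//.
rewrite omega_planar_isotropic oppr0 !addr0 expr0n/= mulr0 addr0.
rewrite (exprM _ 2 2) sqr_sqrtr ?addr_ge0 ?sqr_ge0//.
by congr (_ ^+ 2); ring.
Qed.

Definition cell_set m N : set (heisenberg R n) := embed @` [set p | limit_set p /\ cell m N p].

Definition embedded_set : set (heisenberg R n) := embed @` limit_set.

Lemma cell_set0 : cell_set 0 0 = embedded_set.
Proof.
apply/seteqP; split=> [z [p [Lp _] <-]|z [p Lp <-]]; first by exists p.
by exists p => //; split=> //; have [[|//] _ ?] := Lp 0%N.
Qed.

(** A limit point lies in the isotropic plane, since the other coordinates are limits of zeros. A
    generation has finitely many closed cells, so a point outside all of them has a positive
    distance to their union. *)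
Lemma embedded_closed : closed embedded_set.
Proof.
move=> z zE.
have near e : 0 < e -> exists2 p, limit_set p & mdist (embed p) z < e.
  move=> e0; have [y [[p Lp <-]]] := zE _ (nbhsx_ballx z _ e0).
  by rewrite ballEmdist/= mdistC; exists p.
have r1 : 0 <= (2^-1 : R) < 1 by lra.
have r0 m : 0 < (2^-1 : R) ^+ m by rewrite exprn_gt0.
pose a := horiz z 0 i1; pose b := horiz z 0 i2.
have hz : horiz z = planar i1 i2 a b.
  apply/rowP => i; have [->|ni1] := eqVneq i i1; first by rewrite planar1.
  have [->|ni2] := eqVneq i i2; first by rewrite planar2.
  apply/eqP; rewrite [X in _ == X]mxE (negbTE ni1) (negbTE ni2) !mulr0 addr0 -normr_le0.
  apply: (@le_of_small _ _ _ 1 2^-1 r1) => m; rewrite add0r mul1r.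
  have [p _ pz] := near _ (r0 m); apply: le_trans (ltW pz).
  rewrite mdistC; apply: le_trans (coord_lipschitz i _ _).
  by rewrite /= mxE (negbTE ni1) (negbTE ni2) !mulr0 addr0 subr0.
have vz : vert z = 0.
  apply/eqP; rewrite -normr_le0.
  apply: (@le_of_small _ _ _ 1 2^-1 r1) => m; rewrite add0r mul1r.
  have [p _ pz] := near _ (r0 m).
  have := vert_le_koranyi ((embed p)^-1 * z)%g; rewrite -mdist_heisE !heisE hz /= planarN.
  rewrite omega_planar_isotropic oppr0 add0r addr0.
  have : mdist (embed p) z ^+ 2 <= 2^-1 ^+ m * 1.
    rewrite expr2 ler_pM ?mdist_ge0 ?(ltW pz)// (le_trans (ltW pz))//.
    by rewrite exprn_ile1//; lra.
  by have := normr_ge0 (vert z); lra.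
have zE' : z = embed (a, b) by apply: heis_eq.
exists (a, b); last by rewrite zE'.
move=> m; apply: contrapT => none.
have [e e0 sep] : exists2 e, 0 < e & forall N, (N < 2 ^ m)%N ->
    forall q, pdist q (a, b) < e -> ~ cell m N q.
  suff : forall K, (K <= 2 ^ m)%N -> exists2 e, 0 < e & forall N, (N < K)%N ->
      forall q, pdist q (a, b) < e -> ~ cell m N q by apply.
  elim=> [|K ih] hK; first by exists 1.
  have [e e0 he] := ih (ltnW hK).
  have [e' e0' he'] : exists2 e', 0 < e' & forall q, pdist q (a, b) < e' -> ~ cell m K q.
    apply: contrapT => h; apply: none; exists K => //.
    apply: (cell_closed c2s2 s_gt0 s_le c_ge0) => e' e0'.
    apply: contrapT => h'; apply: h; exists e' => // q qe cq; apply: h'; by exists q.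
  exists (Num.min e e'); first by rewrite lt_min e0.
  move=> N; rewrite ltnS leq_eqVlt => /orP[/eqP ->|hN] q; rewrite lt_min => /andP[qe qe'].
    exact: he'.
  exact: he.
have [p Lp] := near _ e0; rewrite zE' embed_dist => pe.
by have [N hN cN] := Lp m; exact: sep hN p pe cN.
Qed.

Lemma limit_set_origin : limit_set (0, 0).
Proof.
move=> m; exists 0%N; rewrite ?expn_gt0//.
have E : chart m 0 (0, 0) = (0, 0).
  by elim: m => [//|m ih] /=; rewrite ih/=; congr pair; ring.
by rewrite /cell E; split=> /=; rewrite ?mulr0// subr0 mulr1 ltW.
Qed.

Lemma limit_set_end : limit_set (1, 0).
Proof.
move=> m; exists (2 ^ m).-1; first by rewrite prednK// expn_gt0.
have E : chart m (2 ^ m).-1 (1, 0) = (1, 0).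
  elim: m => [//|m ih].
  rewrite (_ : (2 ^ m.+1).-1 = 2 * (2 ^ m).-1 + 1)%N.
    by rewrite chart_childR ih/=; congr pair; ring.
  by rewrite expnS; have := expn_gt0 2 m; lia.
by rewrite /cell E; split=> /=; rewrite ?mulr0// ?mulr1 ?subrr ?mulr0// ltW.
Qed.

Lemma embedded_diam_ge : (1%:E <= diam embedded_set)%E.
Proof.
have h := mdist_le_diam (ex_intro2 _ _ _ limit_set_origin erefl : embedded_set (embed (0, 0)))
  (ex_intro2 _ _ _ limit_set_end erefl : embedded_set (embed (1, 0))).
apply: le_trans h; rewrite lee_fin embed_dist; apply: le_trans (pdist_ge1 _ _).
by rewrite sub0r normrN normr1.
Qed.

Lemma cell_set_diam m N : (diam (cell_set m N) <= (2 * 2^-1 ^+ m)%:E)%E.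
Proof.
apply: diam_le => [|_ _ [p [_ cp] <-] [q [_ cq] <-]].
  by rewrite lee_fin mulr_ge0// exprn_ge0.
rewrite lee_fin embed_dist exprVn ler_pdivlMr ?exprn_gt0// mulrC.
exact: (cell_diam c2s2 s_gt0 s_le c_ge0) cp cq.
Qed.

Lemma embedded_diam_le : (diam embedded_set <= 2%:E)%E.
Proof. by rewrite -cell_set0 (le_trans (cell_set_diam _ _))// expr0 mulr1. Qed.

Lemma cell_set_nonempty m N : (N < 2 ^ m)%N -> cell_set m N !=set0.
Proof.
move=> hN; have e0 : 0 < 2 ^+ m :> R by rewrite exprn_gt0.
have hN' : N%:R + 1 <= 2 ^+ m :> R by rewrite natr1 -natrX ler_nat.
have N0 : 0 <= N%:R :> R by [].
have [|p cp] := @coded_point R c s c2s2 s_gt0 s_le c_ge0 s_decr ((N%:R + 2^-1) / 2 ^+ m).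
  by rewrite divr_ge0 ?ltW//= ?ltr_pdivrMr// ?mul1r; lra.
have [N' [hN2 cN' /andP[h1 h2]]] := cp m.
exists (embed p), p => //; split; first exact: coded_limit_set cp.
have E : 2 ^+ m * ((N%:R + 2^-1) / 2 ^+ m) = N%:R + 2^-1 :> R.
  by rewrite mulrCA divff ?mulr1// gt_eqF.
rewrite E in h1 h2; suff -> : N = N' by [].
apply/eqP; rewrite eqn_leq; apply/andP; split; rewrite -ltnS -(@ltr_nat R).
  by rewrite (lt_le_trans _ h2)// ltrDl.
apply: le_lt_trans h1 _; have nS : N.+1%:R = N%:R + 1 :> R by rewrite natr1.
by rewrite nS; lra.
Qed.

Lemma embedded_not_in_curve : (forall B, exists M, B <= \sum_(m < M) s m ^+ 2) ->
  ~ exists2 Gamma, regular1_curve Gamma & embedded_set `<=` Gamma.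
Proof.
move=> s_sum; rewrite -cell_set0.
have e0 m : 0 < (2^-1 : R) ^+ m by rewrite exprn_gt0.
(* The gap is [(s m)^2 / 2] at scale [2^-m], so [2^m G m] is half of [(s m)^2]. Points of the set
   are within 1 of the origin, [G 0] is small and the diameter is at least 1, so the radius 3/2
   fits. *)
apply: (@tree_not_in_regular_curve R _ cell_set (fun m => s m ^+ 2 / 2 * 2^-1 ^+ m) _ _ _ _ _ _
  (embed (0, 0)) (3 / 2)).
- exact: cell_set_nonempty.
- move=> m N _ [p [Lp cp] <-]; exists p => //; split=> //.
  exact: (cell_nested c2s2 s_gt0 s_le c_ge0 s_decr) cp.
- move=> m N _ _ [p [_ cp] <-] [q [_ cq] <-]; rewrite embed_dist.
  have := cell_siblings_dist c2s2 s_gt0 s_le c_ge0 s_decr cp cq.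
  move=> /(le_trans (gap_ge c2s2 s_gt0 c_ge0 m)).
  by move=> h; rewrite exprVn ler_pdivrMr ?exprn_gt0// [leRHS]mulrC.
- by move=> m; rewrite mulr_gt0// divr_gt0// exprn_gt0.
- move=> m; rewrite [2^-1 ^+ m.+1]exprS.
  have : s m.+1 ^+ 2 <= s m ^+ 2 by rewrite ler_pXn2r ?nnegrE ?(ltW (s_gt0 _)).
  move: (s m.+1 ^+ 2) (s m ^+ 2) => a b.
  by move=> ab; have := e0 m; move: (_ ^+ m) => e e0'; have h : a * e <= b * e; [rewrite ler_pM2r|lra].
- move=> B; have [M hM] := s_sum (2 * B); exists M.
  rewrite (eq_bigr (fun m : 'I_M => 2^-1 * s m ^+ 2)); first by rewrite -mulr_sumr; lra.
  by move=> m _; rewrite mulrCA -exprMn divff// expr1n mulr1 mulrC.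
- by rewrite cell_set0; exists (0, 0) => //; exact: limit_set_origin.
- move=> _ [p [_ cp] <-]; rewrite embed_dist.
  have [p0 _ _] := cp; rewrite /= in p0.
  have [/andP[a1 a2] a3 a4] := triangle_le1 c2s2 s_gt0 s_le c_ge0 cp; rewrite /= in a1 a2 a3 a4.
  apply: le_lt_trans (lerD (pdist_le _ _) (lexx _)) _.
  rewrite /= !sub0r !normrN !ger0_norm// expr0 mulr1.
  by have := s_le 0; have := s_gt0 0; nra.
- rewrite cell_set0; apply: (@lt_le_trans _ _ (2%:E * 1%:E)%E).
    by rewrite -EFinM lte_fin; lra.
  by apply: lee_wpmul2l embedded_diam_ge; rewrite lee_fin.
Qed.

(** [coded_lipschitz] with [p = q] makes the code unique, so that it becomes a function on the
    group. *)
Let code_exists : exists f : heisenberg R n -> R, forall p x, coded p x -> f (embed p) = x.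
Proof.
have /choice[f fP] : forall z, exists x, forall p, z = embed p -> limit_set p -> coded p x.
  move=> z; have [[p [zp Lp]]|none] := pselect (exists p, z = embed p /\ limit_set p).
    have [x px] := coded_exists c2s2 s_gt0 s_le c_ge0 s_decr Lp.
    exists x => q zq _; suff -> : q = p by [].
    have : pdist p q = 0 by rewrite -embed_dist -zp -zq mdistxxP.
    move=> d0; have := pdist_ge1 p q; have := pdist_ge2 p q; rewrite d0 !normr_le0 !subr_eq0.
    by case: p q {px Lp zp zq d0} => [? ?] [? ?] /= /eqP -> /eqP ->.
  by exists 0 => p zp Lp; case: none; exists p.
exists f => p x px; have px' := fP _ p erefl (coded_limit_set px).
apply/eqP; rewrite -subr_eq0 -normr_le0.
apply: le_trans (coded_lipschitz c2s2 s_gt0 s_le c_ge0 s_decr px' px) _.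
by rewrite -embed_dist mdistxxP mulr0.
Qed.

(** The code maps the cell onto a set containing the interior of its dyadic interval; 16 is twice
    its Lipschitz constant 8. *)
Lemma cell_set_length m N : (N < 2 ^ m)%N ->
  ((2^-1 ^+ m / 16)%:E <= hausdorff1 (cell_set m N))%E.
Proof.
move=> hN; have [f fP] := code_exists; have e0 : 0 < 2 ^+ m :> R by rewrite exprn_gt0.
have := @lipschitz_length_le R _ f 8 (N%:R / 2 ^+ m) (N.+1%:R / 2 ^+ m) (cell_set m N).
rewrite (_ : _ / (2 * 8) = 2^-1 ^+ m / 16); last first.
  rewrite -mulrBl (_ : N.+1%:R - N%:R = 1); last by rewrite -natr1 addrAC subrr add0r.
  by rewrite mul1r exprVn; congr (_ / _); rewrite -natrM.
apply=> // [_ _ [p [Lp _] <-] [q [Lq _] <-]|x].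
  have [x px] := coded_exists c2s2 s_gt0 s_le c_ge0 s_decr Lp.
  have [y qy] := coded_exists c2s2 s_gt0 s_le c_ge0 s_decr Lq.
  rewrite (fP _ _ px) (fP _ _ qy) embed_dist.
  exact: (coded_lipschitz c2s2 s_gt0 s_le c_ge0 s_decr px qy).
rewrite /= in_itv/= ltr_pdivrMr// ltr_pdivlMr// => /andP[x1 x2].
have [|p px] := @coded_point R c s c2s2 s_gt0 s_le c_ge0 s_decr x.
  have h : N.+1%:R <= 2 ^+ m :> R by rewrite -natrX ler_nat.
  have N0 : 0 <= N%:R :> R by [].
  by rewrite -(pmulr_lge0 _ e0) -(ltr_pM2r e0) mul1r; apply/andP; split; lra.
exists (embed p); last exact: fP.
exists p => //; split; first exact: coded_limit_set px.
have [N' [hN' cN' /andP[h1 h2]]] := px m; rewrite mulrC in h1 h2.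
suff -> : N = N' by [].
apply/eqP; rewrite eqn_leq; apply/andP; split; rewrite -ltnS -(@ltr_nat R).
  exact: lt_le_trans x1 h2.
exact: le_lt_trans h1 x2.
Qed.

End isotropic_set.

(** * Regularity of the set *)

Section isotropic_set_regularity.
Context {R : realType} {n : nat}.
Variables c s : nat -> R.
Hypothesis c2s2 : forall m, c m ^+ 2 + s m ^+ 2 = 1.
Hypothesis s_gt0 : forall m, 0 < s m.
Hypothesis s_le : forall m, s m <= 4^-1.
Hypothesis c_ge0 : forall m, 0 <= c m.
Hypothesis s_decr : forall m, s m.+1 <= s m.
Variables k l : 'I_n.
Hypothesis kl : k != l.
Implicit Types (p q : R * R) (z w : heisenberg R n) (S : set (heisenberg R n)).

Local Notation chart := (chart c s).
Local Notation unchart := (unchart c s).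
Local Notation cell := (cell c s).
Local Notation limit_set := (limit_set c s).
Local Notation coded := (coded c s).
Local Notation embed := (embed k l).
Local Notation cell_set := (cell_set c s k l).
Local Notation embedded_set := (embedded_set c s k l).

Let half_lt1 : 0 <= (2^-1 : R) < 1. Proof. by lra. Qed.

Let half_gt0 m : 0 < (2^-1 : R) ^+ m. Proof. by rewrite exprn_gt0. Qed.

Let length_le z (r : R) : embedded_set z -> 0 < r ->
  (hausdorff1 (ball z r `&` embedded_set) <= (64 * r)%:E)%E.
Proof.
move=> [p Lp <-] r0; have [x px] := coded_exists c2s2 s_gt0 s_le c_ge0 s_decr Lp.
apply: hausdorff1_le_cover => delta d0.
have [M1 hM1] := expr_small 2 half_lt1 d0.
have [M2 hM2] := expr_small 1 half_lt1 r0.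
pose M := maxn M1 M2; have {}hM1 := hM1 M (leq_maxl _ _); have {hM2} := hM2 M (leq_maxr _ _).
have e0 : 0 < 2 ^+ M :> R by rewrite exprn_gt0.
have eV : 2 ^+ M * 2^-1 ^+ M = 1 :> R by rewrite -exprMn divff// expr1n.
have h0 := half_gt0 M; rewrite mul1r => hM2.
(* Codes of points in the ball fill at most [[x - 8 r, x + 8 r]], so about [16 r 2^M] consecutive
   cells suffice. The shift by 1 and the 3 extra cells allow for rounding and for a code at the
   right end of its closed interval. *)
pose a := Num.truncn (2 ^+ M * (x - 8 * r) - 1); pose K := Num.truncn (16 * r * 2 ^+ M).
exists (K + 3)%N, (2 * 2^-1 ^+ M), (fun i => cell_set M (a + i)); split.
- by rewrite (ltW hM1) andbT mulr_ge0// ltW.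
- move=> w [pq [q Lq Eq]]; move: pq; rewrite -{}Eq ballEmdist/= (embed_dist kl) => pq.
  have [y qy] := coded_exists c2s2 s_gt0 s_le c_ge0 s_decr Lq.
  have [N [hN cN /andP[h1 h2]]] := qy M.
  have := coded_lipschitz c2s2 s_gt0 s_le c_ge0 s_decr px qy.
  rewrite ler_norml => /andP[h3 h4].
  have xy1 : 2 ^+ M * (x - 8 * r) <= 2 ^+ M * y by rewrite ler_pM2l//; lra.
  have xy2 : 2 ^+ M * y <= 2 ^+ M * (x + 8 * r) by rewrite ler_pM2l//; lra.
  have nS i : i.+1%:R = i%:R + 1 :> R by rewrite natr1.
  have aN : (a <= N)%N.
    by rewrite truncn_le_nat nS; lra.
  have NaK : (N - a < K + 3)%N.
    suff : (N < a + K + 3)%N by move: (a) (K); clear; lia.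
    rewrite -(@ltr_nat R) !natrD; apply: le_lt_trans h1 _.
    have : 2 ^+ M * (x - 8 * r) - 1 < a%:R + 1 by rewrite -nS truncnS_gt.
    have : 16 * r * 2 ^+ M < K%:R + 1 by rewrite -nS truncnS_gt.
    by lra.
  exists (N - a)%N => //=; rewrite subnKC//; exists q => //; split=> //.
- by move=> i; exact: (cell_set_diam c2s2 s_gt0 s_le c_ge0 kl).
- have KE : K%:R <= 16 * r * 2 ^+ M.
    by rewrite truncn_le// mulr_ge0 ?ltW//; lra.
  rewrite natrD.
  have : K%:R * 2^-1 ^+ M <= 16 * r by rewrite exprVn ler_pdivrMr.
  by nra.
Qed.

Let length_ge z (r : R) : embedded_set z -> 0 < r -> r < 4 ->
  ((64^-1 * r)%:E <= hausdorff1 (ball z r `&` embedded_set))%E.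
Proof.
move=> [p Lp <-] r0 r4.
have ex_small : exists m, 2 * (2^-1 : R) ^+ m < r.
  by have [m hm] := expr_small 2 half_lt1 r0; exists m; exact: hm.
case: (ex_minnP ex_small) => m mr mmin.
have rm : r <= 4 * 2^-1 ^+ m.
  case: m mr mmin => [|m] mr mmin; first by rewrite expr0; lra.
  have : ~~ (2 * 2^-1 ^+ m < r) by apply/negP => /mmin; rewrite ltnn.
  by rewrite -leNgt exprS; lra.
have [N hN cN] := Lp m.
apply: (@le_trans _ _ (2^-1 ^+ m / 16)%:E); first by rewrite lee_fin; lra.
apply: le_trans (cell_set_length c2s2 s_gt0 s_le c_ge0 s_decr kl hN) _.
apply: le_hausdorff1 => w wC; split; last by have [q [Lq _] <-] := wC; exists q.
rewrite ballEmdist/=; apply: le_lt_trans mr; rewrite -lee_fin.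
apply: le_trans (cell_set_diam c2s2 s_gt0 s_le c_ge0 kl _ N); apply: mdist_le_diam => //.
by exists p.
Qed.

Lemma embedded_Reg1 : Reg1 64 embedded_set.
Proof.
split=> [||| z r Ez r0 rd]; first by lra.
- exact: (embedded_closed c2s2 s_gt0 s_le c_ge0 kl).
- by apply: lt_le_trans (embedded_diam_ge c s_gt0 kl).
- apply/andP; split; last exact: length_le.
  apply: length_ge => //; rewrite -lte_fin; apply: lt_le_trans rd _.
  apply: (@le_trans _ _ (2%:E * 2%:E)%E); last by rewrite -EFinM lee_fin; lra.
  by apply: lee_wpmul2l; [rewrite lee_fin|exact: (embedded_diam_le c2s2 s_gt0 s_le c_ge0 kl)].
Qed.

End isotropic_set_regularity.

(** * Beta numbers of the set *)

Section isotropic_set_beta.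
Context {R : realType} {n : nat}.
Variables c s : nat -> R.
Hypothesis c2s2 : forall m, c m ^+ 2 + s m ^+ 2 = 1.
Hypothesis s_gt0 : forall m, 0 < s m.
Hypothesis s_le : forall m, s m <= 4^-1.
Hypothesis c_ge0 : forall m, 0 <= c m.
Hypothesis s_decr : forall m, s m.+1 <= s m.
Variables k l : 'I_n.
Hypothesis kl : k != l.
Implicit Types (p q : R * R) (z w : heisenberg R n) (S : set (heisenberg R n)).

Local Notation chart := (chart c s).
Local Notation unchart := (unchart c s).
Local Notation cell := (cell c s).
Local Notation limit_set := (limit_set c s).
Local Notation embed := (@embed R n k l).
Local Notation embedded_set := (embedded_set c s k l).

Let unchart_affine m N : exists a1 b1 d1 a2 b2 d2, forall w : R * R,
  unchart m N w = (a1 + b1 * w.1 + d1 * w.2, a2 + b2 * w.1 + d2 * w.2).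
Proof.
elim: m N => [|m ih] N.
  by exists 0, 1, 0, 0, 0, 1 => -[x y] /=; congr pair; ring.
have [a1 [b1 [d1 [a2 [b2 [d2 E]]]]]] := ih N./2; rewrite /=.
case: (odd N).
  exists (a1 + b1 * (1 - 2^-1 * c m) + d1 * (2^-1 * s m)),
    (b1 * (2^-1 * c m) - d1 * (2^-1 * s m)), (- b1 * (2^-1 * s m) - d1 * (2^-1 * c m)),
    (a2 + b2 * (1 - 2^-1 * c m) + d2 * (2^-1 * s m)),
    (b2 * (2^-1 * c m) - d2 * (2^-1 * s m)), (- b2 * (2^-1 * s m) - d2 * (2^-1 * c m)).
  by move=> w; rewrite E/=; congr pair; ring.
exists a1, (b1 * (2^-1 * c m) + d1 * (2^-1 * s m)), (b1 * (2^-1 * s m) - d1 * (2^-1 * c m)),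
  a2, (b2 * (2^-1 * c m) + d2 * (2^-1 * s m)), (b2 * (2^-1 * s m) - d2 * (2^-1 * c m)).
by move=> w; rewrite E/=; congr pair; ring.
Qed.

(** As [omega] vanishes on the isotropic plane, left translation within it is vector addition, so
    its affine lines are horizontal lines. *)
Let chart_line m N (h : R) : exists2 L, horizontal_lines R n L &
  forall x, L (embed (unchart m N (x, h))).
Proof.
have [a1 [b1 [d1 [a2 [b2 [d2 E]]]]]] := unchart_affine m N.
pose v := planar (lshift n k) (lshift n l) b1 b2.
have v0 : v != 0.
  apply/eqP => v0; have /(congr1 (chart m N)) : unchart m N (0, 0) = unchart m N (1, 0).
    have := congr1 (fun u : 'rV[R]_(n + n) => u 0 (lshift n k)) v0.
    have := congr1 (fun u : 'rV[R]_(n + n) => u 0 (lshift n l)) v0.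
    rewrite planar1 ?planar2 ?eq_lshift// !mxE !E => -> ->.
    by congr pair => /=; ring.
  by rewrite !(chartK c2s2) => -[] /eqP; rewrite eq_sym oner_eq0.
pose p0 := embed (a1 + d1 * h, a2 + d2 * h).
exists [set (p0 * Heis u 0)%g | u in [set u | u \in <[v]>%VS]].
  by exists p0, <[v]>%VS; rewrite dim_vline v0.
move=> x; exists (x *: v); first by rewrite /= memvZ// memv_line.
apply: heis_eq; rewrite heisE /=.
  by rewrite E planarZ planarD/=; congr planar; ring.
by rewrite planarZ omega_planar_isotropic !addr0.
Qed.

Lemma beta_infty_ge0 (L : set (set (heisenberg R n))) S : S !=set0 -> (0 <= beta_infty L S)%E.
Proof.
move=> [y Sy]; apply: le_ereal_inf_tmp => _ [A _ <-].
apply: (@le_trans _ _ (edist_inf A y * (fine (diam S))^-1%:E)%E); last first.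
  by apply: ereal_sup_ubound; exists y.
by rewrite mule_ge0 ?edist_inf_ge0// lee_fin invr_ge0 fine_ge0// diam_ge0.
Qed.

(** [m] is the last generation at which one cell contains [S], and the line is the parallel to its
    base at height [s m / 2], through the inner ends of both children. [S] bridges the gap of this
    cell, which bounds its diameter from below and forces [m] to grow as [d] shrinks. *)
Lemma embedded_beta_le S (d : R) : 0 < d -> S !=set0 -> S `<=` embedded_set ->
  (diam S <= d%:E)%E -> exists m,
  (beta_infty (horizontal_lines R n) S <= (4 * s m)%:E)%E /\
  2^-1 ^+ m * (s m ^+ 2 / 2) <= d.
Proof.
move=> d0 [z0 Sz0] SE Sd.
have half_lt1 : 0 <= (2^-1 : R) < 1 by lra.
have Sfin : diam S \is a fin_num by rewrite ge0_fin_numE ?diam_ge0// (le_lt_trans Sd)// ltry.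
pose D := fine (diam S); have D0 : 0 <= D by rewrite fine_ge0// diam_ge0.
have dD : diam S = D%:E by rewrite /D fineK.
have Dd : D <= d by rewrite -lee_fin -dD.
have dist_le p q : S (embed p) -> S (embed q) -> pdist p q <= D.
  by move=> Sp Sq; rewrite -(embed_dist kl) -lee_fin -dD; exact: mdist_le_diam.
have SL z : S z -> exists2 p, limit_set p & z = embed p by move=> /SE[p Lp <-]; exists p.
(* For [D = 0] the inverse is 0 by convention and beta vanishes; any late generation serves as
   [m]. *)
have [D00|Dpos] : D = 0 \/ 0 < D by case: ltrgtP D0 => //; [right|left].
  have [M hM] := expr_small 1 half_lt1 d0; have hd := hM M (leqnn M).
  exists M; split; last first.
    rewrite mul1r in hd; have e0 : 0 < (2^-1 : R) ^+ M by rewrite exprn_gt0.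
    apply: le_trans (ltW hd); rewrite ler_piMr ?(ltW e0)//.
    by have := s_gt0 M; have := s_le M; nra.
  have [L hL _] := chart_line 0 0 0.
  apply: (@le_trans _ _ 0%E); last by rewrite lee_fin mulr_ge0// ltW.
  apply: ereal_inf_le; exists (ereal_sup [set (edist_inf L y * (fine (diam S))^-1%:E)%E | y in S]).
    by exists L.
  apply: ge_ereal_sup => _ [y Sy <-].
  by rewrite -/D D00 invr0 mule0.
pose same m := `[< exists2 N, (N < 2 ^ m)%N & forall p, S (embed p) -> limit_set p -> cell m N p >].
have ex_diff : exists m, ~~ same m.
  apply: contrapT => /forallNP all_same.
  suff : D <= 0 by lra.
  apply: (@le_of_small _ _ _ 2 2^-1 half_lt1) => m; rewrite add0r.
  have /negP := all_same m; rewrite negbK => /asboolP[N _ SN].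
  rewrite -lee_fin -dD; apply: diam_le => [|x y /[dup] Sx /SL[p Lp Ep] /[dup] Sy /SL[q Lq Eq]].
    by rewrite lee_fin mulr_ge0// exprn_ge0.
  rewrite Ep in Sx *; rewrite Eq in Sy *; rewrite (embed_dist kl) lee_fin.
  rewrite exprVn ler_pdivlMr ?exprn_gt0// mulrC.
  by apply: (cell_diam c2s2 s_gt0 s_le c_ge0); exact: SN.
case: (ex_minnP ex_diff) => -[|m] /negP nm mmin.
  by case: nm; apply/asboolP; exists 0%N => // p _ Lp; have [[|//] _ ?] := Lp 0%N.
have /asboolP[N hN SN] : same m by apply: contrapT => /negP /mmin; rewrite ltnn.
have hL : (2 * N < 2 ^ m.+1)%N by rewrite expnS ltn_pmul2l.
have hR : (2 * N + 1 < 2 ^ m.+1)%N by rewrite expnS; move: hN; clear; lia.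
have child p : S (embed p) -> limit_set p -> cell m.+1 (2 * N) p \/ cell m.+1 (2 * N + 1) p.
  move=> Sp Lp; have [N1 hN1 cN1] := Lp m.+1.
  by have [E|E] := child_index c2s2 s_gt0 s_le c_ge0 s_decr hN (SN _ Sp Lp) hN1 cN1;
    rewrite -E; [left|right].
have [p [Sp Lp cp]] : exists p, [/\ S (embed p), limit_set p & cell m.+1 (2 * N) p].
  apply: contrapT => none; apply: nm; apply/asboolP; exists (2 * N + 1)%N => // p Sp Lp.
  by have [cp|//] := child p Sp Lp; case: none; exists p.
have [q [Sq Lq cq]] : exists q, [/\ S (embed q), limit_set q & cell m.+1 (2 * N + 1) q].
  apply: contrapT => none; apply: nm; apply/asboolP; exists (2 * N)%N => // q Sq Lq.
  by have [//|cq] := child q Sq Lq; case: none; exists q.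
have e0 : 0 < 2 ^+ m :> R by rewrite exprn_gt0.
have [L hLine LP] := chart_line m N (s m / 2).
exists m; split; last first.
  apply: le_trans Dd; rewrite mulrC exprVn ler_pdivrMr// [leRHS]mulrC.
  apply: le_trans (gap_ge c2s2 s_gt0 c_ge0 m) _.
  apply: le_trans (cell_siblings_dist c2s2 s_gt0 s_le c_ge0 s_decr cp cq) _.
  by rewrite ler_pM2l// dist_le.
apply: ereal_inf_le; exists (ereal_sup [set (edist_inf L y * (fine (diam S))^-1%:E)%E | y in S]).
  by exists L.
apply: ge_ereal_sup => _ [y Sy <-]; rewrite -/D.
have [r Lr Er] := SL y Sy; rewrite Er in Sy *.
have hdist u v : (chart m N v).1 - (chart m N u).1 <= 2 ^+ m * pdist u v.
  rewrite -(pdist_chart c2s2 m N) (le_trans _ (pdist_ge1 _ _))//.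
  by rewrite distrC ler_norm.
(* The height error at [r] is [s m] times the distance to the gap along the child, which is at most
   four times the horizontal distance to a point of [S] in the other child. *)
have near : `|(chart m N r).2 - s m / 2| <= 4 * s m * (2 ^+ m * D).
  have [_ p1 p2 _ _] := cell_childL c2s2 s_gt0 s_le c_ge0 s_decr cp.
  have [_ q1 q2 _ _] := cell_childR c2s2 s_gt0 s_le c_ge0 s_decr cq.
  have c1 : c m <= 1 := c_le1 c2s2 s_gt0 c_ge0 m.
  have s0 := s_gt0 m.
  have [cr|cr] := child r Sy Lr.
    have [_ r1 r2 _ r3] := cell_childL c2s2 s_gt0 s_le c_ge0 s_decr cr.
    apply: le_trans r3 _; rewrite -mulrA mulrCA ler_pM2l//.
    have h : 2 ^+ m * pdist r q <= 2 ^+ m * D by rewrite ler_pM2l// dist_le.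
    by have := hdist r q; lra.
  have [_ r1 r2 _ r3] := cell_childR c2s2 s_gt0 s_le c_ge0 s_decr cr.
  apply: le_trans r3 _; rewrite -mulrA mulrCA ler_pM2l//.
  have h : 2 ^+ m * pdist p r <= 2 ^+ m * D by rewrite ler_pM2l// dist_le.
  by have := hdist p r; lra.
apply: (@le_trans _ _ ((4 * s m * D)%:E * D^-1%:E)%E); last first.
  by rewrite -EFinM lee_fin mulfK// gt_eqF.
apply: lee_wpmul2r; first by rewrite lee_fin invr_ge0.
pose w := unchart m N ((chart m N r).1, s m / 2).
apply: le_trans (edist_inf_le _ (LP (chart m N r).1)) _; rewrite lee_fin (embed_dist kl).
rewrite -(ler_pM2l e0) -(pdist_chart c2s2 m N) (chartK c2s2).
apply: le_trans (pdist_le _ _) _; rewrite /= subrr normr0 add0r.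
by apply: le_trans near _; rewrite le_eqVlt; apply/orP; left; apply/eqP; ring.
Qed.

End isotropic_set_beta.

(** * Carleson sums generation by generation *)

Section carleson_sum.
Context {R : realType} {T : metricType R}.
Variables (E : set T) (c : R) (D : int -> set (set T)).
Hypothesis dyaD : dyadic_system c E D.

(** Each cube is assigned to one generation to which it belongs. Cubes of one generation are
    disjoint Borel sets, so those inside [Q0] contribute at most [g i] times the measure of [Q0]. *)
Lemma carleson_sum_le (f : set T -> \bar R) (g : nat -> R) (S : R) (gen : nat -> int) Q0 :
  (forall i, 0 <= g i) -> (forall m, \sum_(i < m) g i <= S) ->
  (forall Q, cubes E D Q -> exists i, [/\ dyadic_index E (gen i), D (gen i) Q & (f Q <= (g i)%:E)%E]) ->
  (\esum_(Q in [set Q | cubes E D Q /\ Q `<=` Q0]) (f Q * hausdorff1 Q) <= S%:E * hausdorff1 Q0)%E.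
Proof.
move=> g0 gS fg.
have /choice[i iP] : forall Q, exists i, cubes E D Q ->
    [/\ dyadic_index E (gen i), D (gen i) Q & (f Q <= (g i)%:E)%E].
  move=> Q; have [/fg[i iP]|nQ] := pselect (cubes E D Q); first by exists i.
  by exists 0%N.
suff key (X : seq (set T)) : uniq X -> (forall Q, Q \in X -> cubes E D Q /\ Q `<=` Q0) ->
    (\sum_(Q <- X) f Q * hausdorff1 Q <= S%:E * hausdorff1 Q0)%E.
  apply: ge_ereal_sup => _ [F [finF FA] <-]; rewrite fsbig_finite//.
  by apply: key => [|Q]; [exact: finmap.fset_uniq|rewrite in_fset_set// inE => /FA].
move=> uX XA; pose m := (\max_(Q <- X) i Q)%N.
have im Q : Q \in X -> (i Q < m.+1)%N by move=> QX; rewrite ltnS; exact: leq_bigmax_seq.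
rewrite (partition_big (fun Q => inord (i Q) : 'I_m.+1) predT)//=.
have Q0_ge0 : (0 <= hausdorff1 Q0)%E by exact: hausdorff1_ge0.
apply: (@le_trans _ _ (\sum_(j < m.+1) (g j)%:E * hausdorff1 Q0)%E); last first.
  rewrite -ge0_sume_distrl; last by move=> j _; rewrite lee_fin.
  by rewrite sumEFin; apply: lee_wpmul2r => //; rewrite lee_fin.
apply: lee_sum => j _; rewrite -big_filter.
pose Y := [seq Q <- X | (inord (i Q) : 'I_m.+1) == j].
have YP Q : Q \in Y -> [/\ dyadic_index E (gen j), D (gen j) Q, (f Q <= (g j)%:E)%E & Q `<=` Q0].
  rewrite mem_filter => /andP[/eqP ij QX]; have [cQ QQ0] := XA Q QX.
  by have [h1 h2 h3] := iP Q cQ; rewrite -ij inordK ?im.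
apply: (@le_trans _ _ (\sum_(Q <- Y) (g j)%:E * hausdorff1 (Q0 `&` Q))%E).
  rewrite -/Y big_seq [leRHS]big_seq; apply: lee_sum => Q /YP[_ _ fQ QQ0].
  rewrite (_ : Q0 `&` Q = Q); last by rewrite setIC; exact/setIidPl.
  apply: lee_wpmul2r => //; exact: hausdorff1_ge0.
rewrite -ge0_sume_distrr; last by move=> Q _; exact: hausdorff1_ge0.
apply: lee_wpmul2l; first by rewrite lee_fin.
apply: hausdorff1_caratheodory_sum => [|Q QY|Q Q' QY QY' QQ'].
- exact: filter_uniq.
- have [h1 h2 _ _] := YP Q QY; apply: borel_caratheodory.
  by have [] := dyadic_borel dyaD h1 h2.
- have [h1 h2 _ _] := YP Q QY; have [_ h2' _ _] := YP Q' QY'.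
  apply: contrapT => /eqP/set0P h; move/eqP: QQ'; apply.
  exact: (dyadic_disjoint dyaD h1 h2 h2' h).
Qed.

End carleson_sum.

(** * The choice of slopes and the geometric lemma *)

Section slowly_flattening_set.
Context {R : realType} {n : nat}.
Variables k l : 'I_n.
Hypothesis kl : k != l.

Let s m : R := (4 * Num.sqrt m.+1%:R)^-1.
Let c m : R := Num.sqrt (1 - s m ^+ 2).

Let E := embedded_set c s k l.

Let sqrt_ge1 m : 1 <= Num.sqrt m.+1%:R :> R.
Proof. by rewrite -{1}sqrtr1 ler_sqrt ?ler1n. Qed.

Let s_gt0 m : 0 < s m.
Proof. by rewrite invr_gt0; have := sqrt_ge1 m; lra. Qed.

Let s_le m : s m <= 4^-1.
Proof. by have h := sqrt_ge1 m; rewrite lef_pV2 ?posrE; lra. Qed.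

Let s_sq m : s m ^+ 2 = 16^-1 * m.+1%:R^-1.
Proof. by rewrite exprVn exprMn sqr_sqrtr// invfM; congr (_^-1 * _); ring. Qed.

Let s_decr m : s m.+1 <= s m.
Proof.
have h1 := sqrt_ge1 m; have h2 := sqrt_ge1 m.+1.
rewrite lef_pV2 ?posrE; [|lra..]; rewrite ler_pM2l// ler_sqrt// ler_nat//.
Qed.

Let c_ge0 m : 0 <= c m. Proof. exact: sqrtr_ge0. Qed.

Let c2s2 m : c m ^+ 2 + s m ^+ 2 = 1.
Proof.
rewrite sqr_sqrtr ?subrK// subr_ge0.
by have := s_gt0 m; have := s_le m; nra.
Qed.

Let s_sum B : exists M, B <= \sum_(m < M) s m ^+ 2.
Proof.
have [M hM] := harmonic_unbounded (16 * B); exists M.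
rewrite (eq_bigr (fun m : 'I_M => 16^-1 * m.+1%:R^-1)) => [|m _]; last exact: s_sq.
by rewrite -mulr_sumr; lra.
Qed.

(** The diameter is at most 2, so generations start at -1 or later; shifting by one indexes them by
    natural numbers. *)
Let E_index j : dyadic_index E j -> exists i : nat, j = i%:Z - 1.
Proof.
have d1 := embedded_diam_ge c s_gt0 kl; have d2 := embedded_diam_le c2s2 s_gt0 s_le c_ge0 kl.
rewrite -/E in d1 d2 => -[dE|[j0 /andP[h _] j0j]].
  by move: d2; rewrite dE leye_eq.
have : (2 : R) ^ (- j0) <= 2 ^ (1 : int) by rewrite -lee_fin (le_trans h).
rewrite ler_eXz2l ?ltr1n// => hj.
by exists (absz (j + 1)); rewrite gez0_abs; lia.
Qed.

Let beta_power_le (p : R) m i K : 0 < p -> (i.+1%:R <= K * m.+1%:R) -> 0 < K ->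
  (4 * s m) `^ p <= K `^ (p / 2) * i.+1%:R `^ (- (p / 2)).
Proof.
move=> p0 im K0.
have -> : 4 * s m = m.+1%:R `^ (- 2^-1).
  by rewrite powRN powR12_sqrt// /s invfM mulrA divff ?mul1r.
rewrite -powRrM mulNr [2^-1 * p]mulrC; set a := p / 2.
rewrite !powRN ler_pdivlMr ?powR_gt0// mulrC ler_pdivrMr ?powR_gt0//.
rewrite -powRM ?(ltW K0)//; apply: ge0_ler_powR => //; rewrite ?nnegrE ?mulr_ge0 ?(ltW K0)//.
by rewrite ltW// divr_gt0.
Qed.

(** For a cube of index [i], beta is controlled by a cell generation [m] with [i <= m0 + 2 m]: the
    gap [2^-m / (32 (m + 1))] is at most the diameter bound for the dilated cube, of order [2^-i],
    and [m + 1 <= 2^m] costs the second [m]. So the [p]-th power of beta is at most of order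
    [(i + 1)^(- p / 2)]. *)
Let E_GLem (c0 p : R) : 0 < c0 < 1 -> 2 < p ->
  GLem c0 (beta_infty (horizontal_lines R n)) p E.
Proof.
move=> /andP[c0_gt0 c0_lt1] p2; have p0 : 0 < p by lra.
have half_lt1 : 0 <= (2^-1 : R) < 1 by lra.
(* 192 is 32 from the gap times 6 from the diameter of the dilated cube. *)
have [m0 /(_ m0 (leqnn _)) hm0] := expr_small (192 / c0) half_lt1 ltr01.
pose K : R := m0.+2%:R; pose W := K `^ (p / 2).
have [S hS] : exists S, forall m, \sum_(j < m) j.+1%:R `^ (- (p / 2)) <= S :> R.
  by apply: riemann_bounded; lra.
exists (W * S) => D dyaD Q0 _.
apply: (carleson_sum_le (g := fun i => W * i.+1%:R `^ (- (p / 2)))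
  (gen := fun i => i%:Z - 1) dyaD).
- by move=> i; rewrite mulr_ge0 ?powR_ge0.
- by move=> m; rewrite -mulr_sumr ler_wpM2l ?powR_ge0.
move=> Q [j jE DQ]; have [i Ej] := E_index jE.
exists i; rewrite -Ej; split=> //.
have e0 i' : 0 < (2^-1 : R) ^+ i' by rewrite exprn_gt0.
have jexp : (2 : R) ^ (- j) = 2 * 2^-1 ^+ i.
  by rewrite Ej opprB expfzDr// expr1z -exprnN -exprVn.
have := dyadic_diam dyaD jE DQ; rewrite jexp => /diam_dilate2 Qd.
have [x Ex xQ] := dyadic_ball dyaD jE DQ.
have Qx : Q x.
  by apply: xQ; split=> //; apply: ballxx; rewrite mulr_gt0// jexp mulr_gt0.
have Sx : dilate 2 E Q x by apply: (dilate2_near Qx Ex); rewrite mdistxxP diam_ge0.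
have S0 : dilate 2 E Q !=set0 by exists x.
have dpos : 0 < 3 * (c0^-1 * (2 * 2^-1 ^+ i)) by rewrite !mulr_gt0// invr_gt0.
have [m [bm mi]] := embedded_beta_le c2s2 s_gt0 s_le c_ge0 s_decr kl dpos S0
  (fun y (yS : dilate 2 E Q y) => yS.1) (Qd _).
apply: le_trans (gt0_ler_poweR (ltW p0) _ _ bm) _.
- by rewrite in_itv/= leey andbT beta_infty_ge0.
- by rewrite in_itv/= leey andbT lee_fin mulr_ge0// ltW.
rewrite poweR_EFin lee_fin; apply: beta_power_le => //.
rewrite -natrM ler_nat.
suff : (i <= m0 + 2 * m)%N by move: (i) (m0) (m); clear; nia.
rewrite leqNgt; apply/negP => hi.
have {}hi : 2^-1 ^+ i <= 2^-1 ^+ m0 * 2^-1 ^+ m * 2^-1 ^+ m :> R.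
  by rewrite -!exprD; apply: ler_wiXn2l; [lra|lra|move: hi; clear; lia].
have mS : m.+1%:R * 2^-1 ^+ m <= 1 :> R.
  by rewrite exprVn ler_pdivrMr ?exprn_gt0// mul1r -natrX ler_nat ltn_expl.
have : 2^-1 ^+ m <= 192 / c0 * (m.+1%:R * 2^-1 ^+ i).
  move: mi; rewrite s_sq; set u := m.+1%:R; have u0 : 0 < u by rewrite ltr0n.
  have -> : 2^-1 ^+ m * (16^-1 * u^-1 / 2) = 2^-1 ^+ m / 32 / u by field; lra.
  by rewrite ler_pdivrMr//; lra.
have c192 : 0 < 192 / c0 by rewrite divr_gt0.
have u0 : 0 < m.+1%:R :> R by rewrite ltr0n.
move: hm0 mS hi (e0 m) (e0 m0) u0 c192.
move: (m.+1%:R) (192 / c0) (2^-1 ^+ m) (2^-1 ^+ m0) (2^-1 ^+ i) => u C a b d Cb ua dba a0 b0 u0 C0 h.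
have : C * (u * d) <= C * b * (u * a) * a.
  have -> : C * b * (u * a) * a = C * (u * (b * a * a)) by ring.
  by rewrite !ler_pM2l.
have : C * b * (u * a) * a < a.
  rewrite gtr_pMl//; apply: le_lt_trans Cb.
  by rewrite ler_piMr// mulr_ge0// ltW.
by lra.
Qed.

Lemma exists_regular1_GLem_not_in_curve : exists E : set (heisenberg R n),
  [/\ regular1 E,
      forall c0 p : R, 0 < c0 < 1 -> 2 < p ->
        GLem c0 (beta_infty (horizontal_lines R n)) p E &
      ~ exists2 Gamma, regular1_curve Gamma & E `<=` Gamma].
Proof.
exists E; split; [|exact: E_GLem|].
  by exists 64; exact: (embedded_Reg1 c2s2 s_gt0 s_le c_ge0 s_decr kl).
exact: (embedded_not_in_curve c2s2 s_gt0 s_le c_ge0 s_decr kl s_sum).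
Qed.

End slowly_flattening_set.

Theorem proposition4p37 (R : realType) (n : nat) (c0 : R -> R) :
  (1 < n)%N ->
  dyadic_constant (heisenberg R n) c0 ->
  (forall p : R, 1 <= p < 4 ->
     exists Gamma : set (heisenberg R n),
       regular1_curve Gamma /\
       forall C : R, Reg1 C Gamma ->
         ~ GLem (c0 C) (beta_infty (horizontal_lines R n)) p Gamma) /\
  (forall p : R, 2 < p ->
     exists E : set (heisenberg R n),
       [/\ regular1 E,
           forall C : R, Reg1 C E ->
             GLem (c0 C) (beta_infty (horizontal_lines R n)) p E &
           ~ exists2 Gamma, regular1_curve Gamma & E `<=` Gamma]).
Proof.
move=> n1 dc; split=> p.
  move=> /andP[p1 p4]; apply: exists_curve_not_GLem dc _; first exact: ltnW.
  by rewrite (lt_le_trans ltr01 p1).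
(* Two distinct indices below [n] span the isotropic plane. *)
move=> p2; have kl : Ordinal (ltnW n1) != Ordinal n1 by [].
have [E [regE gE nE]] := @exists_regular1_GLem_not_in_curve R n _ _ kl.
exists E; split=> // C [C1 _ _ _]; apply: gE p2.
by have [] := dc C C1.
Qed.
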